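(* Let $X\subset\mathbb{P}^N$ be a non-degenerate manifold of dimension $n$, and let $L\subset\mathbb{P}^N$ be a linear subspace of dimension $m$ which is tangent to $X$ along a closed subvariety $Y\subset X$ of dimension $r$. Then $$r\leq\min\{m-n,\ \dim SX-1-n\},$$ where $SX\subset\mathbb{P}^N$ is the secant variety of $X$.
   Context: We work over the complex numbers. A manifold $X\subset\mathbb{P}^N$ means an irreducible non-singular closed projective subvariety of $\mathbb{P}^N$; it is non-degenerate if it is not contained in any hyperplane of $\mathbb{P}^N$. For $x\in X$, $T_xX\subset\mathbb{P}^N$ denotes the embedded (projective) tangent space to $X$ at $x$, a linear subspace of dimension $n=\dim X$. A linear subspace $L\subset\mathbb{P}^N$ is tangent to $X$ along a closed subvariety $Y\subset X$ if $T_yX\subset L$ for every $y\in Y$. The secant variety $SX\subset\mathbb{P}^N$ is the closure of the union of all lines $\langle x,x'\rangle$ with $x,x'\in X$, $x\neq x'$.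
   Formalization: The linear subspace L is assumed to be proper (m < N); for L = P^N the claim fails, e.g. for X = Y a smooth conic in P^2, where n = r = 1, m = 2, SX = P^2 and the bound would be 0. *)

(* Defs.v *)
From HB Require Import structures.
From mathcomp Require Import all_boot all_order all_algebra.
From mathcomp Require Import boolp classical_sets reals complex mpoly.

Set Implicit Arguments.
Unset Strict Implicit.
Unset Printing Implicit Defensive.

Import Order.TTheory GRing.Theory Num.Theory.
Local Open Scope classical_set_scope.
Local Open Scope ring_scope.

(* A point of P^N is a line through the origin of K^(N+1). Accordingly, a      *)
(* projective linear subspace of dimension m is a subspace L of K^(N+1) with   *)
(* \dim L = m.+1, a point x lies on it iff (x <= L)%VS, and the span of two    *)
(* projective linear subspaces is their sum.                                   *)
Record proj (K : closedFieldType) (N : nat) := Proj {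
  pline :> {vspace 'rV[K]_N.+1};
  _ : \dim pline == 1%N }.

HB.instance Definition _ K N := [isSub for @pline K N].
HB.instance Definition _ K N := [Choice of proj K N by <:].

Section ProjectiveVarieties.
Variables (K : closedFieldType) (N : nat).
Implicit Types (x y z : proj K N) (A B X Y : set (proj K N)).
Implicit Types (f : {mpoly K[N.+1]}) (L : {vspace 'rV[K]_N.+1}).

Definition vanishes_at f x := forall v, v \in (x : {vspace _}) -> f.@[v 0] = 0.

Definition hom_ideal X : set {mpoly K[N.+1]} :=
  [set f | (exists d, f \is d.-homog) /\ forall x, X x -> vanishes_at f x].

Definition zclosed A := exists2 S : set {mpoly K[N.+1]},
  (forall f, S f -> exists d, f \is d.-homog) &
  A = [set x | forall f, S f -> vanishes_at f x].

Definition zclosure A := smallest zclosed A.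

Definition irreducible A := [/\ zclosed A, A !=set0 &
  forall B1 B2, zclosed B1 -> zclosed B2 -> A `<=` B1 `|` B2 ->
    A `<=` B1 \/ A `<=` B2].

Definition irred_chain A (k : nat) := exists Z : nat -> set (proj K N),
  (forall i, (i <= k)%N -> irreducible (Z i) /\ Z i `<=` A) /\
  (forall i, (i < k)%N -> Z i `<` Z i.+1).

Definition is_dim A (k : nat) :=
  irred_chain A k /\ forall j, irred_chain A j -> (j <= k)%N.

(* Krull dimension, with dimension -1 for the empty set. *)
Definition pdim A : int :=
  xget (-1) [set d : int | exists2 k : nat, d = k%:Z & is_dim A k].

Lemma pdimP A (k : nat) : pdim A = k%:Z <-> is_dim A k.
Proof.
rewrite /pdim; split; case: xgetP => [d -> [j -> Aj] | nA].
- by case=> <-.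
- by [].
- move=> Ak; congr (Posz _); apply/eqP; rewrite eqn_leq.
  by rewrite (Ak.2 _ Aj.1) (Aj.2 _ Ak.1).
- by move=> Ak; case: (nA k%:Z); exists k.
Qed.

Lemma vspace_of_set (S : set 'rV[K]_N.+1) :
    S 0 -> (forall a u v, S u -> S v -> S (a *: u + v)) ->
  exists U : {vspace 'rV[K]_N.+1}, forall w, w \in U <-> S w.
Proof.
move=> S0 Slin.
pose P d := `[< exists2 U : {vspace 'rV[K]_N.+1},
                  \dim U = d & forall w, w \in U -> S w >].
have exP : exists d, P d.
  exists 0%N; apply/asboolP; exists 0%VS; first by rewrite dimv0.
  by move=> w; rewrite memv0 => /eqP ->.
have ubP d : P d -> (d <= \dim {: 'rV[K]_N.+1})%N.
  by move=> /asboolP[U <- _]; apply/dimvS/subvf.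
case: (ex_maxnP exP ubP) => d /asboolP[U dU US] maxd.
exists U => w; split; first exact: US.
move=> Sw; have /maxd : P (\dim (U + <[w]>)%VS).
  apply/asboolP; exists (U + <[w]>)%VS => // _ /memv_addP[u uU [_ /vlineP[a ->] ->]].
  by rewrite addrC; apply: Slin => //; apply: US.
rewrite -dU => leU; have /eqP -> : U == (U + <[w]>)%VS.
  by rewrite eqEdim addvSl.
by rewrite memvE addvSr.
Qed.

(* The affine cone over T_x X: the common kernel of the differentials, at the  *)
(* vectors representing x, of the homogeneous polynomials vanishing on X.      *)
Definition tangent_cone X x : set 'rV[K]_N.+1 :=
  [set w | forall f v, hom_ideal X f -> v \in (x : {vspace _}) ->
     \sum_(i < N.+1) (f^`M(i)).@[v 0] * w 0 i = 0].

Lemma tangent_cone_vspace X x : exists U : {vspace 'rV[K]_N.+1},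
  forall w, w \in U <-> tangent_cone X x w.
Proof.
apply: vspace_of_set => [f v _ _ | a u1 u2 Tu1 Tu2 f v fX vx].
  by rewrite big1 // => i _; rewrite mxE mulr0.
transitivity (a * (\sum_(i < N.+1) (f^`M(i)).@[v 0] * u1 0 i)
              + \sum_(i < N.+1) (f^`M(i)).@[v 0] * u2 0 i).
  rewrite mulr_sumr -big_split; apply: eq_bigr => i _ /=.
  by rewrite !mxE mulrDr mulrCA.
by rewrite Tu1 // Tu2 // mulr0 addr0.
Qed.

Definition tangent_space X x : {vspace 'rV[K]_N.+1} :=
  sval (cid (tangent_cone_vspace X x)).

Definition nonsingular X :=
  forall x, X x -> (\dim (tangent_space X x))%:Z = pdim X + 1.

Definition manifold X := irreducible X /\ nonsingular X.

Definition non_degenerate X := forall H : {vspace 'rV[K]_N.+1},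
  \dim H = N -> ~ (forall x, X x -> (x <= H)%VS).

Definition tangent_along L X Y :=
  forall y, Y y -> (tangent_space X y <= L)%VS.

Definition secant_variety X := zclosure
  [set z | exists x x', [/\ X x, X x', x != x' & (z <= x + x')%VS]].

End ProjectiveVarieties.

(* Main.v *)
(* For X of dimension n and Y of dimension r in X, irreducible, along which L  *)
(* is tangent, it suffices to show that the union T of the tangent spaces of X *)
(* at the points of Y has dimension r + n: indeed T lies in L, and it is an    *)
(* irreducible closed subset of SX, proper because X lies in SX but in no      *)
(* hyperplane through L.                                                       *)
(* Let h be a linear form vanishing on L but not on X. For polynomial vector   *)
(* fields w tangent to X, let k >= 2 be the order to which h vanishes along Y, *)
(* that is, all iterated derivatives of h of order less than k vanish on the   *)
(* cone over Y, but D_w^k h does not for some w. At a point of Y, D_w^k h      *)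
(* depends only on the value of w there. Let v be the generic tangent vector   *)
(* at the generic point y of the cone over Y, and s the value of D_w^k h when  *)
(* w(y) = v. In a frame w'_a of tangent fields of degree G', dual to linear    *)
(* forms up to a factor g', the vector g' v has coordinates linear in v, so    *)
(* that g'^k s is a polynomial in v and y of degree k G' - (k - 1) in y. The   *)
(* polynomials g'^k have no common zero on Y, so for large M, s times any      *)
(* monomial of degree M in y lies in the span over K(v) of the monomials of    *)
(* degree M - (k - 1). Hence multiplication by s y_i^(k-1) preserves a nonzero *)
(* finite-dimensional space over K(v) and s y_i^(k-1) is algebraic over K(v).  *)
(* As k - 1 > 0, the ratios y_i / y_j are algebraic over K(v), so K(v) has     *)
(* transcendence degree at least r + n + 1, that is, T has dimension r + n.    *)

Require Import Defs.
From HB Require Import structures.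
From mathcomp Require Import all_boot all_order all_algebra all_field.
From mathcomp Require Import boolp classical_sets reals complex mpoly.

Set Implicit Arguments.
Unset Strict Implicit.
Unset Printing Implicit Defensive.

Import Order.TTheory GRing.Theory Num.Theory.
Local Open Scope classical_set_scope.
Local Open Scope ring_scope.

(** The tangent spaces along Y sweep out a variety T, the image of a family of dimension r + n, and
    everything follows once the general fibre of this family is finite: T lies in L, whence r + n <=
    m, and T is a proper irreducible closed subset of SX, whence r + n < dim SX ([tangency_bounds]).
    That T lies in SX is seen by differentiating the equations of SX along X ([secant_tangent]); T
    is proper because some hyperplane through L does not contain X ([hyperplane_through]).

    Finiteness of the fibre is a positivity argument. The linear form h of that hyperplane vanishes
    along Y to order at least 2 on X ([vorder2]), and to a finite order k ([finite_vorder]). The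
    k-th derivative of h along a tangent vector v is well defined at points of Y ([iterD_at]) and
    has degree 1 - k in the point of tangency when v is fixed. On the fibre over a general v it is
    thus a nonzero section of the negative line bundle O(1 - k), which a positive-dimensional
    projective variety does not carry. In algebraic form this is an eigenvalue argument
    ([cl_stable], [generic_tangent_rank]).

    Dimensions are transcendence degrees: closed sets are represented by generic points over
    extensions of K, and a chain of d + 1 irreducible sets amounts to d + 1 algebraically
    independent functions on the affine cone ([flag_indep], [indep_flag]). This rests on the
    exchange property of algebraic closure ([cl_exchange], [steinitz]) and on [specialization],
    which also yields the Nullstellensatz. *)

Lemma mpoly_ringind n (R : comNzRingType) (P : {mpoly R[n]} -> Prop) :
  (forall c, P c%:MP) -> (forall i, P 'X_i) ->
  (forall p q, P p -> P q -> P (p + q)) ->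
  (forall p q, P p -> P q -> P (p * q)) -> forall p, P p.
Proof.
move=> PC PX PD PM p; rewrite [p]mpolyE.
apply: (big_ind P) => [||m _]; [by rewrite -mpolyC0; apply: PC|exact: PD|].
rewrite -mul_mpolyC; apply: (PM) => //; rewrite mpolyXE_id.
apply: (big_ind P) => [||i _]; [by rewrite -mpolyC1; apply: PC|exact: PM|].
elim: (m i) => [|j IH]; first by rewrite expr0 -mpolyC1; apply: PC.
by rewrite exprS; apply: PM.
Qed.

(** * Algebraic closure and transcendence bases *)

Section GeneratedSubfield.
Variables (k F : fieldType) (f : {rmorphism k -> F}).
Implicit Types (S : set F).

(** The subfield of F generated by the image of k and S. Differences and quotients suffice: x * y is
    x / (1 / y), also for y = 0 since the inverse of 0 is 0. *)
Definition gen S : set F := [set x | forall D : set F,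
  (forall c, D (f c)) -> S `<=` D -> (forall x y, D x -> D y -> D (x - y)) ->
  (forall x y, D x -> D y -> D (x / y)) -> D x].

Lemma gen_sub S : S `<=` gen S.
Proof. by move=> x Sx D _ /(_ _ Sx). Qed.

Lemma gen_const S c : gen S (f c).
Proof. by move=> D /(_ c). Qed.

Lemma genB S x y : gen S x -> gen S y -> gen S (x - y).
Proof. by move=> gx gy D Dk DS DB DV; apply: (DB); [apply: gx|apply: gy]. Qed.

Lemma genV S x y : gen S x -> gen S y -> gen S (x / y).
Proof. by move=> gx gy D Dk DS DB DV; apply: (DV); [apply: gx|apply: gy]. Qed.

Definition genp S : {pred F} := fun x => `[< gen S x >].

Lemma genp_divring S : divring_closed (genp S).
Proof.
split=> [|x y /asboolP gx /asboolP gy|x y /asboolP gx /asboolP gy].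
- by apply/asboolP; rewrite -(rmorph1 f); apply: gen_const.
- by apply/asboolP; apply: genB.
- by apply/asboolP; apply: genV.
Qed.

HB.instance Definition _ S :=
  GRing.isDivringClosed.Build F (genp S) (genp_divring S).

Record genT S := GenT { genval :> F; _ : genval \in genp S }.

HB.instance Definition _ S := [isSub for @genval S].
HB.instance Definition _ S := [Choice of genT S by <:].
HB.instance Definition _ S := [SubChoice_isSubIntegralDomain of genT S by <:].
HB.instance Definition _ S := [SubIntegralDomain_isSubField of genT S by <:].

Lemma genTP S (x : genT S) : gen S (val x).
Proof. by case: x => y gy; apply/asboolP. Qed.

Lemma gen_in_subproof S c : f c \in genp S.
Proof. by apply/asboolP; apply: gen_const. Qed.

Definition gen_in S (c : k) : genT S := GenT (gen_in_subproof S c).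

Lemma gen_in_is_zmod_morphism S : zmod_morphism (gen_in S).
Proof. by move=> x y; apply: val_inj; rewrite /= rmorphB. Qed.

Lemma gen_in_is_monoid_morphism S : monoid_morphism (gen_in S).
Proof. by split=> [|x y]; apply: val_inj; rewrite /= ?rmorph1 ?rmorphM. Qed.

HB.instance Definition _ S := GRing.isZmodMorphism.Build k (genT S) (gen_in S)
  (gen_in_is_zmod_morphism S).
HB.instance Definition _ S := GRing.isMonoidMorphism.Build k (genT S) (gen_in S)
  (gen_in_is_monoid_morphism S).

End GeneratedSubfield.

Lemma mmap_ext n (R S : nzRingType) (f : R -> S) (a b : 'I_n -> S) (p : {mpoly R[n]}) :
  a =1 b -> mmap f a p = mmap f b p.
Proof.
by move=> ab; apply: eq_bigr => m _; congr (_ * _); apply: eq_bigr => i _; rewrite ab.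
Qed.

Section AlgebraicClosure.
Variables (k F : fieldType) (f : {rmorphism k -> F}).
Implicit Types (S : set F).

(** The relative algebraic closure of k(S) in F, viewed as a closure operator on sets whose
    transitivity and exchange property give transcendence degrees. *)
Definition cl S : set F :=
  [set x | algebraicOver (val : genT f S -> F) x].

Lemma algebraic_cl S (p : {poly F}) x :
  p != 0 -> (forall i, cl S p`_i) -> root p x -> cl S x.
Proof.
move=> p0 clp px; apply/integral_algebraic/(integral_root p0 px).
by apply/integral_poly => i; apply/integral_algebraic/clp.
Qed.

Lemma gen_cl S x : gen f S x -> cl S x.
Proof.
move=> gx; have gx' : x \in genp f S by apply/asboolP.
by rewrite (_ : x = val (GenT gx')) //; apply: algebraic_id.
Qed.

Lemma sub_cl S : S `<=` cl S.
Proof. by move=> x Sx; apply: gen_cl; apply: gen_sub. Qed.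

Lemma cl_const S c : cl S (f c).
Proof. by apply: gen_cl; apply: gen_const. Qed.

Lemma cl0 S : cl S 0. Proof. exact: algebraic0. Qed.
Lemma cl1 S : cl S 1. Proof. exact: algebraic1. Qed.
Lemma clB S x y : cl S x -> cl S y -> cl S (x - y).
Proof. exact: algebraic_sub. Qed.
Lemma clD S x y : cl S x -> cl S y -> cl S (x + y).
Proof. exact: algebraic_add. Qed.
Lemma clM S x y : cl S x -> cl S y -> cl S (x * y).
Proof. exact: algebraic_mul. Qed.
Lemma cl_div S x y : cl S x -> cl S y -> cl S (x / y).
Proof. exact: algebraic_div. Qed.
Lemma clX S x n : cl S x -> cl S (x ^+ n).
Proof.
move=> clx; elim: n => [|n IH]; first by rewrite expr0; apply: cl1.
by rewrite exprS; apply: clM.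
Qed.
Lemma cl_sum (I : Type) (r : seq I) (P : pred I) (G : I -> F) S :
  (forall i, P i -> cl S (G i)) -> cl S (\sum_(i <- r | P i) G i).
Proof. by move=> clG; apply: big_ind => //; [apply: cl0|move=> *; apply: clD]. Qed.
Lemma cl_mmap n (a : 'I_n -> F) S p : (forall i, cl S (a i)) -> cl S (mmap f a p).
Proof.
move=> cla; elim/mpoly_ringind: p => [c|i|p q IHp IHq|p q IHp IHq].
- by rewrite mmapC; apply: cl_const.
- by rewrite mmapX mmap1U.
- by rewrite rmorphD; apply: clD.
- by rewrite rmorphM; apply: clM.
Qed.

Lemma sub_gen_cl S T : S `<=` cl T -> gen f S `<=` cl T.
Proof.
move=> ST x /(_ (cl T)); apply => //; [exact: cl_const|exact: clB|exact: cl_div].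
Qed.

Lemma cl_trans S T : S `<=` cl T -> cl S `<=` cl T.
Proof.
move=> ST x [p p0 px]; apply: (algebraic_cl _ _ px).
  by rewrite map_poly_eq0.
by move=> i; rewrite coef_map; by apply: (sub_gen_cl ST); apply: genTP.
Qed.

Lemma cl_mono S T : S `<=` T -> cl S `<=` cl T.
Proof. by move=> ST; apply: cl_trans => x /ST; apply: sub_cl. Qed.

(** Clearing denominators: A is a subring containing k and S, so elements of k(S) are fractions of
    elements of A; an equation over k(S) is multiplied by the product of its denominators. *)
Lemma cl_clear S (A : F -> Prop) :
  (forall c, A (f c)) -> S `<=` A -> (forall x y, A x -> A y -> A (x - y)) ->
  (forall x y, A x -> A y -> A (x * y)) ->
  forall x, cl S x -> exists p : {poly F},
    [/\ p != 0, forall i, A p`_i & root p x].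
Proof.
move=> Af SA AB AM x [p p0 px].
have A0 : A 0 by rewrite -(rmorph0 f).
have A1 : A 1 by rewrite -(rmorph1 f).
have AN y : A y -> A (- y) by rewrite -sub0r; apply: AB.
have frac y : gen f S y -> exists u v, [/\ A u, A v, v != 0 & y = u / v].
  move/(_ [set y | exists u v, [/\ A u, A v, v != 0 & y = u / v]]).
  apply => /= [c|z Sz|y1 y2 [u1 [v1 [Au1 Av1 v10 ->]]] [u2 [v2 [Au2 Av2 v20 ->]]]
    |y1 y2 [u1 [v1 [Au1 Av1 v10 ->]]] [u2 [v2 [Au2 Av2 v20 ->]]]].
  - by exists (f c), 1; rewrite oner_neq0 divr1.
  - by exists z, 1; rewrite oner_neq0 divr1; split=> //; apply: SA.
  - exists (u1 * v2 - u2 * v1), (v1 * v2); rewrite mulf_neq0 //; split=> //.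
    + by apply: (AB); apply: (AM).
    + exact: AM.
    + by rewrite -mulNr addf_div // mulNr.
  - have [u20|u20] := eqVneq u2 0.
      by exists 0, 1; rewrite oner_neq0 u20 mul0r invr0 mulr0 divr1.
    exists (u1 * v2), (v1 * u2); rewrite mulf_neq0 //; split=> //; try exact: AM.
    by rewrite invf_div mulf_div.
have {}frac y : exists uv : F * F,
    gen f S y -> [/\ A uv.1, A uv.2, uv.2 != 0 & y = uv.1 / uv.2].
  have [/frac[u [v uv]]|ng] := pselect (gen f S y); first by exists (u, v).
  by exists (0, 0).
have [uv uvP] := choice frac.
pose q := map_poly val p : {poly F}.
have q0 : q != 0 by rewrite map_poly_eq0.
have gq i : gen f S q`_i by rewrite coef_map; apply: genTP.
pose d := \prod_(i < size q) (uv q`_i).2.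
have d0 : d != 0 by apply/prodf_neq0 => i _; have [] := uvP _ (gq i).
exists (d *: q); split.
- by rewrite scaler_eq0 negb_or d0.
- move=> i; rewrite coefZ; have [iq|iq] := ltnP i (size q); last first.
    by rewrite nth_default // mulr0.
  rewrite /d (bigD1 (Ordinal iq)) //=; have [Au Av v0 {2}->] := uvP _ (gq i).
  rewrite mulrC mulrA -[_ * (uv q`_i).2]mulrA mulVf // mulr1; apply: (AM) => //.
  by apply: big_ind => // j _; have [] := uvP _ (gq j).
- by rewrite rootE hornerZ (rootP px) mulr0.
Qed.

(** An equation of c over k(S, b) can be given coefficients polynomial in b over [cl S]; read as an
    equation in b, it has coefficients algebraic over k(S, c). *)
Lemma cl_exchange S b c :
  cl (b |` S) c -> ~ cl S c -> cl (c |` S) b.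
Proof.
move=> clc nclc.
pose A y := exists2 P : {poly F}, (forall i, cl S P`_i) & y = P.[b].
have [||x y|x y|p [p0 Ap pc]] := cl_clear (A := A) _ _ _ _ clc.
- move=> d; exists (f d)%:P; last by rewrite hornerC.
  by move=> i; rewrite coefC; case: eqP => _; [apply: cl_const|apply: cl0].
- move=> y [->|Sy]; [exists 'X|exists y%:P]; rewrite ?hornerX ?hornerC //.
    by move=> i; rewrite coefX; case: eqP => _; [apply: cl1|apply: cl0].
  by move=> i; rewrite coefC; case: eqP => _; [apply: sub_cl|apply: cl0].
- move=> [P clP ->] [Q clQ ->]; exists (P - Q); last by rewrite hornerD hornerN.
  by move=> i; rewrite coefB; apply: clB.
- move=> [P clP ->] [Q clQ ->]; exists (P * Q); last by rewrite hornerM.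
  by move=> i; rewrite coefM; apply: cl_sum => j _; apply: clM.
have /choice[P PP] : forall i, exists P : {poly F},
    (forall j, cl S P`_j) /\ p`_i = P.[b].
  by move=> i; have [P ? ?] := Ap i; exists P.
pose R := \sum_(i < size p) c ^+ i *: P i.
have RE j : R`_j = \sum_(i < size p) c ^+ i * (P i)`_j.
  by rewrite coef_sum; apply: eq_bigr => i _; rewrite coefZ.
apply: (@algebraic_cl _ R).
(* If R were zero, the coefficients of a suitable power of b would form a nonzero equation of c over
   [cl S]. *)
- apply: contra_notN nclc => /eqP R0.
  have /eqP p0' := p0; have : exists i, p`_i != 0.
    apply: contrapT => /forallNP p0i; apply: p0'; apply/polyP => i.
    by rewrite coef0; apply/eqP/negP => /negP; apply: p0i.
  move=> [i pi0]; have ip : (i < size p)%N.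
    by rewrite ltnNge; apply: contra pi0 => ?; rewrite nth_default.
  have [j Pij] : exists j, (P i)`_j != 0.
    apply: contrapT => /forallNP P0; move/negP: pi0; apply; rewrite (PP i).2.
    rewrite (_ : P i = 0) ?horner0 //; apply/polyP => j; rewrite coef0.
    by apply/eqP/negP => /negP; apply: P0.
  apply: (@algebraic_cl _ (\poly_(i < size p) (P i)`_j)).
  + apply: contraNneq Pij => /polyP/(_ i); rewrite coef_poly ip coef0.
    by move=> ->.
  + move=> i'; rewrite coef_poly; case: ifP => _; [exact: (PP i').1|exact: cl0].
  + apply/rootP; rewrite horner_poly; transitivity (R`_j).
      by rewrite RE; apply: eq_bigr => i' _; rewrite mulrC.
    by rewrite R0 coef0.
- move=> j; rewrite RE; apply: cl_sum => i _; apply: clM.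
    by apply: clX; apply: sub_cl; left.
  by apply: (cl_mono _ ((PP i).1 j)) => y; right.
- apply/rootP; rewrite /R horner_sum -[RHS](rootP pc) horner_coef.
  by apply: eq_bigr => i _; rewrite hornerZ (PP i).2 mulrC.
Qed.

(** Each entry is transcendental over those to its right; by exchange the order is immaterial
    ([ind_perm]). *)
Fixpoint ind (s : seq F) : Prop :=
  if s is x :: s' then ~ cl [set` s'] x /\ ind s' else True.

Lemma ind_cat s u : ind (s ++ u) -> ind u.
Proof. by elim: s => //= x s IH [_ /IH]. Qed.

Lemma ind_swap x y s : ind (x :: y :: s) -> ind (y :: x :: s).
Proof.
move=> /= [nx [ny inds]]; split; last split=> // clx.
- move=> cly; apply: nx; apply: (@cl_mono (y |` [set` s])).
    by move=> z [->|]; rewrite /= inE ?eqxx // => ->; rewrite orbT.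
  apply: cl_exchange => //; apply: cl_mono cly => z /=; rewrite inE.
  by move=> /orP[/eqP ->|]; [left|right].
- by apply: nx; apply: cl_mono clx => z /=; rewrite inE => ->; rewrite orbT.
Qed.

Lemma ind_perm s t : perm_eq s t -> ind s -> ind t.
Proof.
have front x s1 s2 : ind (s1 ++ x :: s2) -> ind (x :: s1 ++ s2).
  elim: s1 => //= z s1 IH [nz /IH/= [nx inds]]; apply: (@ind_swap z x (s1 ++ s2)).
  split=> //; apply: contra_not nz; apply: cl_mono => y /=.
  by rewrite !inE !mem_cat inE orbCA.
elim: t s => [|x t IH] s pst.
  by move/perm_nilP: pst => ->.
have xs : x \in s by rewrite (perm_mem pst) mem_head.
case/splitPr: xs pst => s1 s2 pst /front /= [nx inds].
have pst' : perm_eq (s1 ++ s2) t.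
  rewrite -(perm_cons x); apply: perm_trans pst; rewrite perm_sym.
  by rewrite (perm_catCA s1 [:: x] s2).
split; last exact: IH inds.
by apply: contra_not nx; apply: cl_mono => y /=; rewrite (perm_mem pst').
Qed.

Lemma steinitz s t : ind s -> {in s, forall x, cl [set` t] x} ->
  (size s <= size t)%N.
Proof.
(* u collects the entries of s that have already replaced entries of t. *)
suff main u : ind (s ++ u) -> {in s, forall x, cl [set` t ++ u] x} ->
    (size s <= size t)%N.
  by move=> inds clt; apply: (main [::]); rewrite !cats0.
elim: t s u => [|y t IH] s u.
  case: s => // x s /= [nx _] /(_ x (mem_head _ _)) clx; case: nx.
  by apply: cl_mono clx => z /=; rewrite mem_cat orbC => ->.
move=> inds clt.
have [?|/existsNP[x /not_implyP[sx ncx]]] :=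
    pselect (forall x, x \in s -> cl [set` t ++ u] x).
  exact/leqW/(IH s u).
case/splitPr: sx inds clt => s1 s2 inds clt.
have cly : cl [set` t ++ x :: u] y.
  have /cl_exchange : cl (y |` [set` t ++ u]) x.
    apply: cl_mono (clt x _); last by rewrite mem_cat inE eqxx orbT.
    by move=> z /=; rewrite inE => /orP[/eqP ->|]; [left|right].
  move=> /(_ ncx); apply: cl_mono => z [->|] /=.
    by rewrite mem_cat inE eqxx orbT.
  by rewrite !mem_cat inE => /orP[->|->]; rewrite ?orbT.
rewrite size_cat /= addnS ltnS -size_cat; apply: (IH _ (x :: u)).
  apply: ind_perm inds; rewrite -!catA perm_cat2l /=.
  by rewrite (perm_catCA [:: x] s2 u).
move=> z zs; apply: (@cl_trans [set` y :: t ++ u]); last first.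
  by apply: clt; move: zs; rewrite !mem_cat inE => /orP[->|->]; rewrite ?orbT.
move=> w /=; rewrite inE => /orP[/eqP -> //|wtu]; apply: sub_cl => /=.
by move: wtu; rewrite !mem_cat inE => /orP[->|->]; rewrite ?orbT.
Qed.

Lemma ind_basis (t : seq F) : exists t' : seq F, [/\ ind t', {subset t' <= t} &
  {in t, forall x, cl [set` t'] x}].
Proof.
elim: t => [|y t [t' [indt subt clt]]]; first by exists [::].
have [cly|ncly] := pselect (cl [set` t'] y).
  exists t'; split=> // x; first by move/subt => xt; rewrite in_cons xt orbT.
  by rewrite in_cons => /orP[/eqP ->|/clt].
exists (y :: t'); split=> //.
- move=> x; rewrite !in_cons => /orP[->//|/subt ->]; exact: orbT.
- move=> x; rewrite in_cons => /orP[/eqP ->|/clt].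
    by apply: sub_cl; rewrite /= mem_head.
  by apply: cl_mono => z /=; rewrite inE => ->; rewrite orbT.
Qed.

End AlgebraicClosure.

(** * Polynomials as univariate polynomials in the last variable *)

Local Notation widen i := (widen_ord (leqnSn _) i).

Section LastVariable.
Variables (n : nat) (R : comNzRingType).
Implicit Types (p q : {mpoly R[n.+1]}) (P Q : {poly {mpoly R[n]}}).

Lemma muni_Xmax : muni ('X_ord_max : {mpoly R[n.+1]}) = 'X.
Proof.
rewrite muniE msuppX big_seq1 mcoeffX eqxx !scale1r mnm1E eqxx expr1.
rewrite (_ : [multinom _ | i < n] = 0%MM) ?mpolyX0 ?scale1r //.
by apply/mnmP => i; rewrite mnmE mnm1E mnm0E -val_eqE /= gtn_eqF.
Qed.

Lemma muni_Xwiden i : muni ('X_(widen i) : {mpoly R[n.+1]}) = ('X_i)%:P.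
Proof.
rewrite muniE msuppX big_seq1 mcoeffX eqxx !scale1r mnm1E.
rewrite -val_eqE /= ltn_eqF // expr0 -[RHS]mulr1 mul_polyC.
by congr ('X_[_] *: _); apply/mnmP => j; rewrite !mnmE -val_eqE.
Qed.

Definition emb P : {mpoly R[n.+1]} := (map_poly (@mwiden n R) P).['X_ord_max].

Lemma muni_mwiden (p : {mpoly R[n]}) : muni (mwiden p) = p%:P.
Proof.
elim/mpoly_ringind: p => [c|i|p q IHp IHq|p q IHp IHq].
- by rewrite mwidenC muniC.
- by rewrite mwidenX mnmwiden1 muni_Xwiden.
- by rewrite mwidenD muniD IHp IHq polyCD.
- by rewrite mwidenM muniM IHp IHq polyCM.
Qed.

Lemma embK P : muni (emb P) = P.
Proof.
rewrite /emb; elim/poly_ind: P => [|P c IH]; first by rewrite rmorph0 horner0 muni0.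
rewrite rmorphD rmorphM /= map_polyX map_polyC hornerD hornerMX hornerC.
by rewrite muniD muniM IH muni_Xmax /= muni_mwiden.
Qed.

Lemma embD P Q : emb (P + Q) = emb P + emb Q.
Proof. by rewrite /emb (rmorphD (map_poly (@mwiden n R))) hornerD. Qed.

Lemma embM P Q : emb (P * Q) = emb P * emb Q.
Proof. by rewrite /emb (rmorphM (map_poly (@mwiden n R))) hornerM. Qed.

Lemma embC (q : {mpoly R[n]}) : emb q%:P = mwiden q.
Proof. by rewrite /emb map_polyC hornerC. Qed.

Lemma embX : emb 'X = 'X_ord_max.
Proof. by rewrite /emb map_polyX hornerX. Qed.

Lemma ord_maxP (i : 'I_n.+1) : (exists j, i = widen j) \/ i = ord_max.
Proof.
have [ni|ni] := ltnP i n; [left; exists (Ordinal ni)|right]; apply/val_inj=> //=.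
by apply/eqP; rewrite eqn_leq ni -ltnS ltn_ord.
Qed.

Lemma muniK p : emb (muni p) = p.
Proof.
elim/mpoly_ringind: p => [c|i|p q IHp IHq|p q IHp IHq].
- by rewrite muniC embC mwidenC.
- have [[j ->]|->] := ord_maxP i.
    by rewrite muni_Xwiden embC mwidenX mnmwiden1.
  by rewrite muni_Xmax embX.
- by rewrite (muniD p q) embD; apply: (congr2 _ IHp IHq).
- by rewrite (muniM p q) embM; apply: (congr2 _ IHp IHq).
Qed.

Lemma muni_eq0 p : (muni p == 0) = (p == 0).
Proof.
by apply/eqP/eqP => [p0|->]; rewrite ?muni0 // -[p]muniK p0 /emb rmorph0 horner0.
Qed.

Variables (S : comNzRingType) (f : {rmorphism R -> S}) (a : 'I_n.+1 -> S).

Let ev P := (map_poly (mmap f (fun i => a (widen i))) P).[a ord_max].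
Let evD P Q : ev (P + Q) = ev P + ev Q.
Proof. by rewrite /ev (rmorphD (map_poly _)) hornerD. Qed.
Let evM P Q : ev (P * Q) = ev P * ev Q.
Proof. by rewrite /ev (rmorphM (map_poly _)) hornerM. Qed.

Lemma mmap_muni p :
  mmap f a p = (map_poly (mmap f (fun i => a (widen i))) (muni p)).[a ord_max].
Proof.
rewrite -/(ev _); elim/mpoly_ringind: p => [c|i|p q IHp IHq|p q IHp IHq].
- by rewrite muniC /ev map_polyC hornerC /= !mmapC.
- have [[j ->]|->] := ord_maxP i.
  + by rewrite muni_Xwiden /ev map_polyC hornerC /= !mmapX !mmap1U.
  + by rewrite muni_Xmax /ev map_polyX hornerX mmapX mmap1U.
- by rewrite (muniD p q) evD (raddfD (mmap f a)); apply: (congr2 _ IHp IHq).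
- by rewrite (muniM p q) evM (rmorphM (mmap f a)); apply: (congr2 _ IHp IHq).
Qed.

Lemma mmap_emb P : mmap f a (emb P) =
  (map_poly (mmap f (fun i => a (widen i))) P).[a ord_max].
Proof. by rewrite mmap_muni embK. Qed.

Lemma mmap_mwiden (p : {mpoly R[n]}) :
  mmap f a (mwiden p) = mmap f (fun i => a (widen i)) p.
Proof. by rewrite mmap_muni muni_mwiden map_polyC hornerC. Qed.

End LastVariable.

Section InfiniteField.
Variable (K : fieldType).
Hypothesis K0 : [pchar K] =i pred0.

Lemma poly_nat_eval0 (p : {poly K}) : (forall i : nat, p.[i%:R] = 0) -> p = 0.
Proof.
move=> px; apply/eqP/negPn/negP => p0.
pose s := [seq i%:R : K | i <- iota 0 (size p)].
suff us : uniq s.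
  have ps : all (root p) s by apply/allP => _ /mapP[i _ ->]; apply/rootP.
  by have := max_poly_roots p0 ps us; rewrite size_map size_iota ltnn.
rewrite map_inj_uniq ?iota_uniq //.
suff inj i j : (i <= j)%N -> i%:R = j%:R :> K -> i = j.
  by move=> i j; case/orP: (leq_total i j) => /inj h; [exact: h|by move/esym/h->].
move=> ij e; have /eqP : (j - i)%:R = 0 :> K by rewrite natrB // e subrr.
move/pcharf0P: K0 => ->; rewrite subn_eq0 => ji; by apply/eqP; rewrite eqn_leq ij ji.
Qed.

Lemma poly_eval0 (p : {poly K}) : (forall x, p.[x] = 0) -> p = 0.
Proof. by move=> px; apply: poly_nat_eval0. Qed.

Lemma mpoly_eval0 n (p : {mpoly K[n]}) : (forall v, p.@[v] = 0) -> p = 0.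
Proof.
elim: n p => [|n IH] p pv.
  by move: (pv (fun=> 0)); rewrite [p]nvar0_mpolyC mevalC => ->; rewrite mpolyC0.
apply/eqP; rewrite -muni_eq0; apply/eqP/polyP => i; rewrite coef0.
apply: IH => v.
suff : map_poly (meval v) (muni p) = 0 by move/polyP/(_ i); rewrite coef_map coef0.
apply: poly_eval0 => x.
pose w (j : 'I_n.+1) := if unlift ord_max j is Some j' then v j' else x.
have /esym := pv w; rewrite /meval mmap_muni => ->.
rewrite /w unlift_none; congr (_.[_]); apply: eq_map_poly => q /=.
apply: meval_eq => j; rewrite (_ : widen j = lift ord_max j) ?liftK //.
by apply/val_inj; rewrite /= /bump leqNgt ltn_ord.
Qed.

End InfiniteField.

(** * Algebraic independence and transcendence degree *)

Section Independence.
Variables (k F : fieldType) (f : {rmorphism k -> F}).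

Definition aindep n (a : 'I_n -> F) :=
  forall q : {mpoly k[n]}, mmap f a q = 0 -> q = 0.

Lemma cl_rangeP n (a : 'I_n -> F) x : cl f (range a) x ->
  exists P : {poly {mpoly k[n]}},
    map_poly (mmap f a) P != 0 /\ root (map_poly (mmap f a) P) x.
Proof.
move=> clx; pose A y := exists q : {mpoly k[n]}, y = mmap f a q.
have [||y z|y z|p [p0 Ap px]] := cl_clear (A := A) _ _ _ _ clx.
- by move=> c; exists c%:MP; rewrite mmapC.
- by move=> _ [i _ <-]; exists 'X_i; rewrite mmapX mmap1U.
- by move=> [q ->] [r ->]; exists (q - r); rewrite rmorphB.
- by move=> [q ->] [r ->]; exists (q * r); rewrite rmorphM.
have [q qP] := choice Ap.
exists (\poly_(i < size p) q i); suff -> :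
  map_poly (mmap f a) (\poly_(i < size p) q i) = p by [].
apply/polyP => i; rewrite coef_map coef_poly /=; case: ltnP => [_|pi].
  by rewrite qP.
by rewrite rmorph0 nth_default.
Qed.

(** Reversed, so that the last variable heads the list: [ind] and [muni] then peel off the same
    element. *)
Let seq_of n (a : 'I_n -> F) := rev [seq a i | i <- enum 'I_n].

Let seq_ofS n (a : 'I_n.+1 -> F) :
  seq_of a = a ord_max :: seq_of (fun i => a (widen i)).
Proof.
by rewrite /seq_of enum_ordSr map_rcons rev_rcons -map_comp.
Qed.

Let set_seq_of n (a : 'I_n -> F) : [set` seq_of a] = range a.
Proof.
apply/seteqP; split=> [x|_ [i _ <-]] /=.
  by rewrite mem_rev => /mapP[i _ ->]; exists i.
by rewrite mem_rev map_f // mem_enum.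
Qed.

Lemma aindep_ind n (a : 'I_n -> F) : aindep a <-> ind f (seq_of a).
Proof.
elim: n a => [|n IH] a.
  rewrite /seq_of enum_ord0 /=; split=> // _ q.
  rewrite [q]nvar0_mpolyC mmapC => /eqP; rewrite fmorph_eq0 => /eqP ->.
  by rewrite mpolyC0.
rewrite seq_ofS /= set_seq_of; split=> [ai|[ncl /IH ai] q].
  split=> [/cl_rangeP[P [P0 Px]]|].
    move/eqP: P0; apply; rewrite (_ : P = 0) ?rmorph0 // -[P]embK.
    by rewrite (ai (emb P)) ?muni0 // mmap_emb; apply/rootP.
  by apply/IH => q; rewrite -mmap_mwiden => /ai/eqP; rewrite -muni_eq0 muni_mwiden
    polyC_eq0 => /eqP.
rewrite mmap_muni => q0; apply/eqP; rewrite -muni_eq0.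
apply: contra_notT ncl => q1; apply: algebraic_cl; last by apply/rootP; exact: q0.
  apply: contra q1 => /eqP/polyP q1; apply/eqP/polyP => i.
  by move/(_ i): q1; rewrite coef_map !coef0; apply: ai.
by move=> i; rewrite coef_map; apply: cl_mmap => j; apply: sub_cl; exists j.
Qed.

Lemma aindep_size n (a : 'I_n -> F) (t : seq F) :
  aindep a -> (forall i, cl f [set` t] (a i)) -> (n <= size t)%N.
Proof.
move=> /aindep_ind ai clt; have := steinitz ai (t := t).
rewrite size_rev size_map size_enum_ord; apply=> x.
by rewrite mem_rev => /mapP[i _ ->].
Qed.

Lemma aindep_sub n m (a : 'I_n -> F) (g : 'I_m -> 'I_n) : injective g ->
  aindep a -> aindep (a \o g).
Proof.
move=> inj ai q q0.
pose h := mmap (@mpolyC n k) (fun i => 'X_(g i)) : {mpoly k[m]} -> _.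
have hE r : mmap f a (h r) = mmap f (a \o g) r.
  rewrite /h; elim/mpoly_ringind: r => [c|i|p r IHp IHr|p r IHp IHr].
  - by rewrite !mmapC.
  - by rewrite !mmapX !mmap1U mmapX mmap1U.
  - by rewrite !(raddfD (mmap _ _)) /=; apply: congr2.
  - by rewrite !(rmorphM (mmap _ _)) /=; apply: congr2.
have h0 : h q = 0 by apply: ai; rewrite hE.
pose h' := mmap (@mpolyC m k) (fun i => if [pick j | g j == i] is Some j then 'X_j else 0)
   : {mpoly k[n]} -> {mpoly k[m]}.
suff h'K r : h' (h r) = r by rewrite -[q]h'K h0 /h' rmorph0.
rewrite /h /h'; elim/mpoly_ringind: r => [c|i|p r IHp IHr|p r IHp IHr].
- by rewrite !mmapC.
- rewrite !mmapX !mmap1U mmapX mmap1U; case: pickP => [j /eqP/inj -> //|/(_ i)].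
  by rewrite eqxx.
- by rewrite !(raddfD (mmap _ _)) /=; apply: congr2.
- by rewrite !(rmorphM (mmap _ _)) /=; apply: congr2.
Qed.

(** A basis t extracted from b, together with z, has every x_i in its closure; exchange gives n <=
    size t + size z, so t has at least R entries. *)
Lemma aindep_choose n M R (x : 'I_n -> F) (b : 'I_M -> F) (z : seq F) :
  aindep x -> (forall i, cl f (range b `|` [set` z]) (x i)) ->
  (R + size z <= n)%N -> exists I : 'I_R -> 'I_M, aindep (b \o I).
Proof.
move=> xi clx le.
have [t [it tb bt]] := ind_basis f (codom b).
have nt : (n <= size t + size z)%N.
  rewrite -size_cat; apply: (aindep_size xi) => i; apply: cl_trans (clx i) => y.
  case=> [[j _ <-]|/= yz].
    apply: cl_mono (bt (b j) (codom_f _ _)) => w /=.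
    by rewrite mem_cat => ->.
  by apply: sub_cl; rewrite /= mem_cat yz orbT.
have Rt : (R <= size t)%N by rewrite -(leq_add2r (size z)) (leq_trans le).
pose t' := drop (size t - R) t.
have it' : ind f t' by apply: (@ind_cat _ _ _ (take (size t - R) t)); rewrite cat_take_drop.
have st' : size t' = R by rewrite size_drop subKn.
have /choice[I IP] : forall i : 'I_R, exists j, b j = nth 0 (rev t') i.
  move=> i; have : nth 0 (rev t') i \in codom b.
    by apply/tb/(mem_drop (n0 := size t - R)); rewrite -/t' -mem_rev mem_nth // size_rev st'.
  by case/codomP => j ->; exists j.
exists I; apply/aindep_ind; rewrite (_ : seq_of _ = t') //.
apply: (can_inj revK); rewrite /seq_of revK.
apply: (@eq_from_nth _ 0); first by rewrite size_map size_enum_ord size_rev st'.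
move=> i; rewrite size_map size_enum_ord => iR.
by rewrite (nth_map (Ordinal iR)) ?size_enum_ord //= IP nth_enum_ord.
Qed.

End Independence.

(** * Specialization of points *)

Lemma irreducible_divisor (L : fieldType) (P : {poly L}) :
  (1 < size P)%N -> exists2 d, irreducible_poly d & d %| P.
Proof.
move=> P1; pose A n := `[< exists d : {poly L}, [/\ size d = n, (1 < n)%N & d %| P] >].
have exA : exists n, A n by exists (size P); apply/asboolP; exists P.
case: (ex_minnP exA) => n /asboolP[d [<- d1 dP]] dmin; exists d => //.
split=> // q q1 qd; rewrite -dvdp_size_eqp // eqn_leq dvdp_leq //=; last first.
  by rewrite -size_poly_gt0 (ltn_trans _ d1).
apply: dmin; apply/asboolP; exists q; split=> //; last exact: dvdp_trans dP.
rewrite ltn_neqAle eq_sym q1 size_poly_gt0 /=.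
by apply: contraTneq qd => ->; rewrite dvd0p -size_poly_gt0 (ltn_trans _ d1).
Qed.

Lemma root_extension (L : fieldType) (P : {poly L}) : (1 < size P)%N ->
  exists (L' : fieldType) (h : {rmorphism L -> L'}) (z : L'), root (map_poly h P) z.
Proof.
move=> /irreducible_divisor[d /irredp_FAdjoin[L' _ [z dz _]] dP].
exists L', (in_alg L'), z; move: dP; rewrite -(dvdp_map (in_alg L')) => /dvdpP[q ->].
by rewrite rootM dz orbT.
Qed.

Lemma cl_map (k L L' : fieldType) (j : {rmorphism k -> L}) (h : {rmorphism L -> L'}) x :
  cl j set0 x -> cl (h \o j) set0 (h x).
Proof.
move=> clx; have [|//|y z|y z|p [p0 Ap px]] := cl_clear (A := range j) _ _ _ _ clx.
- by move=> c; exists c.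
- by move=> [c _ <-] [d _ <-]; exists (c - d); rewrite ?rmorphB.
- by move=> [c _ <-] [d _ <-]; exists (c * d); rewrite ?rmorphM.
apply: (@algebraic_cl _ _ _ _ (map_poly h p)).
- by rewrite map_poly_eq0.
- by move=> i; rewrite coef_map; have [c _ <-] := Ap i; apply: (cl_const (h \o j)).
- by rewrite fmorph_root.
Qed.

Lemma cl_closed (K : closedFieldType) (L : fieldType) (j : {rmorphism K -> L}) x :
  cl j set0 x -> exists c, x = j c.
Proof.
move=> clx; have [|//|y z|y z|p [p0 Ap px]] := cl_clear (A := range j) _ _ _ _ clx.
- by move=> c; exists c.
- by move=> [c _ <-] [d _ <-]; exists (c - d); rewrite ?rmorphB.
- by move=> [c _ <-] [d _ <-]; exists (c * d); rewrite ?rmorphM.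
have /choice[c cP] : forall i, exists c, j c = p`_i by move=> i; have [c] := Ap i; exists c.
pose q := \poly_(i < size p) c i.
have qp : map_poly j q = p.
  apply/polyP => i; rewrite coef_map coef_poly /=; case: ltnP => [_|pi]; first exact: cP.
  by rewrite rmorph0 nth_default.
have [r rq] := closed_field_poly_normal q.
move: px p0; rewrite -qp rq linearZ /= rmorph_prod /= => px p0.
have q0 : j (lead_coef q) != 0.
  by apply: contraNneq p0 => ->; rewrite scale0r.
move: px; rewrite rootZ // (eq_bigr (fun y => 'X - (j y)%:P)).
  by rewrite -(big_map j predT (fun y => 'X - y%:P)) root_prod_XsubC => /mapP[y _ ->]; exists y.
by move=> y _; rewrite rmorphB /= map_polyX map_polyC.
Qed.

(* The points killing the relations of a correspond to homomorphisms on        *)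
(* k[a_1, .., a_n], and these extend across a further algebraic generator if  *)
(* the leading coefficient of a relation for it is not killed                 *)
(* (Atiyah-Macdonald, Proposition 5.23).                                      *)
Lemma specialization (k F : fieldType) (f : {rmorphism k -> F}) n (a : 'I_n -> F)
    (g : {mpoly k[n]}) : [pchar k] =i pred0 -> mmap f a g != 0 ->
  exists (L : fieldType) (j : {rmorphism k -> L}) (p : 'I_n -> L),
    [/\ forall i, cl j set0 (p i), forall q, mmap f a q = 0 -> mmap j p q = 0 &
      mmap j p g != 0].
Proof.
move=> k0; elim: n a g => [|n IH] a g g0.
  exists k, idfun, (fun=> 0); split=> [[]//|q|].
    by rewrite [q]nvar0_mpolyC !mmapC => /eqP; rewrite fmorph_eq0 => /eqP.
  by move: g0; rewrite [g]nvar0_mpolyC !mmapC fmorph_eq0.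
pose a' (i : 'I_n) := a (widen i); pose b := a ord_max.
pose Phi : {poly {mpoly k[n]}} -> {poly F} := map_poly (mmap f a').
have ext (L : fieldType) (j : {rmorphism k -> L}) (p : 'I_n -> L) (z : L) :
    exists p' : 'I_n.+1 -> L, (forall i, p' (widen i) = p i) /\ p' ord_max = z.
  exists (fun i => if unlift ord_max i is Some i' then p i' else z).
  rewrite unlift_none; split=> // i.
  rewrite (_ : widen i = lift ord_max i) ?liftK //.
  by apply/val_inj; rewrite /= /bump leqNgt ltn_ord.
(* If the last coordinate b is transcendental over the others, it can be sent anywhere: an integer
   is chosen at which the specialized g, as a polynomial in b, is nonzero. *)
have [algb|trb] := pselect
  (exists P : {poly {mpoly k[n]}}, Phi P != 0 /\ root (Phi P) b); last first.
  have : Phi (muni g) != 0.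
    by apply: contraNneq g0 => /= h; rewrite mmap_muni -/a' -/Phi h horner0.
  move=> Pg0; have [i gi0] : exists i, mmap f a' (muni g)`_i != 0.
    apply: contrapT => /forallNP gi; move/eqP: Pg0; apply; apply/polyP => i.
    by rewrite coef_map coef0; apply/eqP/negP => /negP; apply: gi.
  have [L [j [p [clp sp gp]]]] := IH a' _ gi0.
  have L0 : [pchar L] =i pred0 by move=> x; rewrite (fmorph_pchar j).
  pose Q := map_poly (mmap j p) (muni g).
  have [i' Qz] : exists i' : nat, Q.[i'%:R] != 0.
    apply: contrapT => /forallNP Qz; move/eqP: gp; apply.
    suff : Q = 0 by move/polyP/(_ i); rewrite coef_map coef0.
    by apply: poly_nat_eval0 => // i'; apply/eqP/negP => /negP; apply: Qz.
  have [p' [p'w p'm]] := ext L j p i'%:R.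
  have p'E q : mmap j p' q = (map_poly (mmap j p) (muni q)).[i'%:R].
    by rewrite mmap_muni p'm; congr (_.[_]); apply: eq_map_poly => r; apply: mmap_ext.
  exists L, j, p'; split.
  - move=> i''; have [[l ->]|->] := ord_maxP i''; rewrite ?p'w // p'm.
    by rewrite -(rmorph_nat j); apply: cl_const.
  - move=> q; rewrite mmap_muni p'E => q0; apply/eqP.
    rewrite (_ : map_poly _ _ = 0) ?horner0 //; apply/polyP => l.
    rewrite coef_map coef0; apply: sp; apply/eqP/negP => /negP ql.
    apply: trb; exists (muni q); split; last exact/rootP.
    by apply: contra ql => /eqP/polyP/(_ l); rewrite coef_map coef0 => ->.
  - by rewrite p'E.
(* In the algebraic case P is an equation of b of least degree: the pseudo-remainder by P of any
   relation then has coefficients vanishing at a'. *)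
have [P [[P0 Pb] Pmin]] : exists P : {poly {mpoly k[n]}}, (Phi P != 0 /\ root (Phi P) b) /\
    forall Q : {poly {mpoly k[n]}}, Phi Q != 0 -> root (Phi Q) b -> (size P <= size Q)%N.
  pose A s := `[< exists P : {poly {mpoly k[n]}}, [/\ size P = s, Phi P != 0 & root (Phi P) b] >].
  have exA : exists s, A s.
    by have [P [P0 Pb]] := algb; exists (size P); apply/asboolP; exists P.
  case: (ex_minnP exA) => s /asboolP[P [<- P0 Pb]] Pm; exists P; split=> // Q Q0 Qb.
  by apply: Pm; apply/asboolP; exists Q.
have Pn0 : P != 0 by apply: contraNneq P0 => ->; rewrite /Phi rmorph0.
have lc : mmap f a' (lead_coef P) != 0.
  apply: contraNneq Pn0 => lc.
  pose Q : {poly {mpoly k[n]}} := \poly_(i < (size P).-1) P`_i.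
  have PQ : Phi Q = Phi P.
    apply/polyP => i; rewrite !coef_map coef_poly /=; case: ltnP => // iP.
    have [->|ne] := eqVneq i (size P).-1; first by rewrite -lead_coefE lc rmorph0.
    rewrite nth_default //; move: iP ne; case: (size P) => //= s le ne.
    by rewrite ltn_neqAle eq_sym ne.
  have := Pmin Q; rewrite PQ => /(_ P0 Pb) le.
  have := leq_trans le (size_poly _ _).
  by case: (size P) (size_poly_eq0 P) => [<-|s _] //=; rewrite ltnn.
have sP : (1 < size P)%N.
  rewrite ltnNge; apply/negP => /size1_polyC Pc; move: P0 Pb.
  rewrite Pc /Phi map_polyC rootC polyC_eq0 /= => h1 h2; by rewrite h2 in h1.
(* An equation of g(a) with nonzero constant term: if this term survives specialization, the
   specialized g cannot be zero. *)
have [G [G0 Gg]] : exists G : {poly {mpoly k[n]}},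
    mmap f a' G`_0 != 0 /\ root (Phi G) (mmap f a g).
  have clg : cl f (range a') (mmap f a g).
    apply: cl_mmap => i; have [[l ->]|->] := ord_maxP i.
      by apply: sub_cl; exists l.
    apply: (@algebraic_cl _ _ _ _ (Phi P)) => // l; rewrite coef_map.
    by apply: cl_mmap => l'; apply: sub_cl; exists l'.
  have [G [G0 Gg]] := cl_rangeP clg.
  have {G0} exG : exists s, (fun s => `[<
      exists G : {poly {mpoly k[n]}}, [/\ size G = s, Phi G != 0 & root (Phi G) (mmap f a g)] >]) s.
    by exists (size G); apply/asboolP; exists G.
  case: (ex_minnP exG) => s /asboolP[H [<- H0 Hg]] Hm; exists H; split=> //.
  apply: contraNneq H0 => H00.
  have [//|H1] := eqVneq (Phi H) 0.
  pose H' : {poly {mpoly k[n]}} := \poly_(i < (size H).-1) H`_i.+1.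
  have HH : Phi H = Phi H' * 'X.
    apply/polyP => -[|i]; rewrite coefMX !coef_map //= coef_poly.
    case: ltnP => // iH; rewrite nth_default //.
    by move: iH; case: (size H).
  have H'0 : Phi H' != 0 by apply: contraNneq H1 => h; rewrite HH h mul0r.
  have : (size H <= size H')%N.
    apply: Hm; apply/asboolP; exists H'; split=> //.
    by move: Hg; rewrite HH rootM [X in _ || X]rootE hornerX (negPf g0) orbF.
  move=> le; have := leq_trans le (size_poly _ _).
  case: (size H) (size_poly_eq0 H) => [|s' _] /=; last by rewrite ltnn.
  by move=> /esym/eqP Hz _; move: H1; rewrite Hz /Phi rmorph0 eqxx.
have lcG : mmap f a' (lead_coef P * G`_0) != 0 by rewrite rmorphM mulf_neq0.
have [L1 [j1 [p1 [clp1 sp1 gp1]]]] := IH _ _ lcG.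
move: gp1; rewrite rmorphM mulf_eq0 negb_or => /andP[lc1 G1].
have [L [h [z Pz]]] : exists (L : fieldType) (h : {rmorphism L1 -> L}) (z : L),
    root (map_poly h (map_poly (mmap j1 p1) P)) z.
  by apply: root_extension; rewrite size_map_poly_id0.
pose j : {rmorphism k -> L} := h \o j1.
have hE m (w : 'I_m -> L1) q : h (mmap j1 w q) = mmap j (h \o w) q.
  elim/mpoly_ringind: q => [c|i|p r IHp IHr|p r IHp IHr].
  - by rewrite !mmapC.
  - by rewrite !mmapX !mmap1U.
  - by rewrite !(raddfD (mmap _ _)) rmorphD; apply: congr2.
  - by rewrite !(rmorphM (mmap _ _)) rmorphM; apply: congr2.
have [p' [p'w p'm]] := ext L j (h \o p1) z.
pose Psi : {poly {mpoly k[n]}} -> {poly L} := map_poly (mmap j (h \o p1)).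
have p'E q : mmap j p' q = (Psi (muni q)).[z].
  by rewrite mmap_muni p'm; congr (_.[_]); apply: eq_map_poly => r; apply: mmap_ext.
have PsiP : root (Psi P) z.
  rewrite (_ : Psi P = map_poly h (map_poly (mmap j1 p1) P)) //.
  by apply/polyP => i; rewrite !coef_map /= hE.
have evS m (w : 'I_m.+1 -> L) (i : {rmorphism k -> L}) (G' : {poly {mpoly k[m]}}) r :
    mmap i w (map_poly (@mwiden m k) G').[r] =
    (map_poly (mmap i (fun l => w (widen l))) G').[mmap i w r].
  rewrite -(horner_map (mmap i w)) -map_poly_comp /=.
  by congr (_.[_]); apply: eq_map_poly => c /=; rewrite mmap_mwiden.
have Psi0 (Q : {poly {mpoly k[n]}}) :
    (forall i, mmap f a' Q`_i = 0) -> Psi Q = 0.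
  move=> Q0; apply/polyP => i; rewrite coef_map coef0 /= -hE.
  by rewrite (sp1 _ (Q0 i)) rmorph0.
have sp q : mmap f a q = 0 -> mmap j p' q = 0.
  rewrite mmap_muni p'E => q0.
  have := Pdiv.ComRing.rdivp_eq P (muni q).
  set e := Pdiv.CommonRing.rscalp _ _; set Q := Pdiv.CommonRing.rdivp _ _.
  set T := Pdiv.CommonRing.rmodp _ _ => eq.
  have T0 i : mmap f a' T`_i = 0.
    apply/eqP/negP => /negP Ti.
    have : (size P <= size T)%N.
      apply: Pmin; first by apply: contra Ti => /eqP/polyP/(_ i); rewrite coef_map coef0 => ->.
      move/(congr1 Phi): eq; rewrite /Phi rmorphD rmorphM /= => /(congr1 (horner^~ b)).
      rewrite hornerD hornerM (rootP Pb) mulr0 add0r => eq; apply/rootP; rewrite -eq.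
      by rewrite -mul_polyC rmorphM hornerM [X in _ * X]q0 mulr0.
    by rewrite leqNgt Pdiv.CommonRing.ltn_rmodpN0.
  move/(congr1 Psi): eq; rewrite /Psi rmorphD rmorphM /= -/Psi (Psi0 _ T0) addr0.
  move/(congr1 (horner^~ z)); rewrite hornerM (rootP PsiP) mulr0.
  rewrite -mul_polyC /Psi rmorphM hornerM /= map_polyC hornerC /= -hE rmorphXn rmorphXn /=.
  by move/eqP; rewrite mulf_eq0 expf_eq0 fmorph_eq0 (negPf lc1) andbF => /eqP.
exists L, j, p'; split=> //.
- move=> i; have [[l ->]|->] := ord_maxP i; rewrite ?p'w /= ?p'm.
    exact: cl_map.
  apply: (@algebraic_cl _ _ _ _ (Psi P)) => //.
    apply: contraNneq lc1 => /polyP/(_ (size P).-1).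
    by rewrite coef_map coef0 /= -hE => /eqP; rewrite fmorph_eq0.
  by move=> i'; rewrite coef_map /= -hE; apply/cl_map/cl_mmap => l; apply: clp1.
- apply: contraNneq G1 => g1.
  have := sp (map_poly (@mwiden n k) G).[g].
  have -> : mmap f a (map_poly (@mwiden n k) G).[g] = (Phi G).[mmap f a g].
    rewrite -(horner_map (mmap f a)) -map_poly_comp /=.
    by congr (_.[_]); apply: eq_map_poly => c /=; rewrite mmap_mwiden.
  move=> /(_ (rootP Gg)); rewrite evS g1 horner_coef0 coef_map /=.
  rewrite (@mmap_ext _ _ _ _ _ (h \o p1)) //.
  by rewrite -hE => /eqP; rewrite fmorph_eq0.
Qed.

(** * Generic points and the Nullstellensatz *)

Section Ideals.
Local Open Scope quotient_scope.
Variable A : comNzRingType.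
Implicit Types (P J : set A).

Definition ideal P :=
  [/\ P 0, forall x y, P x -> P y -> P (x + y) & forall a x, P x -> P (a * x)].

Definition prime_ideal P :=
  [/\ ideal P, ~ P 1 & forall x y, P (x * y) -> P x \/ P y].

Lemma idealB P x y : ideal P -> P x -> P y -> P (x - y).
Proof.
by move=> [_ PD PM] Px Py; apply: PD => //; rewrite -mulN1r; apply: PM.
Qed.

Lemma ideal_sum P (I : Type) (r : seq I) (Q : pred I) (G : I -> A) : ideal P ->
  (forall i, Q i -> P (G i)) -> P (\sum_(i <- r | Q i) G i).
Proof. by move=> [P0 PD _] PG; apply: big_ind. Qed.

Lemma prime_avoiding_powers J x : ideal J -> (forall n, ~ J (x ^+ n)) ->
  exists P, [/\ prime_ideal P, J `<=` P & ~ P x].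
Proof.
move=> idJ Jx; have [J0 JD JM] := idJ.
pose T := {I : set A | [/\ ideal I, J `<=` I & forall n, ~ I (x ^+ n)]}.
pose R (I1 I2 : T) := `[< sval I1 `<=` sval I2 >].
have t0 : T by exists J; split=> //; exact: subset_refl.
have [| | |C totC|[M [idM JM' Mx]] Mmax] := @Zorn T R.
- move=> I; apply/asboolP; exact: subset_refl.
- by move=> I1 I2 I3 /asboolP s12 /asboolP s23; apply/asboolP => y /s12/s23.
- move=> [I1 p1] [I2 p2] /asboolP /= s12 /asboolP /= s21.
  by apply: eq_exist => /=; apply/seteqP.
- have [[I0 CI0]|nC] := pselect (exists I, C I); last first.
    by exists t0 => I CI; case: nC; exists I.
  pose U := [set y | exists2 I : T, C I & sval I y].
  have pU : [/\ ideal U, J `<=` U & forall n, ~ U (x ^+ n)].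
    split; first split.
    + by exists I0 => //; case: (svalP I0) => -[].
    + move=> y z [I1 C1 I1y] [I2 C2 I2z]; case: (totC _ _ C1 C2) => /asboolP s.
        exists I2 => //; case: (svalP I2) => -[_ D _] _ _; apply: D => //; exact: s.
      exists I1 => //; case: (svalP I1) => -[_ D _] _ _; apply: D => //; exact: s.
    + move=> a y [I1 C1 I1y]; exists I1 => //.
      by case: (svalP I1) => -[_ _ M] _ _; apply: M.
    + by move=> y Jy; exists I0 => //; case: (svalP I0) => _ s _; apply: s.
    + by move=> n [I1 _]; case: (svalP I1) => _ _; apply.
  exists (exist _ U pU) => I CI; apply/asboolP => y Iy; by exists I.
exists M; split=> //; last by move=> ?; apply: (Mx 1%N); rewrite expr1.
have [M0 MD MM] := idM.
have ext y : ~ M y -> exists n, exists m a, M m /\ x ^+ n = m + a * y.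
  move=> nMy; pose I := [set z | exists m a, M m /\ z = m + a * y].
  apply: contrapT => /forallNP nI.
  have pI : [/\ ideal I, J `<=` I & forall n, ~ I (x ^+ n)].
    split=> //.
    - split.
      + by exists 0, 0; rewrite mul0r addr0.
      + move=> _ _ [m [a [Mm ->]]] [m' [a' [Mm' ->]]].
        by exists (m + m'), (a + a'); rewrite mulrDl addrACA; split=> //; apply: MD.
      + move=> b _ [m [a [Mm ->]]].
        by exists (b * m), (b * a); rewrite mulrDr mulrA; split=> //; apply: MM.
    - by move=> z /JM' Mz; exists z, 0; rewrite mul0r addr0.
  have MI : M `<=` I by move=> z Mz /=; exists z, 0; rewrite mul0r addr0.
  have e := Mmax (exist _ I pI) (asboolT MI).
  apply: nMy; have : I y by exists 0, 1; rewrite mul1r add0r; split.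
  by move/(congr1 sval): e => /= <-.
split=> //.
  by move=> M1; apply: (Mx 0%N); rewrite expr0.
move=> y z Myz; apply: contrapT => /not_orP[/ext[n [m [a [Mm yE]]]] /ext[n' [m' [a' [Mm' zE]]]]].
apply: (Mx (n + n')%N); rewrite exprD yE zE mulrDr.
apply: (MD); first exact: MM.
rewrite mulrDl; apply: (MD); first by rewrite mulrC; apply: MM.
by rewrite mulrACA; apply: MM.
Qed.

Section ResidueField.
Variables (P : set A) (primeP : prime_ideal P).

Let p : {pred A} := fun x => `[< P x >].

Let p_ideal : idealr_closed p.
Proof.
have [[P0 PD PM] P1 _] := primeP; split.
- exact/asboolP.
- exact/asboolP.
- move=> a x y /asboolP Px /asboolP Py; apply/asboolP/PD => //; exact: PM.
Qed.
HB.instance Definition _ := isIdealr.Build A p p_ideal.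

Let p_prime : prime_idealr_closed p.
Proof.
have [_ _ PM] := primeP; move=> x y /asboolP/PM[Px|Py]; apply/orP.
  by left; apply/asboolP.
by right; apply/asboolP.
Qed.
HB.instance Definition _ := isPrimeIdealrClosed.Build A p p_prime.

Local Notation Q := {ideal_quot p}.

Let pi_eq0 x : (\pi_Q x == 0) = (x \in p).
Proof. by rewrite -[0](rmorph0 \pi_Q) -Quotient.idealrBE subr0. Qed.

Let Q_unit : {pred Q} := fun x => `[< exists y, y * x = 1 >].
Let Q_inv x : Q := xget x [set y | y * x = 1].

Let Q_mulVx : {in Q_unit, left_inverse 1 Q_inv *%R}.
Proof. by move=> x /asboolP[y yx]; rewrite /Q_inv; case: xgetP => // /(_ y). Qed.

Let Q_unitP x y : y * x = 1 -> Q_unit x.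
Proof. by move=> yx; apply/asboolP; exists y. Qed.

Let Q_inv_out : {in [predC Q_unit], Q_inv =1 id}.
Proof.
move=> x /asboolPn nx; rewrite /Q_inv; case: xgetP => // y _ yx.
by case: nx; exists y.
Qed.

HB.instance Definition _ := GRing.ComNzRing_hasMulInverse.Build Q
  Q_mulVx Q_unitP Q_inv_out.

Let Q_domain : GRing.integral_domain_axiom Q.
Proof. exact: Quotient.rquot_IdomainAxiom. Qed.

HB.instance Definition _ := GRing.ComUnitRing_isIntegral.Build Q Q_domain.

(** The map to the fraction field of A / P turns membership in P into vanishing. *)
Lemma residue_field : exists (F : fieldType) (h : {rmorphism A -> F}),
  forall x, h x = 0 <-> P x.
Proof.
exists {fraction Q}, (@FracField.tofrac Q \o \pi_Q) => x; rewrite /=.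
split=> [/eqP|Px]; first by rewrite tofrac_eq0 pi_eq0 => /asboolP.
by apply/eqP; rewrite tofrac_eq0 pi_eq0; apply/asboolP.
Qed.

End ResidueField.
End Ideals.

(** * Substitution and homogeneous components *)

Section Composition.
Variables (n m : nat) (R S : comNzRingType) (f : {rmorphism R -> S}).

Definition subst (g : 'I_m -> {mpoly R[n]}) : {mpoly R[m]} -> {mpoly R[n]} :=
  mmap (@mpolyC n R) g.

Lemma mmap_subst (g : 'I_m -> {mpoly R[n]}) (a : 'I_n -> S) q :
  mmap f a (subst g q) = mmap f (fun i => mmap f a (g i)) q.
Proof.
rewrite /subst; elim/mpoly_ringind: q => [c|i|p r IHp IHr|p r IHp IHr].
- by rewrite !mmapC.
- by rewrite !mmapX !mmap1U.
- by rewrite !(raddfD (mmap _ _)) /=; apply: congr2.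
- by rewrite !(rmorphM (mmap _ _)) /=; apply: congr2.
Qed.

Lemma mmap_map_mpoly (T : comNzRingType) (h : {rmorphism S -> T}) (a : 'I_n -> T) p :
  mmap h a (map_mpoly f p) = mmap (h \o f) a p.
Proof.
elim/mpoly_ringind: p => [c|i|p r IHp IHr|p r IHp IHr].
- by rewrite map_mpolyC !mmapC.
- by rewrite map_mpolyX !mmapX !mmap1U.
- by rewrite (raddfD (map_mpoly _)) !(raddfD (mmap _ _)) /=; apply: congr2.
- by rewrite (rmorphM (map_mpoly _)) !(rmorphM (mmap _ _)) /=; apply: congr2.
Qed.

Lemma rmorph_mmap (T : comNzRingType) (h : {rmorphism S -> T}) (a : 'I_n -> S) p :
  h (mmap f a p) = mmap (h \o f) (h \o a) p.
Proof.
elim/mpoly_ringind: p => [c|i|p r IHp IHr|p r IHp IHr].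
- by rewrite !mmapC.
- by rewrite !mmapX !mmap1U.
- by rewrite !(raddfD (mmap _ _)) rmorphD /=; apply: congr2.
- by rewrite !(rmorphM (mmap _ _)) rmorphM /=; apply: congr2.
Qed.

Lemma mmap_homog d c (a : 'I_n -> S) p : p \is d.-homog ->
  mmap f (fun i => c * a i) p = c ^+ d * mmap f a p.
Proof.
move=> /dhomogP hp; rewrite /mmap mulr_sumr; apply: eq_big_seq => t /hp td.
rewrite mulrCA; congr (_ * _); rewrite /mmap1 -(td : mdeg t = d) mdegE -prodrXr -big_split /=.
by apply: eq_bigr => i _; rewrite exprMn.
Qed.

Lemma mpoly_sum_homog k (p : {mpoly R[n]}) : (msize p <= k)%N ->
  p = \sum_(d < k) pihomog mdeg d p.
Proof. exact: pihomog_partitionE. Qed.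

Lemma mmap_homog_components (a : 'I_n -> S) p :
  (forall d, mmap f a (pihomog mdeg d p) = 0) -> forall c, mmap f (fun i => c * a i) p = 0.
Proof.
move=> pd c; rewrite {1}(mpoly_sum_homog (leqnn (msize p))) rmorph_sum /=.
by apply: big1 => d _; rewrite (mmap_homog _ _ (pihomogP _ _ _)) pd mulr0.
Qed.

End Composition.

Lemma mmap_id n (R : comNzRingType) (q : {mpoly R[n]}) :
  mmap (@mpolyC n R) (fun i => 'X_i) q = q.
Proof.
elim/mpoly_ringind: q => [c|i|p r IHp IHr|p r IHp IHr].
- by rewrite mmapC.
- by rewrite mmapX mmap1U.
- by rewrite !(raddfD (mmap _ _)) /=; apply: congr2.
- by rewrite !(rmorphM (mmap _ _)) /=; apply: congr2.
Qed.

(** The value at c a is a polynomial in c whose coefficients are the values of the components, and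
    it vanishes at all natural numbers c. *)
Lemma components_mmap n (k L : fieldType) (j : {rmorphism k -> L}) (a : 'I_n -> L) p :
  [pchar k] =i pred0 -> (forall c : k, mmap j (fun i => j c * a i) p = 0) ->
  forall d, mmap j a (pihomog mdeg d p) = 0.
Proof.
move=> k0 pa d; have L0 : [pchar L] =i pred0 by move=> x; rewrite (fmorph_pchar j).
pose s := maxn (msize p) d.+1.
pose P := \poly_(i < s) mmap j a (pihomog mdeg i p).
suff : P = 0 by move/polyP/(_ d); rewrite coef_poly leq_maxr coef0.
apply: poly_nat_eval0 => // i; rewrite -(rmorph_nat j) horner_poly; apply: etrans (pa i%:R).
rewrite [in RHS](mpoly_sum_homog (leq_maxl (msize p) d.+1)) rmorph_sum /=.
by apply: eq_bigr => e _; rewrite (mmap_homog _ _ _ (pihomogP _ _ _)) mulrC.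
Qed.

Lemma homogenize n (K : fieldType) (h : {mpoly K[n]}) (i : 'I_n) :
  exists D (H : {mpoly K[n]}), H \is D.-homog /\
    forall (L : fieldType) (j : {rmorphism K -> L}) a, a i = 1 -> mmap j a H = mmap j a h.
Proof.
exists (msize h), (\sum_(d < msize h) 'X_i ^+ (msize h - d) * pihomog mdeg d h).
split.
  apply: rpred_sum => d _.
  have hX e : ('X_i : {mpoly K[n]}) ^+ e \is e.-homog.
    have h1 : ('X_i : {mpoly K[n]}) \is 1.-homog by rewrite dhomogX /= mdeg1.
    by have := dhomogMn e h1; rewrite mul1n.
  have := dhomogM (hX (msize h - d)%N) (pihomogP mdeg d h).
  by rewrite subnK // ltnW.
move=> L j a ai; rewrite [in RHS](mpoly_sum_homog (leqnn (msize h))) !rmorph_sum /=.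
by apply: eq_bigr => d _; rewrite rmorphM rmorphXn /= mmapX mmap1U ai expr1n mul1r.
Qed.

(** * Points of projective space and vanishing ideals *)

Section Points.
Variables (K : closedFieldType) (N : nat).
Hypothesis K0 : [pchar K] =i pred0.
Implicit Types (x y z : proj K N) (Z X Y B : set (proj K N)) (v : 'rV[K]_N.+1).
Local Notation pol := {mpoly K[N.+1]}.

Lemma proj_span x : exists2 v, v != 0 & pline x = <[v]>%VS.
Proof.
case: x => U /= dU; exists (vpick U); first by rewrite vpick0 -dimv_eq0 (eqP dU).
apply/esym/eqP; rewrite eqEdim -memvE memv_pick /= (eqP dU) dim_vline.
by rewrite vpick0 -dimv_eq0 (eqP dU).
Qed.

Lemma span_proj v : v != 0 -> exists x, pline x = <[v]>%VS.
Proof.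
move=> v0; have dv : \dim <[v]> == 1%N by rewrite dim_vline v0.
by exists (Proj dv).
Qed.

Lemma meval_row (a : 'I_N.+1 -> K) (f : pol) : f.@[(\row_i a i) 0] = f.@[a].
Proof. by apply: meval_eq => i; rewrite mxE. Qed.

Lemma meval_scale d (f : pol) c v : f \is d.-homog ->
  f.@[(c *: v) 0] = c ^+ d * f.@[v 0].
Proof.
move=> hf; rewrite -(mmap_homog idfun c (v 0) hf).
by apply: meval_eq => i; rewrite mxE.
Qed.

Lemma vanishes_homog d (f : pol) x v : f \is d.-homog -> v != 0 -> v \in pline x ->
  f.@[v 0] = 0 -> vanishes_at f x.
Proof.
move=> hf v0 vx fv u; have [w w0 xE] := proj_span x.
move: vx; rewrite !xE => /vlineP[c vE] /vlineP[c' ->].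
move: fv v0; rewrite vE !(meval_scale _ _ hf) => /eqP; rewrite mulf_eq0 expf_eq0.
case/orP => [/andP[_ /eqP ->]|/eqP ->]; first by rewrite scale0r eqxx.
by rewrite mulr0.
Qed.

Lemma vanishes_components (f : pol) x :
  vanishes_at f x <-> forall d, vanishes_at (pihomog mdeg d f) x.
Proof.
split=> [fx d v vx|fx v vx].
  apply: (components_mmap (j := idfun)) => // c; rewrite -(fx (c *: v)).
    by apply: meval_eq => i; rewrite mxE.
  exact: memvZ.
have := mmap_homog_components (f := idfun) (fun d => fx d v vx) 1 => <-.
by apply: meval_eq => i; rewrite mul1r.
Qed.

Definition vanishing X : set pol := [set f | forall x, X x -> vanishes_at f x].

Lemma vanishing_ideal X : ideal (vanishing X).
Proof.
split=> [x _ v _|f g fX gX x Xx v vx|f g gX x Xx v vx]; first exact: meval0.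
  by rewrite mevalD (fX x) // (gX x) // addr0.
by rewrite mevalM (gX x) // mulr0.
Qed.

Lemma vanishing_pihomog X f d : vanishing X f -> vanishing X (pihomog mdeg d f).
Proof. by move=> fX x Xx; have /vanishes_components := fX x Xx. Qed.

Lemma zclosedN A x : zclosed A -> ~ A x ->
  exists d (f : pol), [/\ f \is d.-homog, vanishing A f & ~ vanishes_at f x].
Proof.
move=> [S Sh ->] /existsNP[f /not_implyP[Sf fx]]; have [d fd] := Sh f Sf.
by exists d, f; split=> // y; apply.
Qed.

Lemma zclosed_vanishing (f : pol) : zclosed [set x | vanishes_at f x].
Proof.
exists [set pihomog mdeg d f | d in setT].
  by move=> _ [d _ <-]; exists d; apply: pihomogP.
apply/seteqP; split=> x /=; last by move=> fx; apply/vanishes_components => d; apply: fx; exists d.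
by move=> /vanishes_components fx _ [d _ <-].
Qed.

Lemma vanishesM (f g : pol) x :
  vanishes_at (f * g) x -> vanishes_at f x \/ vanishes_at g x.
Proof.
move=> fg; apply: contrapT => /not_orP[nf ng].
have [v v0 xE] := proj_span x.
have comp (h : pol) : ~ vanishes_at h x -> exists P : {poly K}, P != 0 /\
    forall c, P.[c] = h.@[(c *: v) 0].
  move=> nh; exists (\sum_(d < msize h) (pihomog mdeg d h).@[v 0] *: 'X^d).
  have hE c : (\sum_(d < msize h) (pihomog mdeg d h).@[v 0] *: 'X^d).[c] = h.@[(c *: v) 0].
    rewrite horner_sum [in RHS](mpoly_sum_homog (leqnn (msize h))) rmorph_sum /=.
    apply: eq_bigr => d _; rewrite hornerZ hornerXn mulrC.
    by rewrite -(meval_scale _ _ (pihomogP _ _ _)).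
  split=> //; apply: contra_notN nh => /eqP h0 u; rewrite xE => /vlineP[c ->].
  by rewrite -hE h0 horner0.
have [P [P0 PE]] := comp f nf; have [Q [Q0 QE]] := comp g ng.
have : P * Q != 0 by rewrite mulf_neq0.
move/eqP; apply; apply: poly_eval0 => // c; rewrite hornerM PE QE -mevalM.
by apply: fg; rewrite xE memvZ // memv_line.
Qed.

Lemma vanishing_prime Z : irreducible Z -> prime_ideal (vanishing Z).
Proof.
move=> [Zc [x Zx] Zirr]; split; first exact: vanishing_ideal.
- have [v v0 xE] := proj_span x; move=> /(_ x Zx v); rewrite xE memv_line meval1.
  by move=> /(_ isT)/eqP; rewrite oner_eq0.
- move=> f g fgZ; apply: Zirr; try exact: zclosed_vanishing.
  by move=> y Zy; apply: vanishesM; apply: fgZ.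
Qed.

(** The classes of the variables modulo P are the coordinates of a generic point, whose relations
    are exactly the elements of P. *)
Lemma prime_point (P : set pol) : prime_ideal P -> exists (F : fieldType)
    (f : {rmorphism K -> F}) (a : 'I_N.+1 -> F), forall g : pol, mmap f a g = 0 <-> P g.
Proof.
move=> /residue_field[F [h hP]].
exists F, (h \o @mpolyC N.+1 K), (fun i => h 'X_i) => g.
suff -> : mmap (h \o @mpolyC N.+1 K) (fun i => h 'X_i) g = h g by [].
have := rmorph_mmap (@mpolyC N.+1 K) h (fun i => 'X_i) g => <-; congr (h _).
exact: mmap_id.
Qed.

Lemma generic_point Z : irreducible Z -> exists (F : fieldType)
    (f : {rmorphism K -> F}) (a : 'I_N.+1 -> F),
  forall g : pol, mmap f a g = 0 <-> vanishing Z g.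
Proof. by move=> /vanishing_prime/prime_point. Qed.

(** A specialization has coordinates algebraic over K, hence in K, which is algebraically closed. *)
Lemma specialized_point (L : fieldType) (j : {rmorphism K -> L}) p (g : pol) :
  mmap j p g != 0 ->
  exists v, g.@[v 0] != 0 /\ forall q : pol, mmap j p q = 0 -> q.@[v 0] = 0.
Proof.
move=> /(specialization K0)[L' [j' [p' [clp sp gp]]]].
have /choice[w wP] : forall i, exists c, p' i = j' c by move=> i'; apply: cl_closed.
have ev (h : pol) : mmap j' p' h = j' h.@[(\row_i w i) 0].
  rewrite meval_row; have := rmorph_mmap idfun j' w h; rewrite -/(meval _ _) => ->.
  by apply: mmap_ext => i'; rewrite wP.
exists (\row_i w i); split=> [|q q0]; first by rewrite -(fmorph_eq0 j') -ev.
by apply/eqP; rewrite -(fmorph_eq0 j') -ev sp.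
Qed.

Lemma nullstellensatz (P : set pol) (f : pol) : prime_ideal P -> ~ P f ->
  exists v, f.@[v 0] != 0 /\ forall q, P q -> q.@[v 0] = 0.
Proof.
move=> /prime_point[F [h [a aP]]] /aP/eqP/specialized_point[v [fv vP]].
by exists v; split=> // q /aP; apply: vP.
Qed.

End Points.

(** * Chains of irreducible sets and transcendence degree *)

Section Dimension.
Variables (K : closedFieldType) (N : nat).
Hypothesis K0 : [pchar K] =i pred0.
Implicit Types (x y z : proj K N) (Z X Y B : set (proj K N)) (v : 'rV[K]_N.+1).
Local Notation pol := {mpoly K[N.+1]}.

Section Locus.
Variables (L : fieldType) (j : {rmorphism K -> L}) (p : 'I_N.+1 -> L).

(* The smallest closed set containing the point with coordinates p, which may *)
(* lie in an extension of K.                                                  *)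
Definition locus : set (proj K N) := [set x | forall (d : nat) (g : pol),
  g \is d.-homog -> mmap j p g = 0 -> vanishes_at g x].

Lemma locus_closed : zclosed locus.
Proof.
exists [set g | (exists d, g \is d.-homog) /\ mmap j p g = 0]; first by move=> f [].
apply/seteqP; split=> x; first by move=> lx f [[d fd] f0]; apply: lx fd f0.
by move=> h d g gd g0; apply: h; split=> //; exists d.
Qed.

Hypothesis p0 : exists i, p i != 0.

Lemma locusN d (g : pol) : g \is d.-homog -> mmap j p g != 0 ->
  exists2 x, locus x & ~ vanishes_at g x.
Proof.
move=> gd g0; have [i pi0] := p0.
(* The extra factor keeps the specialized vector nonzero, so that it represents a point of P^N. *)
have : mmap j p (g * 'X_i) != 0 by rewrite rmorphM mulf_neq0 //= mmapX mmap1U.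
move=> /(specialized_point K0)[v [gv sp]].
move: gv; rewrite mevalM mulf_eq0 negb_or mevalXU => /andP[gv vi].
have v0 : v != 0 by apply: contraNneq vi => ->; rewrite mxE.
have [x xE] := span_proj v0; have vx : v \in pline x by rewrite xE memv_line.
exists x; last by move=> /(_ v vx)/eqP; rewrite (negPf gv).
by move=> e h he h0; apply: (vanishes_homog he v0 vx); apply: sp.
Qed.

Lemma vanishing_locus g : vanishing locus g <-> forall d, mmap j p (pihomog mdeg d g) = 0.
Proof.
split=> [gl d|gd x lx].
  apply/eqP; apply: contrapT => /negP/(locusN (pihomogP _ _ _))[x lx]; apply.
  by have := vanishing_pihomog K0 d gl; apply.
by apply/(vanishes_components K0) => d; apply: lx (pihomogP _ _ _) (gd d).
Qed.

Lemma locus_irreducible : irreducible locus.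
Proof.
split; first exact: locus_closed.
  have [i pi0] := p0; have [||x lx _] := @locusN 0%N 1.
  - exact: dhomog1.
  - by rewrite rmorph1 oner_neq0.
  by exists x.
move=> B1 B2 c1 c2 l12; apply: contrapT => /not_orP[].
have main B : zclosed B -> ~ locus `<=` B -> exists d (f : pol),
    [/\ f \is d.-homog, vanishing B f & mmap j p f != 0].
  move=> cB /existsNP[x /not_implyP[lx nBx]].
  have [d [f [fd fB nf]]] := zclosedN cB nBx; exists d, f; split=> //.
  by apply/eqP => f0; apply: nf; apply: lx fd f0.
move=> /(main _ c1)[d [f [fd fB f0]]] /(main _ c2)[e [g [ge gB g0]]].
have [||x lx] := @locusN (d + e) (f * g); first exact: dhomogM.
  by rewrite rmorphM mulf_neq0.
apply=> v vx; rewrite mevalM; case: (l12 _ lx) => [/fB|/gB] h.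
  by rewrite h ?mul0r.
by rewrite h ?mulr0.
Qed.

End Locus.

(** Independence in the homogeneous coordinate ring, that is, on the affine cone: dimension d
    corresponds to d + 1 independent functions. *)
Definition indep_on Z m (g : 'I_m -> pol) :=
  forall q : {mpoly K[m]}, vanishing Z (subst g q) -> q = 0.

Definition irr_flag (W : nat -> set (proj K N)) d :=
  (forall i, (i <= d)%N -> irreducible (W i)) /\ (forall i, (i < d)%N -> W i `<` W i.+1).

Lemma meval_subst m (g : 'I_m -> pol) v q :
  (subst g q).@[v 0] = q.@[fun i => (g i).@[v 0]].
Proof. exact: (mmap_subst idfun g (v 0) q). Qed.

Lemma factor_power (A : idomainType) (P : {poly A}) : P != 0 ->
  exists l Q, P = 'X^l * Q /\ Q`_0 != 0.
Proof.
move=> P0; move: {2}(size P) (leqnn (size P)) => s; elim: s P P0 => [|s IH] P P0 sP.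
  by move: sP; rewrite leqn0 size_poly_eq0 (negPf P0).
have [P00|P00] := eqVneq P`_0 0; last by exists 0%N, P; rewrite expr0 mul1r.
have /factor_theorem[Q PQ] : root P 0 by rewrite rootE horner_coef0 P00.
have Q0 : Q != 0 by apply: contraNneq P0 => Q0; rewrite PQ Q0 mul0r.
have sPQ : size P = (size Q).+1 by rewrite PQ subr0 size_mulX.
have [|l [Q' [QE Q'0]]] := IH Q Q0; first by rewrite -ltnS -sPQ.
by exists l.+1, Q'; rewrite PQ QE subr0 exprSr mulrAC.
Qed.

Definition extend m (g : 'I_m -> pol) (f : pol) (i : 'I_m.+1) : pol :=
  if unlift ord_max i is Some i' then g i' else f.

(* Divide the relation by the largest possible power of f.                    *)
Lemma last_relation Z m (g : 'I_m -> pol) (f : pol) q :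
  irreducible Z -> ~ vanishing Z f -> q != 0 -> vanishing Z (subst (extend g f) q) ->
  exists c r, c != 0 /\ vanishing Z (subst g c + f * r).
Proof.
set gf := extend g f; move=> irr fZ q0 qZ.
have gfE P : subst gf (emb P) = (map_poly (subst g) P).[f].
  have -> : f = gf ord_max by rewrite /gf /extend unlift_none.
  have -> : map_poly (subst g) P =
      map_poly (mmap (@mpolyC N.+1 K) (fun i => gf (widen i))) P.
    apply: eq_map_poly => c; apply: mmap_ext => i; rewrite /gf /extend.
    rewrite (_ : widen i = lift ord_max i) ?liftK //.
    by apply/val_inj; rewrite /= /bump leqNgt ltn_ord.
  exact: mmap_emb.
move: q0; rewrite -muni_eq0 => /factor_power[l [Q [qE Q0]]].
have [_ _ pr] := vanishing_prime K0 irr.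
have QZ : vanishing Z ((map_poly (subst g) Q).[f]).
  have : vanishing Z (f ^+ l * (map_poly (subst g) Q).[f]).
    move: qZ; rewrite -[q]muniK gfE qE /subst rmorphM /= map_polyXn hornerM hornerXn.
    by [].
  elim: l {qE} => [|l IH]; first by rewrite expr0 mul1r.
  by rewrite exprS -mulrA => /pr[//|/IH].
exists Q`_0.
have [r rE] : exists r, (map_poly (subst g) Q).[f] = subst g Q`_0 + f * r.
  have -> : subst g Q`_0 = (map_poly (subst g) Q)`_0 by rewrite coef_map.
  elim/poly_ind: (map_poly (subst g) Q) => [|P c _].
    by exists 0; rewrite horner0 coef0 mulr0 addr0.
  exists P.[f]; rewrite hornerMXaddC coefD coefMX coefC add0r addrC.
  by rewrite [f * _]mulrC.
by exists r; rewrite -rE.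
Qed.

(** A relation on Z' between g and f, divided by powers of f, has a nonzero part free of f; on Z,
    where f vanishes, this part is a relation between the g alone. *)
Lemma indep_on_extend Z Z' m (g : 'I_m -> pol) (f : pol) :
  irreducible Z' -> Z `<=` Z' -> vanishing Z f -> ~ vanishing Z' f ->
  indep_on Z g -> indep_on Z' (extend g f).
Proof.
move=> irr ZZ' fZ fZ' gZ q qZ'; apply/eqP; apply: contrapT => /negP q0.
have [c [r [/eqP c0 h]]] := last_relation irr fZ' q0 qZ'; apply: c0; apply: gZ.
move=> x Zx v vx; rewrite -[RHS](h x (ZZ' x Zx) v vx).
by rewrite mevalD mevalM (fZ x Zx v vx) mul0r addr0.
Qed.

Lemma flag_indep W d : irr_flag W d -> exists g : 'I_d.+1 -> pol, indep_on (W d) g.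
Proof.
elim: d => [|d IH] [Wirr Wlt].
  have [_ [x Wx] _] := Wirr 0%N (leqnn 0); have [v v0 xE] := proj_span x.
  have [i vi] : exists i, v 0 i != 0.
    apply: contrapT => /forallNP vi; move/eqP: v0; apply; apply/rowP => i.
    by rewrite mxE; apply/eqP/negP => /negP; apply: vi.
  exists (fun=> 'X_i) => q qW; apply: (mpoly_eval0 K0) => w.
  have := qW x Wx ((w 0 / v 0 i) *: v); rewrite xE memvZ ?memv_line // => /(_ isT).
  rewrite meval_subst => <-; apply: meval_eq => l.
  by rewrite mevalXU mxE divfK // ord1.
have [|g gW] := IH; first by split=> i id; [apply: Wirr|apply: Wlt]; apply: leqW.
have [sub nsub] := Wlt d (ltnSn d); have [cW _ _] := Wirr d (leqnSn d).
have [x [Wx nWx]] : exists x, W d.+1 x /\ ~ W d x.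
  apply: contrapT => /forallNP h; apply: nsub => x Wx.
  by apply: contrapT => nWx; apply: (h x).
have [e [f [fe fW nf]]] := zclosedN cW nWx.
by eexists; apply: (indep_on_extend (Wirr _ (leqnn _)) sub fW _ gW) => /(_ x Wx).
Qed.

End Dimension.

(** * Lowering the dimension by one *)

Lemma aindep_tower (k F L : fieldType) (f : {rmorphism k -> F}) S
    (j : {rmorphism genT f S -> L}) m (b : 'I_m -> genT f S) :
  aindep f (fun i => val (b i)) -> aindep (j \o gen_in f S) (j \o b).
Proof.
move=> ai q; rewrite -(rmorph_mmap (gen_in f S) j) => /eqP.
rewrite fmorph_eq0 => /eqP q0; apply: ai.
have := rmorph_mmap (gen_in f S) (val : {rmorphism genT f S -> F}) b q.
by rewrite q0 rmorph0 => /esym.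
Qed.

Lemma cl_tower (k F L : fieldType) (f : {rmorphism k -> F}) S
    (j : {rmorphism genT f S -> L}) x :
  cl j set0 x -> cl (j \o gen_in f S) (j @` [set y | S (val y)]) x.
Proof.
move=> clx; have [|//|y z|y z|p [p0 Ap px]] := cl_clear (A := range j) _ _ _ _ clx.
- by move=> c; exists c.
- by move=> [c _ <-] [d _ <-]; exists (c - d); rewrite ?rmorphB.
- by move=> [c _ <-] [d _ <-]; exists (c * d); rewrite ?rmorphM.
apply: (algebraic_cl p0 _ px) => i; have [y _ <-] := Ap i.
set T := j @` _.
have /(_ [set z | exists2 y, val y = z & cl (j \o gen_in f S) T (j y)]) := genTP y.
case=> /=.
- by move=> c; exists (gen_in f S c) => //; apply: (cl_const (j \o gen_in f S)).
- move=> z Sz; have zP : z \in genp f S by apply/asboolP; apply: gen_sub.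
  by exists (GenT zP) => //; apply: sub_cl; exists (GenT zP).
- move=> _ _ [u <- clu] [v <- clv]; exists (u - v).
    exact: (rmorphB (val : {rmorphism genT f S -> F})).
  by rewrite rmorphB; apply: clB.
- move=> _ _ [u <- clu] [v <- clv]; exists (u / v).
    exact: (fmorph_div (val : {rmorphism genT f S -> F})).
  by rewrite fmorph_div; apply: cl_div.
- by move=> w /val_inj ->.
Qed.

Section Hypersurface.
Variables (K : closedFieldType) (N : nat).
Hypothesis K0 : [pchar K] =i pred0.
Implicit Types (x y z : proj K N) (Z X Y B : set (proj K N)) (v : 'rV[K]_N.+1).
Local Notation pol := {mpoly K[N.+1]}.

(* Z' is the locus of a point algebraic over K(b_1, .., b_d), where b_0, ..,   *)
(* b_d are independent affine coordinates on Z: b_0 has been specialized.     *)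
Lemma indep_on_restrict Z d (g : 'I_d.+2 -> pol) : irreducible Z -> indep_on Z g ->
  exists Z' (g' : 'I_d.+1 -> pol), [/\ irreducible Z', Z' `<` Z & indep_on Z' g'].
Proof.
move=> irr gZ; have [F [f [a aP]]] := generic_point K0 irr.
have [i0 ai0] : exists i, a i != 0.
  have [_ [x Zx] _] := irr; have [v v0 xE] := proj_span x.
  apply: contrapT => /forallNP a0; move/eqP: v0; apply; apply/rowP => i.
  have : vanishing Z ('X_i : pol).
    by apply/aP; rewrite mmapX mmap1U; apply/eqP/negP => /negP; apply: a0.
  by move=> /(_ x Zx v); rewrite xE memv_line mevalXU mxE; apply.
pose b i := a i / a i0.
have ab i : a i = a i0 * b i by rewrite mulrC divfK.
have bi0 : b i0 = 1 by rewrite /b divff.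
have homog_ab e (h : pol) : h \is e.-homog -> mmap f a h = a i0 ^+ e * mmap f b h.
  by move=> he; rewrite -(mmap_homog f _ _ he); apply: mmap_ext.
have [I bI] : exists I : 'I_d.+1 -> 'I_N.+1, aindep f (b \o I).
  apply: (@aindep_choose _ _ _ d.+2 _ _ (fun i => mmap f a (g i)) b [:: a i0]).
  - by move=> q; rewrite -mmap_subst => /aP/gZ.
  - move=> i; apply: cl_mmap => l; rewrite (ab l); apply: clM; apply: sub_cl.
      by right; rewrite /= inE eqxx.
    by left; exists l.
  - by rewrite addn1.
(* The first coordinate b_(I 0) is left out of S; specializing over K(S) makes every coordinate
   algebraic over K(S). *)
pose S := range (fun i : 'I_d => b (I (lift ord0 i))).
have b1 : mmap (val : {rmorphism genT f S -> F}) b 1 != 0 by rewrite rmorph1 oner_neq0.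
have F00 : [pchar (genT f S)] =i pred0.
  by move=> x; rewrite (fmorph_pchar (gen_in f S)).
have [L [j [p [clp sp _]]]] := specialization F00 b1.
pose jK : {rmorphism K -> L} := j \o gen_in f S.
have spK (q : pol) : mmap f b q = 0 -> mmap jK p q = 0.
  move=> q0; rewrite -(mmap_map_mpoly (gen_in f S) j p q); apply: sp.
  by rewrite (mmap_map_mpoly (gen_in f S) (val : {rmorphism genT f S -> F})).
have pi0 : p i0 = 1.
  have := spK ('X_i0 - 1); rewrite !rmorphB !rmorph1 /= !mmapX !mmap1U bi0 subrr.
  by move=> /(_ erefl)/eqP; rewrite subr_eq0 => /eqP.
have SP i : b (I (lift ord0 i)) \in genp f S.
  by apply/asboolP; apply: gen_sub; exists i.
have pI i : p (I (lift ord0 i)) = j (GenT (SP i)).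
  have ev (M : fieldType) (h : {rmorphism genT f S -> M}) w l c :
      mmap h w ('X_l - c%:MP_[N.+1]) = w l - h c.
    by rewrite rmorphB /= mmapX mmap1U mmapC.
  have := sp ('X_(I (lift ord0 i)) - (GenT (SP i))%:MP); rewrite !ev => h.
  by apply/eqP; rewrite -subr_eq0; apply/eqP/h; apply: subrr.
have pn0 : exists i, p i != 0 by exists i0; rewrite pi0 oner_neq0.
exists (locus jK p),
  (fun i => if unlift ord0 i is Some i' then 'X_(I (lift ord0 i')) else 'X_i0).
split; first exact: locus_irreducible.
- split=> [x lx|sub].
    apply: contrapT => nZx; have [cZ _ _] := irr.
    have [e [h [he hZ nh]]] := zclosedN cZ nZx; apply: nh; apply: (lx _ _ he); apply: spK.
    move/aP/eqP: hZ; rewrite (homog_ab _ _ he) mulf_eq0 expf_eq0 (negPf ai0) andbF.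
    by move/eqP.
  (* If Z were contained in Z', the d + 1 coordinates p_(I i) would be independent, although they
     are algebraic over the d images of S. *)
  have pIi : aindep jK (p \o I).
    move=> q q0; have := mmap_subst jK (fun i => 'X_(I i)) p q.
    rewrite (mmap_ext _ (b := p \o I)) => [|i]; last by rewrite mmapX mmap1U.
    rewrite q0 => h0; have [D [H [HD HE]]] := homogenize (subst (fun i => 'X_(I i)) q) i0.
    have : vanishing Z H.
      move=> x /sub lx; by apply: (lx _ _ HD); rewrite HE.
    move/aP/eqP; rewrite (homog_ab _ _ HD) mulf_eq0 expf_eq0 (negPf ai0) andbF /=.
    rewrite HE // mmap_subst => /eqP q1; apply: bI; rewrite -[RHS]q1.
    by apply: mmap_ext => i; rewrite mmapX mmap1U.
  have : (d.+1 <= size (codom (fun i : 'I_d => p (I (lift ord0 i)))))%N.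
    apply: (aindep_size pIi) => i; apply: cl_mono (cl_tower (clp (I i))).
    move=> _ [y [l _ yE] <-] /=; apply/codomP; exists l; rewrite pI.
    by congr (j _); apply: val_inj.
  by rewrite size_codom card_ord ltnn.
- have bI' : aindep jK (fun i : 'I_d => p (I (lift ord0 i))).
    have : aindep f (fun i => val (GenT (SP i))) by apply: (aindep_sub (@lift_inj _ ord0) bI).
    move=> /(aindep_tower (j := j)) ai q q0; apply: ai; rewrite -q0.
    by apply: mmap_ext => i; rewrite pI.
  set g' := fun i => _; move=> q /(vanishing_locus K0 jK pn0) qh.
  pose e c (i : 'I_d.+1) : {mpoly K[d]} :=
    if unlift ord0 i is Some i' then c *: 'X_i' else c%:MP.
  have qc c : subst (e c) q = 0.
    apply: bI'; rewrite mmap_subst.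
    have := mmap_homog_components qh (jK c); rewrite mmap_subst => h.
    apply: etrans h; apply: mmap_ext => i; rewrite /e /g'.
    case: unliftP => [i' _|_]; rewrite ?mmapZ !mmapX ?mmapC !mmap1U //.
    by rewrite pi0 mulr1.
  (* [qc] shows that q vanishes where the first coordinate is nonzero; the factor takes care of the
     other points. *)
  have : q * 'X_ord0 = 0.
    apply: (mpoly_eval0 K0) => w; rewrite mevalM mevalXU.
    have [->|w0] := eqVneq (w ord0) 0; first by rewrite mulr0.
    have /(congr1 (meval (fun i => w (lift ord0 i) / w ord0))) := qc (w ord0).
    rewrite meval0 -/(mmap idfun _ _) /meval mmap_subst => h.
    rewrite [X in X * _](_ : _ = 0) ?mul0r // -[RHS]h.
    apply: mmap_ext => i; rewrite /e; case: unliftP => [i' ->|->].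
      by rewrite mmapZ mmapX mmap1U mulrC divfK.
    by rewrite mmapC.
  move/eqP; rewrite mulf_eq0 => /orP[/eqP //|/eqP X0].
  have := mcoeffXU K (@ord0 d) ord0; rewrite X0 mcoeff0 eqxx => /esym/eqP.
  by rewrite oner_eq0.
Qed.

Lemma indep_flag Z d (g : 'I_d.+1 -> pol) : irreducible Z -> indep_on Z g ->
  exists W, irr_flag W d /\ W d = Z.
Proof.
elim: d Z g => [|d IH] Z g irr gZ.
  by exists (fun=> Z); split=> //; split=> [[|]|[|]].
have [Z' [g' [irr' ltZ gZ']]] := indep_on_restrict irr gZ.
have [W [[Wirr Wlt] Wd]] := IH _ _ irr' gZ'.
exists (fun i => if (i <= d)%N then W i else Z); rewrite ltnn; split=> //; split=> i.
  by have [id _|//] := leqP i d; apply: Wirr.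
rewrite ltnS => id; rewrite id; have [di|di] := ltnP i d; first exact: Wlt.
by rewrite (_ : i = d) ?Wd //; apply/eqP; rewrite eqn_leq id.
Qed.

End Hypersurface.

(** * Polynomial vector fields tangent to X *)

Section VectorFields.
Variables (R : comNzRingType) (n : nat).
Local Notation pol := {mpoly R[n]}.
Implicit Types (w z : 'I_n -> pol) (f g : pol).

Definition D w f : pol := \sum_i w i * f^`M(i).

Lemma D_add w f g : D w (f + g) = D w f + D w g.
Proof. by rewrite -big_split; apply: eq_bigr => i _; rewrite mderivD mulrDr. Qed.

Lemma D0 w : D w 0 = 0.
Proof. by rewrite /D big1 // => i _; rewrite mderiv0 mulr0. Qed.

Lemma D_opp w f : D w (- f) = - D w f.
Proof. by rewrite -sumrN; apply: eq_bigr => i _; rewrite mderivN mulrN. Qed.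

Lemma D_sub w f g : D w (f - g) = D w f - D w g.
Proof. by rewrite D_add D_opp. Qed.

Lemma D_const w c : D w c%:MP = 0.
Proof. by rewrite /D big1 // => i _; rewrite mderivC mulr0. Qed.

Lemma D_mul w f g : D w (f * g) = D w f * g + f * D w g.
Proof.
rewrite mulr_suml mulr_sumr -big_split; apply: eq_bigr => i _ /=.
by rewrite mderivM mulrDr; congr (_ + _); rewrite ?mulrA // [w i * f]mulrC.
Qed.

Lemma D_sum w (I : Type) (r : seq I) (P : pred I) (F : I -> pol) :
  D w (\sum_(i <- r | P i) F i) = \sum_(i <- r | P i) D w (F i).
Proof. exact: (big_morph _ (D_add w) (D0 w)). Qed.

Lemma mderivXU (i l : 'I_n) : ('X_i : pol)^`M(l) = (i == l)%:R.
Proof.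
rewrite mderivX mnm1E; case: eqVneq => [->|_]; last by rewrite scale0r.
rewrite scale1r (_ : (_ - _)%MM = 0%MM) ?mpolyX0 //.
by apply/mnmP => i'; rewrite mnmBE subnn mnm0E.
Qed.

Lemma D_X w i : D w 'X_i = w i.
Proof.
rewrite /D (bigD1 i) //= mderivXU eqxx mulr1 big1 ?addr0 // => l li.
by rewrite mderivXU eq_sym (negPf li) mulr0.
Qed.

Lemma D_comp w m (u : 'I_m -> pol) (p : {mpoly R[m]}) :
  D w (subst u p) = \sum_a subst u p^`M(a) * D w (u a).
Proof.
rewrite /subst; elim/mpoly_ringind: p => [c|i|p q IHp IHq|p q IHp IHq].
- rewrite mmapC D_const big1 // => a _; by rewrite mderivC rmorph0 mul0r.
- rewrite mmapX mmap1U (bigD1 i) //= big1 => [|a ai].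
    rewrite addr0 mderivX mnm1E eqxx scale1r (_ : (_ - _)%MM = 0%MM).
      by rewrite mpolyX0 rmorph1 mul1r.
    by apply/mnmP => i'; rewrite mnmBE subnn mnm0E.
  by rewrite mderivX mnm1E eq_sym (negPf ai) scale0r rmorph0 mul0r.
- rewrite rmorphD D_add IHp IHq -big_split; apply: eq_bigr => a _ /=.
  by rewrite mderivD rmorphD mulrDl.
- rewrite rmorphM D_mul IHp IHq mulr_suml mulr_sumr -big_split.
  apply: eq_bigr => a _ /=; rewrite mderivM rmorphD !rmorphM mulrDl /=.
  by congr (_ + _); [exact: mulrAC|rewrite mulrA].
Qed.

Definition bracket w z i := D w (z i) - D z (w i).

Lemma D_bracket w z f : D w (D z f) - D z (D w f) = D (bracket w z) f.
Proof.
have DD w1 w2 : D w1 (D w2 f) =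
    \sum_i D w1 (w2 i) * f^`M(i) + \sum_i \sum_l w2 i * (w1 l * f^`M(i)^`M(l)).
  rewrite [D w2 f]/D D_sum -big_split; apply: eq_bigr => i _ /=.
  by rewrite D_mul -mulr_sumr.
rewrite !DD [X in _ + X - _]exchange_big /=.
rewrite [X in _ + X - _](_ : _ = \sum_i \sum_l w i * (z l * f^`M(i)^`M(l))).
  by rewrite opprD addrACA subrr addr0 -sumrB; apply: eq_bigr => i _; rewrite mulrBl.
by apply: eq_bigr => i _; apply: eq_bigr => l _; rewrite mulrCA (mderiv_comm l i).
Qed.

Lemma D_lin (I : finType) (c : I -> R) (z : I -> 'I_n -> pol) f :
  D (fun i => \sum_a (c a)%:MP * z a i) f = \sum_a (c a)%:MP * D (z a) f.
Proof.
rewrite /D [LHS](eq_bigr (fun i => \sum_a (c a)%:MP * (z a i * f^`M(i)))).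
  by rewrite exchange_big /=; apply: eq_bigr => a _; rewrite mulr_sumr.
by move=> i _; rewrite mulr_suml; apply: eq_bigr => a _; rewrite mulrA.
Qed.

Lemma meval_D w f v : (D w f).@[v] = \sum_i (w i).@[v] * f^`M(i).@[v].
Proof. by rewrite /D rmorph_sum; apply: eq_bigr => i _; rewrite /= mevalM. Qed.

Section Order.
Variables (w : 'I_n -> pol) (v : 'I_n -> R).

Lemma iterD_sum j (I : Type) (r : seq I) (P : pred I) (F : I -> pol) :
  iter j (D w) (\sum_(i <- r | P i) F i) = \sum_(i <- r | P i) iter j (D w) (F i).
Proof. by elim: j => //= j ->; rewrite D_sum. Qed.

Lemma iterD_add j f g : iter j (D w) (f + g) = iter j (D w) f + iter j (D w) g.
Proof. by elim: j => //= j ->; rewrite D_add. Qed.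

Lemma iterD_sub j f g : iter j (D w) (f - g) = iter j (D w) f - iter j (D w) g.
Proof. by elim: j => //= j ->; rewrite D_sub. Qed.

Lemma iterD_scale j c f : iter j (D w) (c%:MP * f) = c%:MP * iter j (D w) f.
Proof. by elim: j => //= j ->; rewrite D_mul D_const mul0r add0r. Qed.

Definition order_ge e f := forall j, (j < e)%N -> (iter j (D w) f).@[v] = 0.

Lemma order_ge_mul e g f : order_ge e f ->
  order_ge e (g * f) /\ (iter e (D w) (g * f)).@[v] = g.@[v] * (iter e (D w) f).@[v].
Proof.
elim: e g f => [|e IH] g f of_; first by split=> //=; rewrite mevalM.
have of' : order_ge e f by move=> j je; apply: of_; apply: ltnW.
have oDf : order_ge e (D w f) by move=> j je; rewrite -iterSr; apply: of_.
have key j : (j <= e)%N -> (iter j.+1 (D w) (g * f)).@[v] =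
    (iter j (D w) (D w g * f)).@[v] + (iter j (D w) (g * D w f)).@[v].
  by move=> _; rewrite iterSr D_mul iterD_add mevalD.
have [o1 e1] := IH (D w g) f of'; have [o2 e2] := IH g (D w f) oDf.
split=> [[|j] je|].
- by rewrite mevalM (of_ 0%N) ?mulr0.
- rewrite key; last exact: ltnW je.
  by have -> := o1 j je; have -> := o2 j je; rewrite addr0.
- by rewrite key // e1 e2 (of_ e) // mulr0 add0r -iterSr.
Qed.

End Order.

Lemma euler d (q : pol) (a : 'I_n -> R) : q \is d.-homog ->
  \sum_i a i * q^`M(i).@[a] = d%:R * q.@[a].
Proof.
move=> /dhomogP hq; rewrite {2}[q]mpolyE rmorph_sum mulr_sumr.
rewrite (eq_bigr (fun i => \sum_(m <- msupp q) a i * (q@_m *: ('X_[m])^`M(i)).@[a])).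
  rewrite exchange_big; apply: eq_big_seq => m /hq /= md.
  rewrite mevalZ -(md : mdeg m = d) mdegE natr_sum mulr_suml; apply: eq_bigr => i _.
  rewrite mevalZ mulrCA [RHS]mulrCA; congr (_ * _); rewrite mderivX mevalZ mulrCA.
  case: (posnP (m i)) => [->|mi]; first by rewrite !mul0r.
  congr (_ * _); rewrite -(mevalXU a i) -mevalM -mpolyXD; congr ('X_[_].@[_]).
  by rewrite addmC submK // lep1mP -lt0n.
move=> i _; rewrite {1}[q]mpolyE (raddf_sum (mderiv i)) (raddf_sum (meval a)) mulr_sumr /=.
by apply: eq_bigr => m _; rewrite mderivZ.
Qed.

Lemma dhomog_mderiv d (q : pol) i : q \is d.-homog -> q^`M(i) \is d.-1.-homog.
Proof.
move=> /dhomogP hq; apply/dhomogP => m; rewrite mcoeff_msupp mcoeff_mderiv => h.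
have : (m + U_(i))%MM \in msupp q.
  by rewrite mcoeff_msupp; apply: contraNneq h => ->; rewrite mul0rn.
by move=> /hq /= <-; rewrite mdegD mdeg1 addn1.
Qed.

(** q(x - v) vanishes at v to order d with leading form q, so d derivatives along w leave d! times q
    at w(v). The induction on d uses Euler's identity. *)
Lemma order_translate w v d (q : pol) : q \is d.-homog ->
  order_ge w v d (subst (fun i => 'X_i - (v i)%:MP) q) /\
  (iter d (D w) (subst (fun i => 'X_i - (v i)%:MP) q)).@[v] =
    d`!%:R * q.@[fun i => (w i).@[v]].
Proof.
set u := fun i => _; elim: d q => [|d IH] q hq.
  split=> //=; rewrite fact0 mul1r [q]msize1_polyC.
    by rewrite /subst mmapC !mevalC.
  rewrite mmeasureE big_seq; apply: (big_ind (fun s => s <= 1)%N) => // [x y|m mq].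
    by rewrite geq_max => -> ->.
  by rewrite ltnS; move/dhomogP: hq => /(_ _ mq) /= ->.
have Dq : D w (subst u q) = \sum_i w i * subst u q^`M(i).
  rewrite D_comp; apply: eq_bigr => i _; rewrite D_sub D_const subr0 D_X.
  exact: mulrC.
have o i := IH _ (dhomog_mderiv i hq).
split=> [[|j] jd|].
- have /(congr1 (meval v)) := mmap_homog (@mpolyC n R) 0 u hq.
  rewrite /= expr0n mul0r meval0 => h.
  rewrite /subst -[RHS]h; have ev := mmap_subst idfun.
  rewrite -!/(subst _ _) /meval !ev; apply: mmap_ext => i.
  by rewrite -/(meval _ _) /u mevalB mevalXU mevalC subrr -/(meval _ _) mevalM meval0 mul0r.
- rewrite iterSr Dq iterD_sum rmorph_sum big1 // => i _.
  by have [h _] := order_ge_mul (w i) (o i).1; apply: h.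
- rewrite iterSr Dq iterD_sum rmorph_sum factS natrM [_.+1%:R * _]mulrC -mulrA.
  rewrite -(euler _ hq) mulr_sumr; apply: eq_bigr => i _ /=.
  have [_ ->] := order_ge_mul (w i) (o i).1; rewrite (o i).2.
  by rewrite mulrCA.
Qed.

End VectorFields.

(** * Tangent fields and the order of vanishing along Y *)

Section TangentFields.
Variables (K : closedFieldType) (N : nat).
Hypothesis K0 : [pchar K] =i pred0.
Local Notation pol := {mpoly K[N.+1]}.
Implicit Types (x y : proj K N) (v u : 'rV[K]_N.+1) (w z : 'I_N.+1 -> pol) (f g : pol).
Variable X : set (proj K N).

Definition tangent_field w := forall f, vanishing X f -> vanishing X (D w f).

Definition field_at w v : 'rV[K]_N.+1 := \row_i (w i).@[v 0].

Lemma meval_D_at w f v : (D w f).@[v 0] = \sum_i f^`M(i).@[v 0] * field_at w v 0 i.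
Proof. by rewrite meval_D; apply: eq_bigr => i _; rewrite mxE mulrC. Qed.

Lemma tangent_field_bracket w z :
  tangent_field w -> tangent_field z -> tangent_field (bracket w z).
Proof.
move=> wX zX f fX; rewrite -D_bracket.
exact: (idealB (vanishing_ideal X) (wX _ (zX _ fX)) (zX _ (wX _ fX))).
Qed.

Lemma tangent_field_lin (I : finType) (c : I -> K) (z : I -> 'I_N.+1 -> pol) :
  (forall a, tangent_field (z a)) -> tangent_field (fun i => \sum_a (c a)%:MP * z a i).
Proof.
move=> zX f fX; rewrite D_lin; apply: (@ideal_sum _ (vanishing X)); first exact: vanishing_ideal.
by move=> a _; have [_ _ M] := vanishing_ideal X; apply: M; apply: zX.
Qed.

Lemma field_at_lin (I : finType) (c : I -> K) (z : I -> 'I_N.+1 -> pol) v :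
  field_at (fun i => \sum_a (c a)%:MP * z a i) v = \sum_a c a *: field_at (z a) v.
Proof.
apply/rowP => i; rewrite mxE summxE rmorph_sum; apply: eq_bigr => a _ /=.
by rewrite mevalM mevalC !mxE.
Qed.

Lemma tangent_spaceP Z x u : u \in tangent_space Z x <-> tangent_cone Z x u.
Proof. exact: (svalP (cid (tangent_cone_vspace Z x))). Qed.

Lemma mem_tangent_space x v u : X x -> v != 0 -> v \in pline x ->
  (forall f, hom_ideal X f -> \sum_(i < N.+1) f^`M(i).@[v 0] * u 0 i = 0) ->
  u \in tangent_space X x.
Proof.
move=> Xx v0 vx h; apply/tangent_spaceP => f v' fX v'x.
have [[d fd] _] := fX; have [w w0 xE] := proj_span x.
move: vx v'x; rewrite !xE => /vlineP[c vE] /vlineP[c' v'E].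
have c0 : c != 0 by apply: contraNneq v0 => c0; rewrite vE c0 scale0r.
have -> : v' = (c' / c) *: v by rewrite v'E vE scalerA divfK.
transitivity ((c' / c) ^+ d.-1 * \sum_(i < N.+1) f^`M(i).@[v 0] * u 0 i).
  rewrite mulr_sumr; apply: eq_bigr => i _.
  by rewrite (meval_scale _ _ (dhomog_mderiv i fd)) mulrA.
by rewrite h // mulr0.
Qed.

Lemma tangent_field_at w x v : tangent_field w -> X x -> v != 0 -> v \in pline x ->
  field_at w v \in tangent_space X x.
Proof.
move=> wX Xx v0 vx; apply: (mem_tangent_space Xx v0 vx) => f [_ fX].
by rewrite -meval_D_at (wX f fX x).
Qed.

Section VanishingOrder.
Variable Y : set (proj K N).
Hypotheses (YX : Y `<=` X) (irrY : irreducible Y).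
Let primeY := vanishing_prime K0 irrY.
Let idealY : ideal (vanishing Y) := vanishing_ideal Y.

(** Order of vanishing along Y of the restriction of f to X: only derivatives tangent to X are
    tested, so that equations of X have infinite order ([vorder_vanishing]). *)
Fixpoint vorder k f : Prop :=
  if k is k'.+1 then vanishing Y f /\ forall w, tangent_field w -> vorder k' (D w f)
  else True.

Lemma vorderS k f : vorder k.+1 f -> vorder k f.
Proof. by elim: k f => //= k IH f [fY Df]; split=> // w /Df/IH. Qed.

Lemma vorder_le k l f : (l <= k)%N -> vorder k f -> vorder l f.
Proof.
elim: k => [|k IH]; first by rewrite leqn0 => /eqP ->.
by rewrite leq_eqVlt => /orP[/eqP ->//|/IH h /vorderS/h].
Qed.

Lemma vorder_ideal k : ideal (vorder k).
Proof.
have [Y0 YD YM] := idealY; elim: k => [|k [k0 kD kM]] //; split.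
- by split=> // w _; rewrite D0.
- move=> f g [fY Df] [gY Dg]; split; first exact: YD.
  by move=> w wX; rewrite D_add; apply: kD; [apply: Df|apply: Dg].
- move=> g f /[dup] /vorderS kf [fY Df]; split; first exact: YM.
  move=> w wX; rewrite D_mul; apply: kD; first exact: kM.
  by apply: (kM); apply: Df.
Qed.

Lemma vorder_vanishing k f : vanishing X f -> vorder k f.
Proof.
elim: k f => //= k IH f fX; split; first by move=> y /YX; apply: fX.
by move=> w wX; apply: IH; apply: wX.
Qed.

(** In D(g f) = D(g) f + g D(f) the first term has order k, because f does by induction; hence so
    does g D(f), and g is cancelled again by induction. *)
Lemma vorder_cancel k f g : ~ vanishing Y g -> vorder k (g * f) -> vorder k f.
Proof.
move=> ng; have [_ _ Ypr] := primeY.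
elim: k f => //= k IH f [gfY Dgf].
have fY : vanishing Y f by have [] := Ypr _ _ gfY.
have [k0 kD kM] := vorder_ideal k.
have kf : vorder k f.
  case: k IH Dgf k0 kD kM => // k IH Dgf k0 kD kM; apply: IH; split=> // w wX.
  by apply: vorderS; apply: Dgf.
split=> // w wX; apply: IH.
have := idealB (vorder_ideal k) (Dgf w wX) (kM (D w g) f kf).
by rewrite D_mul addrAC subrr add0r.
Qed.

Lemma vorder_iter k n w f : tangent_field w -> vorder (n + k) f ->
  vorder k (iter n (D w) f).
Proof. by move=> wX; elim: n f => // n IH f [_ Df]; rewrite iterSr; apply: IH; apply: Df. Qed.

Lemma D_iter_comm n w z f : tangent_field w -> tangent_field z -> vorder n.+1 f ->
  vanishing Y (D w (iter n (D z) f) - iter n (D z) (D w f)).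
Proof.
move=> wX zX; have [Y0 YD YM] := idealY.
elim: n f => [|n IH] f fn; first by rewrite subrr.
have [_ Df] := fn; have := IH _ (Df z zX).
have bX := tangent_field_bracket wX zX.
have e : D w (D z f) = D z (D w f) + D (bracket w z) f.
  by rewrite -D_bracket addrC subrK.
rewrite !iterSr e iterD_add => h.
have hb : vanishing Y (iter n (D z) (D (bracket w z) f)).
  have : vorder (n + 1) (D (bracket w z) f) by rewrite addn1; apply: Df.
  by move/(vorder_iter zX) => [].
by have := YD _ _ h hb; rewrite opprD addrA subrK.
Qed.

(* Swapping two fields introduces their bracket, which is again a tangent     *)
(* field: this term has one derivative less and vanishes on Y.                *)
Lemma iterD_at k y v w z c f : Y y -> v \in pline y -> tangent_field w ->
  tangent_field z -> field_at z v = c *: field_at w v -> vorder k f ->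
  (iter k (D z) f).@[v 0] = c ^+ k * (iter k (D w) f).@[v 0].
Proof.
move=> Yy vy wX zX zw; elim: k f => [|k IH] f fk; first by rewrite expr0 mul1r.
have -> : (iter k.+1 (D z) f).@[v 0] = c * (D w (iter k (D z) f)).@[v 0].
  rewrite iterS !meval_D_at mulr_sumr; apply: eq_bigr => i _.
  by rewrite zw mxE mulrCA.
have /eqP := D_iter_comm wX zX fk Yy vy; rewrite mevalB subr_eq0 => /eqP ->.
by have [_ Df] := fk; rewrite (IH _ (Df w wX)) iterSr exprS mulrA.
Qed.

(** On Y the fields commute up to brackets that still vanish there, so the k-th derivative along w +
    c z expands binomially; only the terms of degree 0 and 1 in c are recorded. *)
Lemma iterD_line k y v w z f : Y y -> v \in pline y -> tangent_field w ->
  tangent_field z -> vorder k f -> exists P : {poly K},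
  [/\ forall c, (iter k (D (fun i => w i + c%:MP * z i)) f).@[v 0] = P.[c],
    P`_0 = (iter k (D w) f).@[v 0] &
    P`_1 = k%:R * (iter k.-1 (D w) (D z f)).@[v 0]].
Proof.
move=> Yy vy wX zX; elim: k f => [|k IH] f fk.
  by exists (f.@[v 0])%:P; rewrite !coefC mul0r; split=> // c; rewrite hornerC.
have [_ Df] := fk.
have [P [Pc P0 P1]] := IH _ (Df w wX); have [Q [Qc Q0 Q1]] := IH _ (Df z zX).
exists (P + Q * 'X); split.
- move=> c; rewrite iterSr hornerD hornerMX -Pc -Qc mulrC.
  have -> : D (fun i => w i + c%:MP * z i) f = D w f + c%:MP * D z f.
    rewrite /D mulr_sumr -big_split; apply: eq_bigr => i _ /=.
    by rewrite mulrDl mulrA.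
  by rewrite iterD_add mevalD iterD_scale mevalM mevalC.
- by rewrite coefD coefMX addr0 P0 iterSr.
- rewrite coefD coefMX /= P1 Q0; have [->|k0] := posnP k.
    by rewrite mul0r add0r mul1r.
  rewrite -[in RHS]natr1 mulrDl mul1r; congr (_ * _ + _).
  rewrite -[in RHS](prednK k0) iterSr.
  have -> : D z (D w f) = D w (D z f) - D (bracket w z) f.
    by rewrite -D_bracket opprB addrCA subrr addr0.
  have : vorder (k.-1 + 1) (D (bracket w z) f).
    by rewrite addn1 prednK //; apply: Df; apply: tangent_field_bracket.
  move/(vorder_iter wX) => [hb _].
  by rewrite iterD_sub mevalB (hb y Yy v vy) subr0.
Qed.

(* Polarization: a symmetric multilinear form in characteristic 0 is zero as  *)
(* soon as it vanishes on the diagonal.                                       *)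
Lemma vorder_polarize k f : vorder k f ->
  (forall w, tangent_field w -> vanishing Y (iter k (D w) f)) -> vorder k.+1 f.
Proof.
elim: k f => [|k IH] f fk fw.
  by split=> //; apply: (fw (fun=> 0)) => g _; rewrite /D big1 => [|i _]; rewrite ?mul0r //;
    have [] := vanishing_ideal X.
have [fY Df] := fk; split=> // z zX; apply: IH; first exact: Df.
move=> w wX y Yy v vy.
have [P [Pc P0 P1]] := iterD_line Yy vy wX zX fk.
have P_eq0 : P = 0.
  apply: (poly_eval0 K0) => c; rewrite -Pc; apply: (fw _ _ y Yy v vy) => g gX.
  have -> : D (fun i => w i + c%:MP * z i) g = D w g + c%:MP * D z g.
    rewrite /D mulr_sumr -big_split; apply: eq_bigr => i _ /=.
    by rewrite mulrDl mulrA.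
  have [_ XD XM] := vanishing_ideal X; apply: XD; first exact: wX.
  by apply: XM; apply: zX.
move: P1; rewrite P_eq0 coef0 => /esym/eqP; rewrite mulf_eq0 => /orP[|/eqP //].
by move/pcharf0P: K0 => ->.
Qed.

End VanishingOrder.
End TangentFields.

(** * Frames of tangent fields *)

Section LinearAlgebra.
Variables (K : fieldType) (m : nat).
Implicit Types (s t : 'rV[K]_m) (T : {vspace 'rV[K]_m}).

Lemma free_matrix (X : seq 'rV[K]_m) c : size X = c -> free X ->
  row_free (\matrix_(i < c, l < m) X`_i 0 l).
Proof.
move=> <- fX0; have /freeP fX : free (in_tuple X) by [].
apply: inj_row_free => v vX.
apply/rowP => i; rewrite mxE; apply: fX => /=; rewrite -[RHS]vX.
apply/rowP => l; rewrite summxE !mxE; apply: eq_bigr => j _.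
by rewrite !mxE.
Qed.

(** A maximal free family in S spans S and so cuts out T, whence c + d = m by rank-nullity; a
    complement of its span completes it to a basis. *)
Lemma annihilator_frame (S : set 'rV[K]_m) T (d : nat) :
  (forall t, t \in T <-> forall s, S s -> \sum_i s 0 i * t 0 i = 0) -> \dim T = d ->
  exists c (s : 'I_m -> 'rV[K]_m), [/\ (c + d)%N = m,
    forall i : 'I_m, (i < c)%N -> S (s i) & \matrix_(i, l) s i 0 l \in unitmx].
Proof.
move=> TS dT.
pose A c := `[< exists X : seq 'rV[K]_m, [/\ size X = c, free X & {in X, forall s, S s}] >].
have exA : exists c, A c by exists 0%N; apply/asboolP; exists [::]; rewrite nil_free.
have ubA c : A c -> (c <= m)%N.
  move=> /asboolP[X [<- /eqP <- _]]; apply: leq_trans (dimvS (subvf _)) _.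
  by rewrite dimvf dim_matrix mul1r.
case: (ex_maxnP exA ubA) => c /asboolP[X [sX fX XS]] maxc.
have spanX s : S s -> s \in <<X>>%VS.
  move=> Ss; apply: contraT => nXs; have : A c.+1.
    apply/asboolP; exists (s :: X); rewrite /= sX free_cons nXs; split=> // s'.
    by rewrite inE => /orP[/eqP ->|/XS].
  by move/maxc; rewrite ltnn.
pose M := \matrix_(i < c, l < m) X`_i 0 l.
have Mfree : row_free M by apply: free_matrix.
pose f : 'Hom('rV[K]_m, 'rV[K]_c) := linfun (mulmxr M^T).
have kerf : lker f = T.
  apply/vspaceP => t; rewrite memv_ker lfunE /=.
  have MtE i : (t *m M^T) 0 i = \sum_l X`_i 0 l * t 0 l.
    by rewrite !mxE; apply: eq_bigr => l _; rewrite !mxE mulrC.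
  apply/eqP/idP => [ft|/TS Tt].
    apply/TS => s /spanX; rewrite -{1}(in_tupleE X) => /coord_span ->.
    rewrite (eq_bigr (fun i => \sum_(j < size X) coord (in_tuple X) j s * (X`_j 0 i * t 0 i))).
      rewrite exchange_big big1 //= => j _; rewrite -mulr_sumr.
      have jc : (j < c)%N by rewrite -sX.
      by have := MtE (Ordinal jc); rewrite ft mxE /= => <-; rewrite mulr0.
    move=> i _; rewrite summxE mulr_suml; apply: eq_bigr => j _.
    by rewrite mxE mulrA.
  apply/rowP => i; rewrite MtE mxE; apply/Tt/XS/mem_nth.
  by rewrite sX.
have limf : limg f = fullv.
  apply/vspaceP => b; rewrite memvf; apply/memv_imgP.
  exists (b *m (pinvmx M)^T); first exact: memvf.
  by rewrite lfunE /= -mulmxA -trmx_mul mulmxVp // trmx1 mulmx1.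
have cd : (c + d)%N = m.
  have := limg_ker_dim f fullv; rewrite capfv kerf limf dT !dimvf !dim_matrix !mul1r.
  by rewrite addnC.
pose X' := X ++ vbasis (<<X>>^C)%VS.
have bX' : basis_of fullv X'.
  have cap : (<<X>> :&: <<X>>^C)%VS = 0%VS by rewrite capv_compl.
  rewrite -(addv_complf <<X>>); apply: cat_basis.
  - by rewrite directvE /= dimv_disjoint_sum.
  - by rewrite basisEfree fX subvv /=; move/eqP: fX => ->.
  - exact: vbasisP.
have sX' : size X' = m.
  by have /eqP <- := basis_free bX'; rewrite (span_basis bX') dimvf dim_matrix mul1r.
exists c, (fun i => X'`_i); split=> //.
  move=> i ic; rewrite nth_cat sX ic; apply/XS/mem_nth.
  by rewrite sX.
by rewrite -row_free_unit; apply: free_matrix => //; exact: basis_free bX'.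
Qed.

End LinearAlgebra.

Section HomogeneousDeterminant.
Variables (R : comNzRingType) (n : nat).
Local Notation pol := {mpoly R[n]}.

Lemma prod_homog (I : finType) (F : I -> pol) (e : I -> nat) :
  (forall i, F i \is (e i).-homog) -> \prod_i F i \is (\sum_i e i).-homog.
Proof.
move=> Fe; apply: (big_rec2 (fun d p => p \is d.-homog)) => [|i d p _ pd].
  exact: dhomog1.
exact: dhomogM.
Qed.

Lemma sign_homog d (b : nat) (p : pol) : p \is d.-homog -> (-1) ^+ b * p \is d.-homog.
Proof. by rewrite -signr_odd; case: (odd b); rewrite ?mul1r ?mulN1r // dhomogN. Qed.

Lemma det_homog m (A : 'M[pol]_m) (e : 'I_m -> nat) :
  (forall i l, A i l \is (e i).-homog) -> \det A \is (\sum_i e i).-homog.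
Proof.
by move=> Ae; apply: rpred_sum => s _; apply: sign_homog; apply: prod_homog.
Qed.

(** The cofactor omits row i, which has degree 0, and so has the degree of the whole determinant. *)
Lemma adj_homog m (A : 'M[pol]_m) (e : 'I_m -> nat) i l :
  (forall i l, A i l \is (e i).-homog) -> e i = 0%N ->
  (\adj A) l i \is (\sum_i e i).-homog.
Proof.
move=> Ae ei; rewrite mxE; apply: sign_homog.
rewrite (bigD1_ord i) //= ei add0n; apply: det_homog => i' l'.
by rewrite !mxE.
Qed.

End HomogeneousDeterminant.

Definition linform (K : fieldType) m (s : 'rV[K]_m) : {mpoly K[m]} :=
  \sum_i (s 0 i)%:MP * 'X_i.

Lemma mmap_linform (K L : fieldType) (f : {rmorphism K -> L}) m (s : 'rV[K]_m) a :
  mmap f a (linform s) = \sum_i f (s 0 i) * a i.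
Proof.
rewrite /linform rmorph_sum; apply: eq_bigr => i _ /=.
by rewrite rmorphM /= mmapC mmapX mmap1U.
Qed.

Lemma meval_linform (K : fieldType) m (s : 'rV[K]_m) a :
  (linform s).@[a] = \sum_i s 0 i * a i.
Proof. exact: (mmap_linform idfun s a). Qed.

Lemma linform_homog (K : fieldType) m (s : 'rV[K]_m) : linform s \is 1.-homog.
Proof.
apply: rpred_sum => i _; rewrite mul_mpolyC; apply: rpredZ.
by rewrite dhomogX /= mdeg1.
Qed.

Lemma D_linform (K : fieldType) m (w : 'I_m -> {mpoly K[m]}) (s : 'rV[K]_m) :
  D w (linform s) = \sum_i (s 0 i)%:MP * w i.
Proof.
rewrite D_sum; apply: eq_bigr => i _.
by rewrite D_mul D_const mul0r add0r D_X.
Qed.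

Lemma mderiv_linform (K : fieldType) m (s : 'rV[K]_m) l :
  (linform s)^`M(l) = (s 0 l)%:MP.
Proof.
rewrite raddf_sum (bigD1 l) //= big1 => [|i il].
  by rewrite addr0 mderiv_mulC mderivXU eqxx mulr1.
by rewrite mderiv_mulC mderivXU (negPf il) mulr0.
Qed.

Section Frame.
Variables (K : closedFieldType) (N : nat).
Hypothesis K0 : [pchar K] =i pred0.
Local Notation pol := {mpoly K[N.+1]}.
Implicit Types (x y : proj K N) (v u t : 'rV[K]_N.+1) (f g : pol).

Lemma vanishes_nonzero f x :
  (forall v, v != 0 -> v \in pline x -> f.@[v 0] = 0) -> vanishes_at f x.
Proof.
move=> fx v vx; have [v1 v10 xE] := proj_span x.
move: vx; rewrite xE => /vlineP[c ->].
pose P := \sum_(d < msize f) (pihomog mdeg d f).@[v1 0] *: 'X^d.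
have PE b : P.[b] = f.@[(b *: v1) 0].
  rewrite horner_sum [in RHS](mpoly_sum_homog (leqnn (msize f))) rmorph_sum /=.
  apply: eq_bigr => d _; rewrite hornerZ hornerXn mulrC.
  by rewrite -(meval_scale _ _ (pihomogP _ _ _)).
suff P0 : P = 0 by rewrite -PE P0 horner0.
have : 'X * P = 0.
  apply: (poly_eval0 K0) => b; rewrite hornerM hornerX PE.
  have [->|b0] := eqVneq b 0; first by rewrite mul0r.
  by rewrite fx ?mulr0 // ?scaler_eq0 ?negb_or ?b0 // xE memvZ // memv_line.
by move/eqP; rewrite mulf_eq0 polyX_eq0 => /eqP.
Qed.

Variables (X : set (proj K N)) (n : nat).
Hypotheses (irrX : irreducible X)
  (dimT : forall x, X x -> \dim (tangent_space X x) = n.+1).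

(* A frame at v: the fields w_a are columns of the adjugate of the Jacobian   *)
(* matrix of equations of X completed by linear forms u_a to local parameters *)
(* at v, and g is its determinant.                                            *)
Lemma tangent_frame x v : X x -> v != 0 -> v \in pline x ->
  exists (g : pol) (G : nat) (w : 'I_n.+1 -> 'I_N.+1 -> pol) (u : 'I_n.+1 -> 'rV[K]_N.+1),
  [/\ g.@[v 0] != 0, g \is G.-homog /\ (forall a i, w a i \is G.-homog),
    forall a, tangent_field X (w a),
    forall a b, D (w a) (linform (u b)) = g *+ (a == b) &
    forall y v' t, X y -> v' \in pline y -> t \in tangent_space X y ->
      g.@[v' 0] *: t = \sum_a (linform (u a)).@[t 0] *: field_at (w a) v'].
Proof.
move=> Xx v0 vx.
pose grad f : 'rV[K]_N.+1 := \row_i f^`M(i).@[v 0].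
have [||c [s [cn sS sU]]] := @annihilator_frame _ _ (grad @` hom_ideal X) (tangent_space X x) n.+1.
- move=> t; split=> [/tangent_spaceP Tt _ [f fX <-]|h].
    by rewrite -[RHS](Tt f v fX vx); apply: eq_bigr => i _; rewrite mxE.
  apply: (mem_tangent_space Xx v0 vx) => f fX; rewrite -[RHS](h (grad f)).
    by apply: eq_bigr => i _; rewrite mxE.
  by exists f.
- exact: dimT.
(* The first c rows are equations of X with gradient s_i at v, the others the linear forms s_i
   themselves; the second component is the degree of the gradient. *)
have /choice[phi phiP] : forall i : 'I_N.+1, exists p : pol * nat,
    [/\ forall l, p.1^`M(l) \is (p.2).-homog, grad p.1 = s i,
       (i < c)%N -> hom_ideal X p.1 & (c <= i)%N -> p = (linform (s i), 0%N)].
  move=> i; have [ic|ci] := ltnP i c.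
    have [f fX fs] := sS i ic; have [[d fd] _] := fX.
    by exists (f, d.-1); split=> // l; apply: dhomog_mderiv.
  exists (linform (s i), 0%N); split=> //.
    by move=> l /=; rewrite mderiv_linform -[_%:MP]mulr1 mul_mpolyC; apply: rpredZ; apply: dhomog1.
  by apply/rowP => l; rewrite mxE /= mderiv_linform mevalC.
pose Jac := \matrix_(i < N.+1, l < N.+1) ((phi i).1)^`M(l).
have idx_lt (a : 'I_n.+1) : (c + a < N.+1)%N by rewrite -cn ltn_add2l.
pose idx a := Ordinal (idx_lt a).
have phi_idx a : (phi (idx a)) = (linform (s (idx a)), 0%N).
  by have [_ _ _] := phiP (idx a); apply; apply: leq_addr.
pose G := (\sum_i (phi i).2)%N.
have JacH i l : Jac i l \is ((phi i).2).-homog by rewrite mxE; have [] := phiP i.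
pose g := \det Jac; pose w a i := (\adj Jac) i (idx a).
pose u a := s (idx a).
have gv : g.@[v 0] != 0.
  have : map_mx (meval (v 0)) Jac = \matrix_(i, l) s i 0 l.
    by apply/matrixP => i l; rewrite !mxE; have [_ <- _ _] := phiP i; rewrite mxE.
  by rewrite /g -det_map_mx /= => ->; rewrite -unitfE -unitmxE.
have gG : g \is G.-homog by apply: det_homog.
have wG a i : w a i \is G.-homog.
  by apply: (adj_homog (e := fun i => (phi i).2)) => //; rewrite phi_idx.
have Dw a i : D (w a) (phi i).1 = g *+ (i == idx a).
  have /matrixP/(_ i (idx a)) := mul_mx_adj Jac; rewrite !mxE => <-.
  by apply: eq_bigr => l _; rewrite mxE mulrC.
(* Apply adj(Jac) Jac = g to t: gradients of equations of X kill t, so only the columns belonging to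
   the linear forms remain. *)
have complete y v' t : X y -> v' \in pline y -> t \in tangent_space X y ->
    g.@[v' 0] *: t = \sum_a (linform (u a)).@[t 0] *: field_at (w a) v'.
  move=> Xy v'y /tangent_spaceP Tt; apply/rowP => l.
  pose J' := map_mx (meval (v' 0)) Jac.
  have : (map_mx (meval (v' 0)) (\adj Jac) *m (J' *m t^T)) = g.@[v' 0] *: t^T.
    by rewrite mulmxA -map_mxM mul_adj_mx map_scalar_mx mul_scalar_mx.
  move/matrixP/(_ l 0); rewrite ![in RHS]mxE [in LHS]mxE => e.
  rewrite mxE -e summxE (bigID (fun i : 'I_N.+1 => (i < c)%N)) /= big1 ?add0r.
    rewrite (reindex_onto idx (fun i => inord (i - c))) /=; last first.
      move=> i; rewrite -leqNgt => ci; apply: val_inj => /=.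
      rewrite inordK ?subnKC // ltn_subLR // cn; exact: ltn_ord.
    apply: eq_big => [a|a _].
      by rewrite -leqNgt leq_addr addKn inord_val eqxx.
    rewrite !mxE mulrC; congr (_ * _); last by rewrite /w mxE.
    rewrite meval_linform; apply: eq_bigr => l' _.
    by rewrite !mxE phi_idx mderiv_linform mevalC.
  move=> i ic; rewrite [X in _ * X](_ : _ = 0) ?mulr0 // mxE.
  have [_ _ fX _] := phiP i; rewrite -[RHS](Tt _ v' (fX ic) v'y).
  by apply: eq_bigr => l' _; rewrite !mxE.
exists g, G, w, u; split=> //.
(* As g is not zero on X, it suffices that g D(w_a) f vanishes on X. Where g is nonzero, the u_b are
   coordinates on the tangent space, and the tangent vector with the u-coordinates of w_a is w_a. *)
- move=> a f fX; have [_ _ pr] := vanishing_prime K0 irrX.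
  have [|gX|//] := pr g (D (w a) f); last by have /eqP := gX x Xx v vx; rewrite (negPf gv).
  move=> y Xy; apply: vanishes_nonzero => v' v'0 v'y; rewrite mevalM.
  have [->|gv'] := eqVneq g.@[v' 0] 0; first by rewrite mul0r.
  pose U := \matrix_(b < n.+1, l < N.+1) u b 0 l.
  pose h : 'Hom('rV[K]_N.+1, 'rV[K]_n.+1) := linfun (mulmxr U^T).
  have hE t b : h t 0 b = (linform (u b)).@[t 0].
    rewrite lfunE /= !mxE meval_linform; apply: eq_bigr => l _.
    by rewrite !mxE mulrC.
  have ker0 : (tangent_space X y :&: lker h)%VS = 0%VS.
    apply/eqP; rewrite -subv0; apply/subvP => t; rewrite memv_cap memv_ker memv0.
    move=> /andP[Tt /eqP ht]; have := complete y v' t Xy v'y Tt.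
    rewrite big1 => [|b _]; last by rewrite -hE ht mxE scale0r.
    by move/eqP; rewrite scaler_eq0 (negPf gv').
  have : (h @: tangent_space X y)%VS = fullv.
    apply/eqP; rewrite eqEdim subvf dimvf dim_matrix mul1r.
    have := limg_ker_dim h (tangent_space X y).
    by rewrite ker0 dimv0 add0n (dimT Xy) => ->; rewrite ltnSn.
  move=> himg.
  have : (\row_b (g.@[v' 0] *+ (a == b))) \in (h @: tangent_space X y)%VS.
    by rewrite himg memvf.
  move=> /memv_imgP[t Tt ht].
  have tE : t = field_at (w a) v'.
    apply: (scalerI gv'); rewrite (complete y v' t) // (bigD1 a) //= big1 => [|b ba].
      by rewrite -hE -ht mxE eqxx addr0.
    by rewrite -hE -ht mxE eq_sym (negPf ba) scale0r.
  rewrite meval_D_at -tE (_ : \sum_i _ = 0) ?mulr0 //.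
  rewrite (eq_bigr (fun i => \sum_(d < msize f) (pihomog mdeg d f)^`M(i).@[v' 0] * t 0 i)).
    rewrite exchange_big big1 //= => d _; move/tangent_spaceP: Tt; apply=> //.
    split; first by exists d; apply: pihomogP.
    exact: vanishing_pihomog.
  move=> i _; rewrite {1}(mpoly_sum_homog (leqnn (msize f))).
  by rewrite (raddf_sum (mderiv i)) (raddf_sum (meval _)) mulr_suml.
- move=> a b; rewrite -[linform _]/((linform (s (idx b)), 0%N).1) -phi_idx Dw.
  by rewrite -val_eqE /= eqn_add2l eq_sym.
Qed.

End Frame.

(** * Finiteness of the order of vanishing *)

Section FiniteOrder.
Variables (K : closedFieldType) (N : nat).
Hypothesis K0 : [pchar K] =i pred0.
Local Notation pol := {mpoly K[N.+1]}.
Implicit Types (x y : proj K N) (v t : 'rV[K]_N.+1) (f g : pol).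
Variables (X Y : set (proj K N)) (n : nat).
Hypotheses (irrX : irreducible X)
  (dimT : forall x, X x -> \dim (tangent_space X x) = n.+1)
  (dimX : is_dim X n) (YX : Y `<=` X) (irrY : irreducible Y).

(** On polynomials in u, the field w_a acts as g times the partial derivative in u_a, and g cancels.
    All partial derivatives of p thus have infinite order and are zero by induction on the degree,
    which leaves a constant. *)
Lemma vorder_parameters (g : pol) (w : 'I_n.+1 -> 'I_N.+1 -> pol) (u : 'I_n.+1 -> pol)
    (p : {mpoly K[n.+1]}) :
  ~ vanishing Y g -> (forall a, tangent_field X (w a)) ->
  (forall a b, D (w a) (u b) = g *+ (a == b)) ->
  (forall k, vorder X Y k (subst u p)) -> p = 0.
Proof.
move=> gY wX wu; have [s] : exists s, forall m, (s <= mdeg m)%N -> p@_m = 0.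
  by exists (msize p) => m le; apply: memN_msupp_eq0; apply: mmeasure_mnm_ge le.
elim: s p => [|s IH] p ps pY; first by apply/mpolyP => m; rewrite mcoeff0 ps.
have pa a : p^`M(a) = 0.
  apply: IH => [m sm|k]; first by rewrite mcoeff_mderiv ps ?mul0rn // mdegD mdeg1 addn1.
  apply: (vorder_cancel K0 irrY gY).
  have [_ /(_ (w a) (wX a))] := pY k.+1; rewrite D_comp (bigD1 a) //= wu eqxx mulrC.
  by rewrite big1 ?addr0 // => b ba; rewrite wu eq_sym (negPf ba) mulr0.
have pc m : m != 0%MM -> p@_m = 0.
  move=> m0; have [a ma] : exists a, m a != 0%N.
    apply: contrapT => /forallNP h; move/eqP: m0; apply; apply/mnmP => a.
    by rewrite mnm0E; apply/eqP/negP => /negP; apply: h.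
  have /(congr1 (mcoeff (m - U_(a))%MM)) := pa a.
  rewrite mcoeff_mderiv submK ?lep1mP // mcoeff0 -mulr_natr => /eqP.
  by rewrite mulf_eq0; move/pcharf0P: K0 => -> /= /orP[/eqP|].
have pE : p = (p@_0%MM)%:MP.
  apply/mpolyP => m; rewrite mcoeffC; have [->|m0] := eqVneq m 0%MM.
    by rewrite mulr1.
  by rewrite pc // mulr0.
have [_ [y Yy] _] := irrY; have [pY1 _] := pY 1%N; have [v v0 yE] := proj_span y.
have := pY1 y Yy v; rewrite yE memv_line pE /subst mmapC mevalC => /(_ isT) ->.
by rewrite mpolyC0.
Qed.

Lemma not_indep_on (g : 'I_n.+2 -> pol) : ~ indep_on X g.
Proof.
move=> /(indep_flag K0 irrX)[W [[Wirr Wlt] WX]]; have [_ /(_ n.+1)] := dimX.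
rewrite ltnn => h; suff /h : irred_chain X n.+1 by [].
have sub i j : (j + i = n.+1)%N -> W i `<=` X.
  elim: j i => [|j IH] i; first by rewrite add0n => ->; rewrite WX.
  rewrite addSnnS => ij; apply: subset_trans (IH _ ij); apply: (Wlt i _).1.
  by rewrite -ij leq_addl.
exists W; split=> // i ni; split; first exact: Wirr.
by apply: (sub _ (n.+1 - i)%N); rewrite subnK.
Qed.

(** The n + 1 parameters u and h are n + 2 functions on a cone of dimension n + 1, so c(u) = - h r
    on X with c nonzero; if h had infinite order along Y, so would c(u). *)
Lemma finite_vorder (h : pol) : ~ vanishing X h -> exists k, ~ vorder X Y k h.
Proof.
move=> hX; apply: contrapT => /forallNP hY0.
have hY k : vorder X Y k h by apply: contrapT.
have [_ [y Yy] _] := irrY; have [v v0 yE] := proj_span y.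
have vy : v \in pline y by rewrite yE memv_line.
have [g [G [w [u [gv _ wX wu _]]]]] := tangent_frame K0 irrX dimT (YX Yy) v0 vy.
have gY : ~ vanishing Y g by move=> /(_ y Yy v vy)/eqP; rewrite (negPf gv).
have /existsNP[q /not_implyP[qX /eqP q0]] := @not_indep_on (extend (fun a => linform (u a)) h).
have [c [r [/eqP c0 cX]]] := last_relation K0 irrX hX q0 qX; apply: c0.
apply: (vorder_parameters gY wX wu) => k.
have idk := vorder_ideal X Y k; have [_ _ kM] := idk.
have h1 : vorder X Y k (h * r) by rewrite mulrC; apply: kM.
by have := idealB idk (vorder_vanishing YX k cX) h1; rewrite addrK.
Qed.

End FiniteOrder.

(** * Hyperplanes and secant varieties *)

Section Hyperplanes.
Variables (K : closedFieldType) (N : nat).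
Hypothesis K0 : [pchar K] =i pred0.
Local Notation pol := {mpoly K[N.+1]}.
Implicit Types (x y : proj K N) (v t : 'rV[K]_N.+1) (f g : pol) (X : set (proj K N)).
Implicit Types (L : {vspace 'rV[K]_N.+1}).

Lemma hyperplane_through X L : non_degenerate X -> (\dim L <= N)%N ->
  exists s : 'rV[K]_N.+1, {in L, forall t, (linform s).@[t 0] = 0} /\
    ~ vanishing X (linform s).
Proof.
move=> ndX dL.
pose A := \matrix_(i < \dim L, l < N.+1) (vbasis L)`_i 0 l.
have [s s0 sA] : exists2 s : 'rV[K]_N.+1, s != 0 & s *m A^T = 0.
  have : kermx A^T != 0.
    rewrite kermx_eq0 /row_free mxrank_tr neq_ltn (leq_ltn_trans (rank_leq_row _)) //.
  by move/rowV0Pn => [s /sub_kermxP sA s0]; exists s.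
exists s; split.
  move=> t /coord_vbasis ->; rewrite meval_linform.
  have -> : \sum_i s 0 i * (\sum_(j < \dim L) coord (vbasis L) j t *: (vbasis L)`_j) 0 i =
      \sum_(j < \dim L) coord (vbasis L) j t * (s *m A^T) 0 j.
    rewrite (eq_bigr (fun i => \sum_(j < \dim L)
        coord (vbasis L) j t * (s 0 i * (vbasis L)`_j 0 i))).
      rewrite exchange_big; apply: eq_bigr => j _; rewrite -mulr_sumr mxE.
      by congr (_ * _); apply: eq_bigr => i _; rewrite !mxE.
    move=> i _; rewrite summxE mulr_sumr; apply: eq_bigr => j _.
    by rewrite mxE mulrCA.
  by rewrite sA big1 // => j _; rewrite mxE mulr0.
pose h : 'Hom('rV[K]_N.+1, 'rV[K]_1) := linfun (mulmxr s^T).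
have hE t : h t 0 0 = (linform s).@[t 0].
  rewrite lfunE /= mxE meval_linform; apply: eq_bigr => i _.
  by rewrite mxE mulrC.
have dimH : \dim (lker h) = N.
  have himg : limg h = fullv.
    apply/vspaceP => b; rewrite memvf; apply/memv_imgP.
    have [l sl] : exists l, s 0 l != 0.
      apply: contrapT => /forallNP sl; move/eqP: s0; apply; apply/rowP => l.
      by rewrite mxE; apply/eqP/negP => /negP; apply: sl.
    exists ((b 0 0 / s 0 l) *: delta_mx 0 l); first exact: memvf.
    apply/rowP => i; rewrite ord1 hE meval_linform (bigD1 l) //= big1.
      by rewrite !mxE !eqxx mulr1 addr0 mulrC divfK.
    by move=> j jl; rewrite !mxE (negPf jl) andbF !mulr0.
  have := limg_ker_dim h fullv; rewrite capfv himg !dimvf !dim_matrix !mul1r.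
  by rewrite addn1 => -[].
move=> sX; apply: (ndX _ dimH) => x Xx; apply/subvP => t tx.
rewrite memv_ker; apply/eqP/rowP => i; rewrite ord1 hE mxE.
exact: (sX x Xx t tx).
Qed.

Lemma non_degenerate_two X x : (0 < N)%N -> non_degenerate X ->
  exists2 y, X y & y != x.
Proof.
move=> N0 ndX; have [|s [sx sX]] := hyperplane_through (L := pline x) ndX.
  by case: x => U /= /eqP ->.
apply: contrapT => h; apply: sX => y Xy v vy; apply: sx.
suff <- : y = x by [].
by apply/eqP; apply: contrapT => /negP yx; apply: h; exists y.
Qed.

Definition secant_set X : set (proj K N) :=
  [set z | exists x x', [/\ X x, X x', x != x' & (z <= x + x')%VS]].

Variable X : set (proj K N).
Hypothesis X2 : forall x, exists2 y, X y & y != x.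

Lemma sub_secant_set : X `<=` secant_set X.
Proof.
move=> x Xx; have [y Xy yx] := X2 x; exists x, y; rewrite eq_sym; split=> //.
exact: addvSl.
Qed.

Lemma secant_add q v v' x x' : vanishing (secant_set X) q -> X x -> X x' ->
  v \in pline x -> v' \in pline x' -> q.@[(v + v') 0] = 0.
Proof.
move=> qS Xx Xx' vx v'x'; have [e|ne] := eqVneq x x'.
  by apply: (qS x); [exact: sub_secant_set|rewrite rpredD // e].
have [->|vv] := eqVneq (v + v') 0.
  by apply: (qS x); [exact: sub_secant_set|exact: mem0v].
have [z zE] := span_proj vv; apply: (qS z); last by rewrite zE memv_line.
by exists x, x'; split=> //; rewrite zE -memvE memv_add.
Qed.

(** For fixed v over y, q(x - v) vanishes for all x in the cone over X; d derivatives along w at x =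
    v give d! q(w(v)) = 0. *)
Lemma secant_tangent d q w y v : q \is d.-homog -> vanishing (secant_set X) q ->
  tangent_field X w -> X y -> v \in pline y -> q.@[(field_at w v) 0] = 0.
Proof.
move=> qd qS wX Xy vy.
pose F := subst (fun i => 'X_i - (v 0 i)%:MP) q.
have FX : vanishing X F.
  move=> x Xx t tx; rewrite meval_subst.
  rewrite -[RHS](secant_add qS Xx Xy tx (_ : - v \in pline y)) ?rpredN //.
  by apply: meval_eq => i; rewrite mevalB mevalXU mevalC !mxE.
have : vanishing X (iter d (D w) F) by elim: (d) => //= j IH; apply: wX.
move=> /(_ y Xy v vy); rewrite (order_translate w (v 0) qd).2 => /eqP.
have d0 : d`!%:R != 0 :> K by move/pcharf0P: K0 => ->; rewrite -lt0n fact_gt0.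
rewrite mulf_eq0 (negPf d0) => /eqP <-.
by apply: meval_eq => i; rewrite mxE.
Qed.

(** Sums of two vectors of the cone over X fill the cone over the secant set. If f and g are not
    zero on it, primality of the ideal of X gives a first summand for which neither is identically
    zero in the second, and then applies again to the second. *)
Lemma secant_irreducible : irreducible X -> irreducible (secant_variety X).
Proof.
move=> irrX; have [cX [x0 Xx0] _] := irrX.
have sub : secant_set X `<=` secant_variety X by move=> z Sz B [cB]; apply.
have Sclosed : zclosed (secant_variety X).
  exists [set f | (exists d, f \is d.-homog) /\ vanishing (secant_set X) f].
    by move=> f [].
  apply/seteqP; split=> z.
    move=> Sz f [[d fd] fS]; apply: (Sz [set z | vanishes_at f z]); split=> //.
    exact: zclosed_vanishing.
  move=> h B [cB SB]; apply: contrapT => nBz.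
  have [d [f [fd fB nf]]] := zclosedN cB nBz; apply: nf; apply: h; split.
    by exists d.
  by move=> y /SB; apply: fB.
split=> //; first by exists x0; apply: sub; apply: sub_secant_set.
move=> B1 B2 c1 c2 S12; apply: contrapT => /not_orP[].
have main B : zclosed B -> ~ secant_variety X `<=` B -> exists f : pol,
    vanishing B f /\ exists x x' v v', [/\ X x, X x', v \in pline x, v' \in pline x' &
      f.@[(v + v') 0] != 0].
  move=> cB nB; have [z [Sz nBz]] : exists z, secant_set X z /\ ~ B z.
    apply: contrapT => /forallNP h; apply: nB => z Sz; apply: (Sz B); split=> //.
    by move=> y Sy; apply: contrapT => nBy; apply: (h y).
  have [d [f [fd fB nf]]] := zclosedN cB nBz; exists f; split=> //.
  have [v [vz fv]] : exists v, v \in pline z /\ f.@[v 0] != 0.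
    apply: contrapT => /forallNP h; apply: nf => v vz; apply/eqP/negP => /negP fv.
    by apply: (h v).
  have [x [x' [Xx Xx' _ zxx]]] := Sz.
  have /memv_addP[a ax [b bx' vE]] := subvP zxx _ vz.
  by exists x, x', a, b; rewrite -vE.
move=> /(main _ c1)[f [fB [x1 [x1' [v1 [v1' [Xx1 Xx1' v1x v1x' f1]]]]]]].
move=> /(main _ c2)[g [gB [x2 [x2' [v2 [v2' [Xx2 Xx2' v2x v2x' g2]]]]]]].
have [_ _ pr] := vanishing_prime K0 irrX.
pose tr (a : 'rV[K]_N.+1) (q : pol) := subst (fun i => 'X_i + (a 0 i)%:MP) q.
have trE a q t : (tr a q).@[t 0] = q.@[(t + a) 0].
  by rewrite meval_subst; apply: meval_eq => i; rewrite mevalD mevalXU mevalC mxE.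
have [x [v [Xx [vx fgv]]]] : exists x v, X x /\ v \in pline x /\ (tr v1' f * tr v2' g).@[v 0] != 0.
  apply: contrapT => h.
  have : vanishing X (tr v1' f * tr v2' g).
    move=> x Xx v vx; apply/eqP/negP => /negP fg; apply: h.
    by exists x, v.
  case/pr => [/(_ x1 Xx1 v1 v1x)|/(_ x2 Xx2 v2 v2x)]; rewrite trE => /eqP.
    by rewrite (negPf f1).
  by rewrite (negPf g2).
move: fgv; rewrite mevalM mulf_eq0 negb_or !trE => /andP[fv gv].
have : vanishing X (tr v f * tr v g).
  move=> x' Xx' v' v'x'; rewrite mevalM !trE -mevalM addrC.
  apply: (secant_add _ Xx Xx' vx v'x') => z /sub/S12[/fB h|/gB h] t tz.
    by rewrite mevalM h ?mul0r.
  by rewrite mevalM h ?mulr0.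
case/pr => [/(_ x1' Xx1' v1' v1x')|/(_ x2' Xx2' v2' v2x')]; rewrite trE addrC => /eqP.
  by rewrite (negPf fv).
by rewrite (negPf gv).
Qed.

End Hyperplanes.

(** * The generic tangent vector along Y *)

Section Eigenvalues.
Variables (k F : fieldType) (f : {rmorphism k -> F}) (S : set F).

Let clp (p : {poly F}) := forall i, cl f S p`_i.

Let clp_sum (I : Type) (r : seq I) (P : pred I) (G : I -> {poly F}) :
  (forall i, P i -> clp (G i)) -> clp (\sum_(i <- r | P i) G i).
Proof. by move=> clG i; rewrite coef_sum; apply: cl_sum => j /clG. Qed.

Let clpM p q : clp p -> clp q -> clp (p * q).
Proof. by move=> cp cq i; rewrite coefM; apply: cl_sum => j _; apply: clM. Qed.

Let clp_C c : cl f S c -> clp c%:P.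
Proof. by move=> cc i; rewrite coefC; case: eqP => _ //; apply: cl0. Qed.

Lemma cl_char_poly m (M : 'M[F]_m) : (forall i j, cl f S (M i j)) ->
  forall i, cl f S (char_poly M)`_i.
Proof.
move=> clM'; rewrite -/(clp _) /char_poly; apply: clp_sum => s _; apply: clpM.
  have -> : (-1) ^+ perm.odd_perm s = ((-1) ^+ perm.odd_perm s)%:P :> {poly F}.
    by rewrite rmorphXn rmorphN1.
  by apply: clp_C; apply: clX; rewrite -sub0r; apply: clB; [apply: cl0|apply: cl1].
apply: (big_ind clp) => [||i _]; [exact: clp_C (cl1 _ _)|exact: clpM|].
rewrite !mxE => l; rewrite coefB; apply: clB; last exact: clp_C.
rewrite coefMn coefX; case: (i == _); last by rewrite mulr0n; apply: cl0.
by case: eqP => _; [apply: cl1|apply: cl0].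
Qed.

(** s is an eigenvalue of the matrix c, hence a root of a characteristic polynomial with
    coefficients in the closure. *)
Lemma cl_stable (I : finType) (b : I -> F) (c : I -> I -> F) s :
  (exists i, b i != 0) -> (forall i j, cl f S (c i j)) ->
  (forall i, s * b i = \sum_j c i j * b j) -> cl f S s.
Proof.
move=> [i0 bi0] clc sb.
pose M : 'M[F]_#|I| := \matrix_(i, j) c (enum_val j) (enum_val i).
apply: (@algebraic_cl _ _ _ _ (char_poly M)).
- by rewrite monic_neq0 // char_poly_monic.
- by apply: cl_char_poly => i j; rewrite mxE.
- rewrite -eigenvalue_root_char; apply/eigenvalueP.
  exists (\row_i b (enum_val i)).
    apply/rowP => j; rewrite !mxE sb (reindex (@enum_val _ (mem I))) /=.
      by apply: eq_bigr => i _; rewrite !mxE mulrC.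
    by apply: onW_bij; apply: enum_val_bij.
  apply: contraNneq bi0 => /rowP/(_ (enum_rank i0)).
  by rewrite !mxE enum_rankK => ->.
Qed.

End Eigenvalues.

Section Spans.
Variables (k F : fieldType) (f : {rmorphism k -> F}) (S : set F) (n : nat) (y : 'I_n -> F).

(* The condition mdeg b = d - e is stated additively, so that there is no such *)
(* monomial if d < e.                                                         *)
Definition mspan e d : set F := [set z | exists c : 'X_{1..n < d.+1} -> F,
  (forall b, cl f S (c b)) /\
  z = \sum_(b : 'X_{1..n < d.+1} | (mdeg b + e == d)%N) c b * mmap1 y b].

Lemma mspan0 e d : mspan e d 0.
Proof.
exists (fun=> 0); split=> [b|]; first exact: cl0.
by rewrite big1 // => b _; rewrite mul0r.
Qed.

Lemma mspanD e d z1 z2 : mspan e d z1 -> mspan e d z2 -> mspan e d (z1 + z2).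
Proof.
move=> [c1 [cl1 ->]] [c2 [cl2 ->]]; exists (fun b => c1 b + c2 b); split=> [b|].
  exact: clD.
by rewrite -big_split; apply: eq_bigr => b _; rewrite mulrDl.
Qed.

Lemma mspanZ e d c z : cl f S c -> mspan e d z -> mspan e d (c * z).
Proof.
move=> clc [c1 [cl1 ->]]; exists (fun b => c * c1 b); split=> [b|]; first exact: clM.
by rewrite mulr_sumr; apply: eq_bigr => b _; rewrite mulrA.
Qed.

Lemma mspan_sum e d (I : Type) (r : seq I) (P : pred I) (G : I -> F) :
  (forall i, P i -> mspan e d (G i)) -> mspan e d (\sum_(i <- r | P i) G i).
Proof. by move=> h; apply: big_ind => //; [apply: mspan0|move=> *; apply: mspanD]. Qed.

Lemma mspan_mon e d (b : 'X_{1..n}) : (mdeg b + e)%N = d -> mspan e d (mmap1 y b).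
Proof.
move=> bd; have bd1 : (mdeg b < d.+1)%N by rewrite ltnS -bd leq_addr.
exists (fun b' => (b' == BMultinom bd1)%:R); split=> [b'|].
  by case: eqP => _; [apply: cl1|apply: cl0].
rewrite (bigD1 (BMultinom bd1)) /=; last by rewrite bd.
rewrite eqxx mul1r big1 ?addr0 // => b' /andP[_ /negPf ->].
by rewrite mul0r.
Qed.

Lemma mspan_homog e d (p : {mpoly k[n]}) : p \is d.-homog -> mspan e (d + e) (mmap f y p).
Proof.
move=> /dhomogP pd; rewrite /mmap big_seq; apply: mspan_sum => b /pd /= bd.
by apply: mspanZ; [apply: cl_const|apply: mspan_mon; rewrite bd].
Qed.

Lemma mspanS e d z : mspan e.+1 d.+1 z -> mspan e d z.
Proof.
move=> [c [clc ->]]; apply: mspan_sum => b /eqP bd; apply: mspanZ => //.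
by apply: mspan_mon; apply/eqP; rewrite -eqSS -addnS bd.
Qed.

Lemma mspanS' e d z : mspan e d z -> mspan e.+1 d.+1 z.
Proof.
move=> [c [clc ->]]; apply: mspan_sum => b /eqP bd; apply: mspanZ => //.
by apply: mspan_mon; rewrite addnS bd.
Qed.

Lemma mspan_X e d i z : mspan e d z -> mspan e d.+1 (y i * z).
Proof.
move=> [c [clc ->]]; rewrite mulr_sumr; apply: mspan_sum => b /eqP bd.
rewrite mulrCA; apply: mspanZ => //.
have -> : y i * mmap1 y b = mmap1 y (U_(i) + b)%MM.
  by rewrite -[RHS](mmapX y f) mpolyXD rmorphM /= !mmapX mmap1U.
by apply: mspan_mon; rewrite mdegD mdeg1 add1n addSn bd.
Qed.

Lemma mspan_fill e d i z : mspan e d z -> mspan 0 d (y i ^+ e * z).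
Proof.
elim: e d z => [|e IH] d z; first by rewrite expr0 mul1r.
case: d => [|d] h.
  (* No monomial has degree 0 - (e + 1), so this span is zero. *)
  have -> : z = 0 by case: h => c [_ ->]; apply: big1 => b; rewrite addnS.
  by rewrite mulr0; apply: mspan0.
rewrite exprS -mulrA; apply: mspan_X; apply: IH; exact: mspanS.
Qed.

(* Multiplication by s preserves a nonzero finite-dimensional space.          *)
Lemma mspan_stable d s : (exists i, y i != 0) ->
  (forall b : 'X_{1..n}, mdeg b = d -> mspan 0 d (s * mmap1 y b)) -> cl f S s.
Proof.
move=> [i yi] sb; pose I := {b : 'X_{1..n < d.+1} | mdeg b == d}.
have /choice[c cP] : forall b : I, exists c : 'X_{1..n < d.+1} -> F,
    (forall b', cl f S (c b')) /\
    s * mmap1 y (val b) = \sum_(b' : 'X_{1..n < d.+1} | (mdeg b' + 0 == d)%N) c b' * mmap1 y b'.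
  by move=> b; apply: sb; apply/eqP/(valP b).
apply: (@cl_stable _ _ _ _ I (fun b => mmap1 y (val b)) (fun b b' => c b (val b'))).
- have di : (mdeg (U_(i) *+ d)%MM < d.+1)%N by rewrite mdegMn mdeg1 mul1n.
  have di' : mdeg (BMultinom di) == d by rewrite /= mdegMn mdeg1 mul1n.
  exists (Sub (BMultinom di) di'); rewrite SubK /= /mmap1.
  rewrite (bigD1 i) //= big1 ?mulr1 => [|i' ii'].
    by rewrite expf_neq0.
  by rewrite mulmnE mnm1E eq_sym (negPf ii') mul0n expr0.
- by move=> b b'; apply: (cP b).1.
- move=> b; rewrite (cP b).2 (eq_bigl (fun b' => mdeg (bmnm b') == d)) => [|b'].
    rewrite (reindex_omap (val : I -> 'X_{1..n < d.+1}) insub) /= => [|b' bd].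
      by apply: eq_bigl => x; rewrite valK eqxx andbT (valP x).
    by rewrite insubT.
  by rewrite addn0.
Qed.

End Spans.

Lemma pihomog_mulX (K : fieldType) n (q : {mpoly K[n]}) i d :
  pihomog mdeg d ('X_i * q) = if d is d'.+1 then 'X_i * pihomog mdeg d' q else 0.
Proof.
pose k := maxn (msize q) d.+1.
have Xh e : ('X_i * pihomog mdeg e q) \is e.+1.-homog.
  rewrite -add1n; apply: dhomogM; last exact: pihomogP.
  by rewrite dhomogX /= mdeg1.
have -> : 'X_i * q = \sum_(e < k) 'X_i * pihomog mdeg e q.
  by rewrite -mulr_sumr -(mpoly_sum_homog (leq_maxl (msize q) d.+1)).
rewrite raddf_sum /=; case: d @k => [|d] k.
  by rewrite big1 // => e _; rewrite (pihomog_ne0 _ (Xh e)).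
have dk : (d < k)%N by rewrite /k leq_max ltnS leqnSn orbT.
rewrite (bigD1 (Ordinal dk)) //= (pihomog_dE (Xh d)) big1 ?addr0 // => e ed.
by rewrite (pihomog_ne0 _ (Xh e)) // eqSS.
Qed.

Lemma dhomog0_const (R : nzRingType) n (q : {mpoly R[n]}) : q \is 0.-homog -> q = (q@_0)%:MP.
Proof.
move=> q0; apply/mpolyP => m; rewrite mcoeffC eq_sym.
case: (eqVneq m 0%MM) => [->|m0]; first by rewrite mulr1.
by rewrite mulr0 (dhomog_nemf_coeff q0) // mdeg_eq0.
Qed.

Lemma D_homog (R : comNzRingType) n G d (w : 'I_n -> {mpoly R[n]}) (q : {mpoly R[n]}) :
  (forall i, w i \is G.-homog) -> q \is d.-homog -> D w q \is (G + d.-1).-homog.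
Proof.
by move=> wG qd; apply: rpred_sum => i _; apply: dhomogM (wG i) (dhomog_mderiv i qd).
Qed.

Lemma mmap_eq n (R S : nzRingType) (f f' : R -> S) (a b : 'I_n -> S) (q : {mpoly R[n]}) :
  f =1 f' -> a =1 b -> mmap f a q = mmap f' b q.
Proof.
by move=> ff' ab; rewrite (mmap_ext _ _ ab); apply: eq_bigr => m _; rewrite ff'.
Qed.

(** * Transcendence degree of the generic tangent vector *)

Section Estimate.
Variables (K : closedFieldType) (N : nat).
Hypothesis K0 : [pchar K] =i pred0.
Local Notation pol := {mpoly K[N.+1]}.
Implicit Types (x y : proj K N) (v t : 'rV[K]_N.+1) (f g : pol).
Variables (X Y : set (proj K N)) (n r : nat).
Hypotheses (irrX : irreducible X)
  (dimT : forall x, X x -> \dim (tangent_space X x) = n.+1)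
  (dimX : is_dim X n) (YX : Y `<=` X) (irrY : irreducible Y).
Variable gY : 'I_r.+1 -> pol.
Hypothesis gY_indep : indep_on Y gY.
Variable s : 'rV[K]_N.+1.
Hypotheses (sT : forall y t, Y y -> t \in tangent_space X y -> (linform s).@[t 0] = 0)
  (sX : ~ vanishing X (linform s)).
Let h := linform s.

Lemma vanishing_orY f g : vanishing Y (f * g) -> vanishing Y f \/ vanishing Y g.
Proof. by have [_ _ pr] := vanishing_prime K0 irrY; apply: pr. Qed.

Lemma point_in_tangent_space y v : X y -> v != 0 -> v \in pline y ->
  v \in tangent_space X y.
Proof.
move=> Xy v0 vy; apply: (mem_tangent_space Xy v0 vy) => f [[d fd] fX].
rewrite (eq_bigr (fun i => v 0 i * f^`M(i).@[v 0])) => [|i _]; last exact: mulrC.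
by rewrite (euler _ fd) (fX y Xy v vy) mulr0.
Qed.

(** Both v and the values of tangent fields at v lie in the tangent space, where the form vanishes.
    Order 2 is what makes the exponent e + 1 below positive. *)
Lemma vorder2 : vorder X Y 2 h.
Proof.
split=> [y Yy|w wX].
  apply: (vanishes_nonzero K0) => v v0 vy; apply: (sT Yy).
  by apply: point_in_tangent_space => //; apply: YX.
split=> // y Yy; apply: (vanishes_nonzero K0) => v v0 vy.
rewrite D_linform -[RHS](sT Yy (tangent_field_at wX (YX Yy) v0 vy)) meval_linform rmorph_sum.
by apply: eq_bigr => i _; rewrite /= mevalM mevalC mxE.
Qed.

Lemma exact_vorder : exists e, vorder X Y e.+2 h /\ ~ vorder X Y e.+3 h.
Proof.
have [k nk] := finite_vorder K0 irrX dimT dimX YX irrY sX.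
have exk : exists k, `[< ~ vorder X Y k h >] by exists k; apply/asboolP.
case: (ex_minnP exk) => m /asboolP nm mmin.
have m3 : (2 < m)%N.
  by rewrite ltnNge; apply/negP => m2; apply: nm; apply: vorder_le m2 vorder2.
case: m m3 nm mmin => [|[|[|e]]] // _ nm mmin; exists e; split=> //.
apply: contrapT => ne; have : (e.+3 <= e.+2)%N by apply: mmin; apply/asboolP.
by rewrite ltnn.
Qed.

(* Functions on the product of the cone over Y and the affine space A^(n+1):  *)
(* polynomials in parameters c_0, .., c_n with coefficients in K[x_0, .., x_N].*)
Local Notation A := {mpoly pol[n.+1]}.
Let ev v (c : 'I_n.+1 -> K) : A -> K := mmap (meval (v 0)) (fun a => c a).

Let P : set A := [set Q | forall y v c, Y y -> v != 0 -> v \in pline y -> ev v c Q = 0].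

(** For suitable constants c neither of two nonzero factors specializes to zero on Y, and the ideal
    of Y is prime. *)
Let P_prime : prime_ideal P.
Proof.
split.
- split=> [y v c _ _ _|Q1 Q2 P1 P2 y v c Yy v0 vy|Q1 Q2 P2 y v c Yy v0 vy].
  + by rewrite /ev rmorph0.
  + by rewrite /ev rmorphD /= -!/(ev _ _ _) (P1 y v c) // (P2 y v c) // addr0.
  + by rewrite /ev rmorphM /= -!/(ev _ _ _) (P2 y v c) // mulr0.
- have [_ [y Yy] _] := irrY; have [v v0 yE] := proj_span y.
  move=> /(_ y v (fun=> 0) Yy v0); rewrite yE memv_line /ev rmorph1 => /(_ isT)/eqP.
  by rewrite oner_eq0.
- move=> Q1 Q2 P12; apply: contrapT => /not_orP[].
  pose sp c (Q : A) : pol := mmap idfun (fun a => (c a)%:MP) Q.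
  have spE c Q v : (sp c Q).@[v 0] = ev v c Q.
    rewrite /sp (rmorph_mmap idfun (meval (v 0))); apply: mmap_ext => a /=.
    exact: mevalC.
  have main Q : ~ P Q -> exists (q : {mpoly K[n.+1]}), q != 0 /\
      forall c, q.@[c] != 0 -> ~ vanishing Y (sp c Q).
    move=> nP; have [y [v [c [Yy [v0 [vy Qn0]]]]]] : exists y v c,
        Y y /\ v != 0 /\ v \in pline y /\ ev v c Q != 0.
      apply: contrapT => H; apply: nP => y v c Yy v0 vy; apply/eqP/negP => /negP Qn0.
      by apply: H; exists y, v, c.
    have qE c' : (map_mpoly (meval (v 0)) Q).@[c'] = ev v c' Q.
      exact: (mmap_map_mpoly (meval (v 0)) idfun c' Q).
    exists (map_mpoly (meval (v 0)) Q); split.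
      by apply: contraNneq Qn0 => q0; rewrite -qE q0 meval0.
    by move=> c'; rewrite qE => Qc /(_ y Yy v vy)/eqP; rewrite spE (negPf Qc).
  move=> /main[q1 [q10 n1]] /main[q2 [q20 n2]].
  have [c qc] : exists c, (q1 * q2).@[c] != 0.
    apply: contrapT => /forallNP H; have /eqP := mulf_neq0 q10 q20; apply.
    by apply: (mpoly_eval0 K0) => c; apply/eqP/negP => /negP; apply: H.
  move: qc; rewrite mevalM mulf_eq0 negb_or => /andP[/n1 nv1 /n2 nv2].
  have : vanishing Y (sp c Q1 * sp c Q2).
    move=> y Yy; apply: (vanishes_nonzero K0) => v v0 vy.
    by rewrite mevalM !spE -(P12 y v c Yy v0 vy) /ev rmorphM.
  by case/vanishing_orY.
Qed.

(* The k-th iterated derivative of f along sum_a c_a w_a, the c_a being       *)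
(* treated as constants.                                                      *)
Fixpoint parametrized k (w : 'I_n.+1 -> 'I_N.+1 -> pol) (c : 'I_n.+1 -> A) (f : pol) : A :=
  if k is k'.+1 then \sum_a c a * parametrized k' w c (D (w a) f) else f%:MP.

Let evC v c f : ev v c f%:MP = f.@[v 0].
Proof. by rewrite /ev mmapC. Qed.

Let ev_sum v c (I : finType) (G : I -> A) : ev v c (\sum_i G i) = \sum_i ev v c (G i).
Proof. by rewrite /ev rmorph_sum. Qed.

Let evM v c Q1 Q2 : ev v c (Q1 * Q2) = ev v c Q1 * ev v c Q2.
Proof. by rewrite /ev rmorphM. Qed.

Let evX v c a : ev v c 'X_a = c a.
Proof. by rewrite /ev mmapX mmap1U. Qed.

Let ev_parametrized v c k w c' f : ev v c (parametrized k w c' f) =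
  (iter k (D (fun i => \sum_a (ev v c (c' a))%:MP * w a i)) f).@[v 0].
Proof.
elim: k f => [|k IH] f; first exact: evC.
rewrite ev_sum iterSr D_lin iterD_sum rmorph_sum; apply: eq_bigr => a _ /=.
by rewrite evM IH iterD_scale mevalM mevalC.
Qed.

Let parametrized0 k w c : parametrized k w c 0 = 0.
Proof.
elim: k => [|k IH] /=; first exact: mpolyC0.
by rewrite big1 // => a _; rewrite D0 IH mulr0.
Qed.

Section Frame.
Variables (E : fieldType) (pi : {rmorphism A -> E}).
Hypothesis piP : forall Q, pi Q = 0 <-> P Q.
Variable e : nat.
Hypotheses (he : vorder X Y e.+2 h) (nhe : ~ vorder X Y e.+3 h).
Variables (g : pol) (w : 'I_n.+1 -> 'I_N.+1 -> pol) (u : 'I_n.+1 -> 'rV[K]_N.+1).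
Hypotheses (gY0 : ~ vanishing Y g) (wX : forall a, tangent_field X (w a))
  (wu : forall a b, D (w a) (linform (u b)) = g *+ (a == b))
  (complete : forall y v t, X y -> v \in pline y -> t \in tangent_space X y ->
    g.@[v 0] *: t = \sum_a (linform (u a)).@[t 0] *: field_at (w a) v).

(** In E, [yE] is the generic point of the cone over Y, [cE] consists of free parameters, and [p] is
    the generic tangent vector: the field with coefficients [cE] evaluated at [yE]. *)
Let iota : {rmorphism K -> E} := pi \o (@mpolyC n.+1 pol \o @mpolyC N.+1 K).
Let yE l : E := pi ('X_l)%:MP.
Let cE a : E := pi 'X_a.
Let V l : A := \sum_a 'X_a * (w a l)%:MP.
Let wc (c : 'I_n.+1 -> K) i : pol := \sum_a (c a)%:MP * w a i.
Let p l : E := pi (V l).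

Let pi_ev Q1 Q2 : (forall y v c, Y y -> v != 0 -> v \in pline y -> ev v c Q1 = ev v c Q2) ->
  pi Q1 = pi Q2.
Proof.
move=> Q12; apply/eqP; rewrite -subr_eq0 -rmorphB; apply/eqP/piP => y v c Yy v0 vy.
by rewrite /ev rmorphB /= -!/(ev _ _ _) (Q12 y) // subrr.
Qed.

Let piC f : pi f%:MP = mmap iota yE f.
Proof.
rewrite -{1}[f](mmap_id f).
have := rmorph_mmap (@mpolyC N.+1 K) (pi \o @mpolyC n.+1 pol) (fun i => 'X_i) f.
by rewrite /= => ->.
Qed.

Let pig : pi g%:MP != 0.
Proof.
apply/eqP => /piP gP; apply: gY0 => y Yy; apply: (vanishes_nonzero K0) => v v0 vy.
by have := gP y v (fun=> 0) Yy v0 vy; rewrite evC.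
Qed.

Let wcX c : tangent_field X (wc c).
Proof. exact: tangent_field_lin. Qed.

Let evV v c l : ev v c (V l) = field_at (wc c) v 0 l.
Proof.
rewrite ev_sum mxE rmorph_sum; apply: eq_bigr => a _ /=.
by rewrite evM evX evC mevalM mevalC.
Qed.

Lemma generic_tangent_vanishing (q : pol) :
  (forall w y v, tangent_field X w -> Y y -> v != 0 -> v \in pline y ->
    q.@[(field_at w v) 0] = 0) -> mmap iota p q = 0.
Proof.
move=> qv; transitivity (pi (mmap (@mpolyC n.+1 pol \o @mpolyC N.+1 K) V q)).
  exact/esym/rmorph_mmap.
apply/piP => y v c Yy v0 vy.
rewrite /ev (rmorph_mmap (@mpolyC n.+1 pol \o @mpolyC N.+1 K)).
transitivity (q.@[(field_at (wc c) v) 0]); last exact: qv (wcX c) Yy v0 vy.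
rewrite /meval; transitivity (mmap idfun (fun l => ev v c (V l)) q).
  by apply: eq_bigr => m _; congr (_ * _); rewrite /= mmapC; exact: mevalC.
by apply: mmap_ext => l; apply: evV.
Qed.

Let sigma := parametrized e.+2 w (fun a => 'X_a) h.

Let ev_sigma v c : ev v c sigma = (iter e.+2 (D (wc c)) h).@[v 0].
Proof.
have wcE : (fun i => \sum_a (ev v c 'X_a)%:MP * w a i) = wc c.
  by apply/funext => i; apply: eq_bigr => a _; rewrite evX.
by rewrite /sigma ev_parametrized wcE.
Qed.

(** At each point of Y, g times a tangent field w' is a combination of the frame. If sigma were
    zero, g D_w'^(e+2) h would vanish on Y for every w', and polarization would raise the order of h
    to e + 3. *)
Let sigma0 : pi sigma != 0.
Proof.
apply/eqP => /piP sP; apply: nhe; apply: (vorder_polarize K0 he) => w' w'X.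
suff : vanishing Y (g * iter e.+2 (D w') h) by case/vanishing_orY.
move=> y Yy; apply: (vanishes_nonzero K0) => v vn0 vy; rewrite mevalM.
have t := tangent_field_at w'X (YX Yy) vn0 vy.
pose c a := (linform (u a)).@[(field_at w' v) 0].
have wc_at : field_at (wc c) v = g.@[v 0] *: field_at w' v.
  by rewrite field_at_lin (complete (YX Yy) vy t).
have := iterD_at Yy vy w'X (wcX c) wc_at he.
rewrite -ev_sigma (sP y v c Yy vn0 vy) => /esym/eqP.
rewrite mulf_eq0 expf_eq0 /= => /orP[/eqP ->|/eqP ->]; first by rewrite mul0r.
by rewrite mulr0.
Qed.

Let S : set E := range p.
Let span := mspan iota S yE.

(** Each derivative adds G' to the degree in y and removes 1, so that j of them leave d + j G' -
    j. *)
Let span_parametrized j w' c' G' d f :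
  (forall a, cl iota S (pi (c' a))) -> (forall a i, w' a i \is G'.-homog) ->
  f \is d.-homog -> span j (d + j * G') (pi (parametrized j w' c' f)).
Proof.
move=> clc w'G; elim: j d f => [|j IH] d f fd /=.
  by rewrite piC mul0n; apply: mspan_homog.
rewrite rmorph_sum; apply: mspan_sum => a _ /=; rewrite rmorphM; apply: mspanZ; first exact: clc.
case: d fd => [|d] fd.
  by rewrite (dhomog0_const fd) D_const parametrized0 rmorph0; apply: mspan0.
have := mspanS' (IH _ _ (D_homog (w'G a) fd)); congr (span _ _ _).
by rewrite mulSn addSn addnA [(d + G')%N]addnC.
Qed.

(* The multipliers that trade the k-th derivative of h, for k = e + 2, against  *)
(* a loss of e + 1 in the degree of the coordinates on Y.                     *)
Let J : set pol := [set q | forall d, span e.+1 d (pi sigma * pi (pihomog mdeg d q)%:MP)].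

Let J_ideal : ideal J.
Proof.
split=> [d|q1 q2 J1 J2 d|q1 q2 J2].
- by rewrite raddf0 mpolyC0 rmorph0 mulr0; apply: mspan0.
- by rewrite raddfD /= mpolyCD rmorphD /= mulrDr; apply: mspanD; [apply: J1|apply: J2].
move: q2 J2; apply: (mpoly_ringind (P := fun q => forall f, J f -> J (q * f))) q1 =>
  [c|i|q q' IHq IHq'|q q' IHq IHq'] f Jf.
- move=> d; have -> : pihomog mdeg d (c%:MP * f) = c%:MP * pihomog mdeg d f.
    by rewrite !mul_mpolyC linearZ.
  rewrite mpolyCM rmorphM mulrCA; apply: mspanZ; last exact: Jf.
  exact: (cl_const iota).
- move=> [|d]; rewrite pihomog_mulX; first by rewrite mpolyC0 rmorph0 mulr0; apply: mspan0.
  by rewrite mpolyCM rmorphM mulrCA; apply: (mspan_X i (Jf d)).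
- move=> d; rewrite mulrDl raddfD /= mpolyCD rmorphD /= mulrDr.
  by apply: mspanD; [apply: (IHq _ Jf)|apply: (IHq' _ Jf)].
- by rewrite -mulrA; apply: (IHq); apply: IHq'.
Qed.

Let vanishing_J q : vanishing Y q -> J q.
Proof.
move=> qY d; have -> : pi (pihomog mdeg d q)%:MP = 0.
  apply/piP => y v c Yy v0 vy; rewrite evC.
  exact: (vanishing_pihomog K0 d qY Yy vy).
by rewrite mulr0; apply: mspan0.
Qed.

(* A change of frame multiplies the field by g', hence the k-th derivative by  *)
(* g' ^+ k; the derivative computed in the new frame has degree k G' - (k - 1)*)
(* in the coordinates on Y.                                                   *)
Let frame_J y : Y y -> exists d f, [/\ f \is d.-homog, J f & ~ vanishes_at f y].
Proof.
move=> Yy; have [v v0 yE'] := proj_span y.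
have vy : v \in pline y by rewrite yE' memv_line.
have [g' [G' [w' [u' [gv [gG wG] w'X _ complete']]]]] := tangent_frame K0 irrX dimT (YX Yy) v0 vy.
have gk : g' ^+ e.+2 \is (e.+2 * G').-homog by rewrite mulnC; apply: dhomogMn.
exists (e.+2 * G')%N, (g' ^+ e.+2); split=> //; last first.
  by move=> /(_ v vy); rewrite rmorphXn /= => /eqP; rewrite expf_eq0 (negPf gv) andbF.
pose U a : A := \sum_l ((u' a 0 l)%:MP)%:MP * V l.
have clU a : cl iota S (pi (U a)).
  rewrite rmorph_sum; apply: cl_sum => l _ /=; rewrite rmorphM; apply: clM.
    exact: (cl_const iota).
  by apply: sub_cl; exists l.
have evU z c a : ev z c (U a) = (linform (u' a)).@[(field_at (wc c) z) 0].
  rewrite ev_sum meval_linform; apply: eq_bigr => l _.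
  by rewrite evM !evC mevalC evV.
have change : pi g'%:MP ^+ e.+2 * pi sigma = pi (parametrized e.+2 w' U h).
  rewrite -!rmorphXn -rmorphM; apply: pi_ev => x z c Yx z0 zx.
  rewrite evM ev_sigma ev_parametrized evC rmorphXn /=; symmetry.
  have t := tangent_field_at (wcX c) (YX Yx) z0 zx.
  apply: (iterD_at Yx zx (wcX c)) he; first exact: tangent_field_lin.
  rewrite field_at_lin (complete' x z _ (YX Yx) zx t).
  by apply: eq_bigr => a _; rewrite evU.
move=> d; case: (eqVneq d (e.+2 * G')%N) => [->|dn]; last first.
  by rewrite (pihomog_ne0 _ gk) ?mpolyC0 ?rmorph0 ?mulr0 1?eq_sym //; apply: mspan0.
rewrite (pihomog_dE gk) !rmorphXn mulrC change; apply: mspanS.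
by apply: (span_parametrized e.+2 clU wG (d := 1)); exact: linform_homog.
Qed.

(** J has no common zero in P^N: [frame_J] excludes the points of Y, and the equations of Y exclude
    the others. The Nullstellensatz is applied to a prime avoiding the powers of X_i. *)
Let power_J i : exists j, J ('X_i ^+ j).
Proof.
apply: contrapT => /forallNP nJ.
have [Q [Q_prime JQ nQ]] := prime_avoiding_powers J_ideal nJ.
have [v [vi vQ]] := nullstellensatz K0 Q_prime nQ.
have v0 : v != 0 by apply: contraNneq vi => ->; rewrite mevalXU mxE.
have [x xE] := span_proj v0.
have vx : v \in pline x by rewrite xE memv_line.
have [Yx|nYx] := pselect (Y x).
  have [d [f [fd Jf]]] := frame_J Yx; apply.
  by apply: (vanishes_homog fd v0 vx); apply: vQ; apply: JQ.
have [Yc _ _] := irrY; have [d [f [fd fY nf]]] := zclosedN Yc nYx.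
apply: nf; apply: (vanishes_homog fd v0 vx); apply: vQ; apply: JQ.
exact: vanishing_J.
Qed.

Let monomials_J : exists M, forall b : 'X_{1..N.+1}, mdeg b = M -> J 'X_[b].
Proof.
have /choice[j jJ] := power_J; have [_ _ JM] := J_ideal.
(* A monomial of degree above the sum of the j_i is divisible by some X_i^(j_i). *)
exists (\sum_i j i).+1 => b bM.
have [i ij] : exists i, (j i <= b i)%N.
  apply: contrapT => /forallNP bj; have : (mdeg b <= \sum_i j i)%N.
    by rewrite mdegE; apply: leq_sum => i _; have /negP := bj i; rewrite -ltnNge; apply: ltnW.
  by rewrite bM ltnn.
have -> : b = (b - U_(i) *+ j i + U_(i) *+ j i)%MM.
  apply/mnmP => l; rewrite mnmDE mnmBE mulmnE mnm1E; case: eqP => [<-|_].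
    by rewrite mul1n subnK.
  by rewrite mul0n addn0 subn0.
by rewrite mpolyXD; apply: (JM); rewrite -mpolyXn; apply: jJ.
Qed.

Let y_basepoint : exists i, yE i != 0.
Proof.
have [_ [y Yy] _] := irrY; have [v v0 yE'] := proj_span y.
have vy : v \in pline y by rewrite yE' memv_line.
apply: contrapT => /forallNP y0; move/negP: (v0); apply; apply/eqP/rowP => l.
have /negP := y0 l; rewrite negbK => /eqP/piP/(_ y v (fun=> 0) Yy v0 vy).
by rewrite evC mevalXU mxE.
Qed.

(** Multiplication by sigma lowers the degree of monomials in y by e + 1 and y_i^(e+1) restores it,
    so the product preserves the span of the monomials of degree M. *)
Let cl_sigma_y i : cl iota S (pi sigma * yE i ^+ e.+1).
Proof.
have [M MJ] := monomials_J.
apply: (mspan_stable (d := M) y_basepoint).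
move=> b bM; rewrite -mulrA mulrCA; apply: mspan_fill.
have := MJ b bM M; rewrite pihomog_dE; last by rewrite dhomogX /= bM.
by rewrite piC mmapX.
Qed.

(** Fixing the values of the parameters in a relation leaves a relation between the [gY] on Y, which
    is trivial. *)
Let aindep_yc : aindep iota (fun i : 'I_(r.+1 + n.+1) =>
  match fintype.split i with inl j => pi (gY j)%:MP | inr a => cE a end).
Proof.
move=> q q0; apply: (mpoly_eval0 K0) => z.
pose z1 (j : 'I_r.+1) := z (lshift n.+1 j); pose c (a : 'I_n.+1) := z (rshift r.+1 a).
pose sp : {mpoly K[r.+1]} := mmap (@mpolyC r.+1 K) (fun i =>
  match fintype.split i with inl j => 'X_j | inr a => (c a)%:MP end) q.
pose Q : A := mmap (@mpolyC n.+1 pol \o @mpolyC N.+1 K) (fun i =>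
  match fintype.split i with inl j => (gY j)%:MP | inr a => 'X_a end) q.
have PQ : P Q.
  apply/piP; rewrite -[RHS]q0 /Q (rmorph_mmap (@mpolyC n.+1 pol \o @mpolyC N.+1 K)).
  by apply: mmap_ext => i /=; case: fintype.split.
have sp0 : sp = 0.
  apply: gY_indep => y Yy; apply: (vanishes_nonzero K0) => v v0 vy.
  rewrite -(PQ y v c Yy v0 vy) /ev /Q (rmorph_mmap (@mpolyC n.+1 pol \o @mpolyC N.+1 K)).
  rewrite [sp]/(mmap _ _ _) /subst.
  rewrite (rmorph_mmap (@mpolyC r.+1 K) (mmap (@mpolyC N.+1 K) gY)).
  rewrite (rmorph_mmap (mmap (@mpolyC N.+1 K) gY \o @mpolyC r.+1 K)).
  apply: mmap_eq => [x|i] /=; first by rewrite !mmapC /= !mevalC.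
  by case: fintype.split => [j|a] /=; rewrite !(mmapX, mmap1U, mmapC) ?mevalC.
have : sp.@[z1] = 0 by rewrite sp0 meval0.
rewrite (rmorph_mmap (@mpolyC r.+1 K) (meval z1)) => <-.
apply: mmap_eq => [x|i] /=; first by rewrite mevalC.
case: (fintype.splitP i) => [j|a] ij.
  by rewrite mevalXU; congr z; apply: val_inj.
by rewrite mevalC; congr z; apply: val_inj.
Qed.

(* The generic tangent vector, together with one coordinate of the point of   *)
(* tangency, generates up to algebraic elements the function field of the     *)
(* tangent bundle over the cone on Y, of transcendence degree r + n + 2.      *)
Lemma generic_tangent_rank : exists I : 'I_(r + n).+1 -> 'I_N.+1, aindep iota (p \o I).
Proof.
have [i0 yi0] := y_basepoint.
pose S' : set E := range p `|` [set` [:: yE i0]].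
have clS' : cl iota S `<=` cl iota S' by apply: cl_mono => z ?; left.
have cly i : cl iota S' (yE i).
  (* Dividing two instances of [cl_sigma_y] eliminates sigma; as e + 1 > 0, a root can be taken. *)
  have cli : cl iota S (yE i / yE i0).
    have cq : cl iota S ((yE i / yE i0) ^+ e.+1).
      have := cl_div (cl_sigma_y i) (cl_sigma_y i0).
      by rewrite -mulf_div divff // mul1r expr_div_n.
    apply: (@algebraic_cl _ _ _ _ ('X^(e.+1) - ((yE i / yE i0) ^+ e.+1)%:P)).
    - by rewrite monic_neq0 // monicXnsubC.
    - move=> l; rewrite coefB coefXn coefC; apply: clB.
        by case: eqP => _; [apply: cl1|apply: cl0].
      by case: eqP => _; [apply: cq|apply: cl0].
    - by rewrite rootE !hornerE subrr.
  rewrite -[yE i](divfK yi0); apply: clM; first by apply: clS'.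
  by apply: sub_cl; right; rewrite /= inE.
have clc a : cl iota S' (cE a).
  (* By duality of the frame, u_a takes the value c_a g on the generic tangent vector, so c_a is
     recovered from p and y. *)
  have cu : \sum_l ((u a 0 l)%:MP)%:MP * V l = 'X_a * g%:MP.
    transitivity (\sum_b 'X_b * (D (w b) (linform (u a)))%:MP : A).
      under eq_bigr do rewrite mulr_sumr.
      rewrite exchange_big; apply: eq_bigr => b _ /=.
      rewrite D_linform rmorph_sum mulr_sumr; apply: eq_bigr => l _ /=.
      by rewrite mulrCA -mpolyCM.
    rewrite (bigD1 a) //= wu eqxx big1 ?addr0 // => b ba.
    by rewrite wu (negPf ba) mulr0n mpolyC0 mulr0.
  have -> : cE a = (\sum_l iota (u a 0 l) * p l) / pi g%:MP.
    apply: (mulIf pig); rewrite divfK //.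
    rewrite -[LHS]rmorphM -cu rmorph_sum; apply: eq_bigr => l _ /=.
    by rewrite rmorphM.
  apply: cl_div; last by rewrite piC; apply: cl_mmap.
  apply: cl_sum => l _; apply: clM; first exact: cl_const.
  by apply: clS'; apply: sub_cl; exists l.
(* Of the r + n + 2 independent elements, the adjoined coordinate [yE i0] accounts for at most
   one. *)
apply: (aindep_choose aindep_yc (z := [:: yE i0])); last by rewrite addn1 addnS.
move=> i; case: fintype.split => [j|a]; last exact: clc.
by rewrite piC; apply: cl_mmap.
Qed.

End Frame.

Lemma tangent_variety_generic_point : exists (E : fieldType) (f : {rmorphism K -> E})
    (p : 'I_N.+1 -> E),
  (exists I : 'I_(r + n).+1 -> 'I_N.+1, aindep f (p \o I)) /\
  forall q : pol, (forall w y v, tangent_field X w -> Y y -> v != 0 -> v \in pline y ->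
    q.@[(field_at w v) 0] = 0) -> mmap f p q = 0.
Proof.
have [e [he nhe]] := exact_vorder.
have [E [pi piP]] := residue_field P_prime.
have [_ [y Yy] _] := irrY; have [v v0 yE] := proj_span y.
have vy : v \in pline y by rewrite yE memv_line.
have [g [G [w [u [gv _ wX wu complete]]]]] := tangent_frame K0 irrX dimT (YX Yy) v0 vy.
have gY0 : ~ vanishing Y g by move=> /(_ y Yy v vy)/eqP; rewrite (negPf gv).
have [I indI] := generic_tangent_rank piP he nhe gY0 wX wu complete.
do 3!eexists; split; first by exists I; exact: indI.
by move=> q qv; apply: (generic_tangent_vanishing piP wX qv).
Qed.

End Estimate.

(** * Tangency *)

Section Tangency.
Variables (K : closedFieldType) (N : nat).
Hypothesis K0 : [pchar K] =i pred0.
Local Notation pol := {mpoly K[N.+1]}.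
Implicit Types (X Y Z : set (proj K N)) (L : {vspace 'rV[K]_N.+1}).

Lemma indep_on_size Z d (g : 'I_d -> pol) : irreducible Z -> indep_on Z g -> (d <= N.+1)%N.
Proof.
move=> irrZ gZ; have [F [f [a aP]]] := generic_point K0 irrZ.
have ai : aindep f (fun i => mmap f a (g i)).
  by move=> q; rewrite -mmap_subst => /aP/gZ.
rewrite -[N.+1]card_ord -(size_codom a); apply: (aindep_size ai) => i.
by apply: cl_mmap => l; apply: sub_cl; exact: codom_f.
Qed.

Lemma irr_flag_sub (W : nat -> set (proj K N)) d i : irr_flag W d -> (i <= d)%N -> W i `<=` W d.
Proof.
elim: d => [|d IH] [Wirr Wlt]; first by rewrite leqn0 => /eqP ->.
rewrite leq_eqVlt ltnS => /orP[/eqP -> //|/IH id].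
apply: (@subset_trans _ (W d)); last by have [] := Wlt d (ltnSn d).
by apply: id; split=> [j /leqW/Wirr|j /ltnW/Wlt].
Qed.

Lemma irred_chain_flag Z k : irred_chain Z k -> exists Z' (g : 'I_k.+1 -> pol),
  [/\ irreducible Z', Z' `<=` Z & indep_on Z' g].
Proof.
move=> [W [Wirr Wlt]]; have [|g gW] := @flag_indep _ _ K0 W k.
  by split=> [i /Wirr[]|].
by have [irrW sub] := Wirr k (leqnn k); exists (W k), g.
Qed.

(** Chain lengths are at most N, as there are at most N + 1 independent functions; hence a longest
    chain exists and [pdim] does not take its default value. *)
Lemma irred_chain_dim Z k : irred_chain Z k -> exists2 d, (k <= d)%N & is_dim Z d.
Proof.
move=> Zk; have exd : exists d, `[< irred_chain Z d >] by exists k; apply/asboolP.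
have ub d : `[< irred_chain Z d >] -> (d <= N)%N.
  move=> /asboolP/irred_chain_flag[Z' [g [irrZ _ gZ]]].
  exact: (indep_on_size irrZ gZ).
case: (ex_maxnP exd ub) => d /asboolP Zd dmax; exists d; first by apply/dmax/asboolP.
by split=> // j Zj; apply/dmax/asboolP.
Qed.

Lemma coordinate_linforms L : exists s : 'I_(\dim L) -> 'rV[K]_N.+1,
  {in L, forall (t : 'rV[K]_N.+1) i,
  t 0 i = \sum_j (linform (s j)).@[t 0] * (vbasis L)`_j 0 i}.
Proof.
exists (fun j => \row_l coord (vbasis L) j (delta_mx 0 l)) => t tL i.
rewrite [in LHS](coord_vbasis tL) summxE; apply: eq_bigr => j _.
rewrite mxE; congr (_ * _); rewrite meval_linform {1}[t]matrix_sum_delta big_ord1.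
rewrite linear_sum /=; apply: eq_bigr => l _.
by rewrite linearZ /= mulrC mxE.
Qed.

Section Bounds.
Variables (X Y : set (proj K N)) (n r m : nat).
Hypotheses (irrX : irreducible X)
  (dimT : forall x, X x -> \dim (tangent_space X x) = n.+1)
  (dimX : is_dim X n) (YX : Y `<=` X) (irrY : irreducible Y).
Variable gY : 'I_r.+1 -> pol.
Hypothesis gY_indep : indep_on Y gY.
Hypothesis ndX : non_degenerate X.
Variable L : {vspace 'rV[K]_N.+1}.
Hypotheses (dimL : \dim L = m.+1) (mN : (m < N)%N) (tangL : tangent_along L X Y).

Lemma tangency_bounds :
  (r + n <= m)%N /\ exists2 d, (r + n < d)%N & is_dim (secant_variety X) d.
Proof.
have [|s [sL sX]] := @hyperplane_through _ _ X L ndX; first by rewrite dimL.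
have X2 x : exists2 y, X y & y != x.
  by apply: non_degenerate_two => //; apply: leq_ltn_trans mN.
have sT y t : Y y -> t \in tangent_space X y -> (linform s).@[t 0] = 0.
  by move=> Yy ty; apply: sL; apply: (subvP (tangL Yy)).
have [E [f [p [[I indI] pv]]]] :=
  tangent_variety_generic_point K0 irrX dimT dimX YX irrY gY_indep sT sX.
have pL (q : pol) : (forall t : 'rV[K]_N.+1, t \in L -> q.@[t 0] = 0) -> mmap f p q = 0.
  move=> qL; apply: pv => w y v wX Yy v0 vy; apply: qL; apply: (subvP (tangL Yy)).
  exact: (tangent_field_at wX (YX Yy) v0 vy).
split.
  have [u uL] := coordinate_linforms L.
  (* First bound: p satisfies the equations of L, so its coordinates are linear combinations of the
     values of m + 1 linear forms. *)
  rewrite -ltnS -dimL -[X in (_ <= X)%N]card_ord.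
  rewrite -(size_codom (fun j => mmap f p (linform (u j)))).
  apply: (aindep_size indI) => i /=.
  have -> : p (I i) = \sum_j mmap f p (linform (u j)) * f ((vbasis L)`_j 0 (I i)).
    apply/eqP; rewrite -subr_eq0; apply/eqP.
    rewrite -[RHS](pL ('X_(I i) - \sum_j linform (u j) * ((vbasis L)`_j 0 (I i))%:MP)).
      rewrite rmorphB rmorph_sum /= mmapX mmap1U; congr (_ - _).
      by apply: eq_bigr => j _; rewrite rmorphM /= mmapC.
    move=> t tL; rewrite mevalB mevalXU (uL t tL) rmorph_sum /= -sumrB big1 // => j _.
    by rewrite mevalM mevalC subrr.
  apply: cl_sum => j _; apply: clM; last exact: cl_const.
  by apply: sub_cl; exact: codom_f.
(* Second bound: T lies in SX and in the hyperplane of s, while X does not lie in the latter; so a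
   chain of length r + n ending in T is prolonged by SX. *)
pose T := locus f p.
have p0 : exists i, p i != 0.
  exists (I ord0); apply/eqP => pI0; have := indI 'X_ord0.
  rewrite mmapX mmap1U /= pI0 => /(_ erefl)/(congr1 (mcoeff U_(ord0)%MM)).
  by rewrite mcoeffX eqxx mcoeff0 => /eqP; rewrite oner_eq0.
have irrT : irreducible T := locus_irreducible K0 f p0.
have irrS := secant_irreducible K0 X2 irrX.
have secS : secant_set X `<=` secant_variety X by move=> z Sz B [_ SB]; apply: SB.
have TS : T `<=` secant_variety X.
  move=> x Tx; apply: contrapT => nSx; have [cS _ _] := irrS.
  have [d [q [qd qS]]] := zclosedN cS nSx; apply; apply: (Tx d q qd).
  apply: pv => w y v wX Yy v0 vy.
  by apply: (secant_tangent K0 X2 qd _ wX (YX Yy) vy) => z /secS; apply: qS.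
have sT0 : vanishing T (linform s).
  by move=> x Tx; apply: (Tx 1%N); [exact: linform_homog|exact: pL].
have indT : indep_on T (fun i => 'X_(I i)).
  move=> q /(vanishing_locus K0 f p0)/mmap_homog_components/(_ 1) q0; apply: indI.
  rewrite -[RHS]q0 mmap_subst; apply: mmap_ext => i /=.
  by rewrite mmapX mmap1U mul1r.
have [W [Wflag WT]] := indep_flag K0 irrT indT; have [Wirr Wlt] := Wflag.
apply: (@irred_chain_dim _ (r + n).+1).
have WTi i : (i <= r + n)%N -> W i `<=` T.
  by rewrite -WT; exact: irr_flag_sub.
exists (fun i => if (i <= r + n)%N then W i else secant_variety X); split=> i.
  case: (leqP i (r + n)) => [irn _|_ _]; last by split.
  by split; [exact: Wirr|move=> x /(WTi _ irn)/TS].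
rewrite ltnS => irn; rewrite irn; case: (ltnP i (r + n)) => [/Wlt //|rni].
have -> : i = (r + n)%N by apply/eqP; rewrite eqn_leq irn.
rewrite WT; split=> // ST; apply: sX => x Xx; apply: sT0; apply: ST; apply: secS.
exact: sub_secant_set.
Qed.

End Bounds.
End Tangency.

Theorem theorem1 (R : realType) (N n m r : nat)
    (X Y : set (proj R[i] N)) (L : {vspace 'rV[R[i]]_N.+1})
    (manifold_X : manifold X) (nondegenerate_X : non_degenerate X)
    (dim_X : pdim X = n%:Z)
    (dim_L : \dim L = m.+1) (proper_L : (m < N)%N)
    (closed_Y : zclosed Y) (sub_YX : Y `<=` X) (dim_Y : pdim Y = r%:Z)
    (tangent_L : tangent_along L X Y) :
  r%:Z <= Num.min (m%:Z - n%:Z) (pdim (secant_variety X) - 1 - n%:Z).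
Proof.
have K0 : [pchar R[i]] =i pred0 := @pchar_num _.
have [irrX smoothX] := manifold_X.
have dimT x : X x -> \dim (tangent_space X x) = n.+1.
  by move=> /smoothX; rewrite dim_X -PoszD addn1 => -[].
have dimX : is_dim X n by apply/pdimP.
(* Y may be reducible: it is replaced by the last member Y' of a chain of length r in Y, which
   carries r + 1 independent functions. *)
have [/irred_chain_flag[//|Y' [g [irrY Y'Y gY]]] _] : is_dim Y r by apply/pdimP.
have [rm [d rd /pdimP ->]] := tangency_bounds K0 irrX dimT dimX
  (subset_trans Y'Y sub_YX) irrY gY nondegenerate_X dim_L proper_L
  (fun y Yy => tangent_L y (Y'Y y Yy)).
rewrite le_min !lerBrDr -!PoszD !lez_nat rm addn1; exact: rd.
Qed.
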